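(* In the setting described in the context (with $I_{\mathrm{ra}}\neq\emptyset$), put $$\hat\omega'=\sum_{j=1}^{n-3}d\Big(\frac{p_j}{P(q_j;\boldsymbol t)}-\sum_{i=1}^{\nu}\frac{D_i(q_j;\boldsymbol t,\boldsymbol\theta)}{(q_j-t_i)^{n_i}}-D_\infty(q_j;\boldsymbol t,\boldsymbol\theta)\Big)\wedge dq_j+\sum_{i\in I_{\mathrm{un}}}\sum_{l=0}^{n_i-2}\Big(dH_{\theta^+_{l,t_i}}\wedge d\theta^+_{l,t_i}+dH_{\theta^-_{l,t_i}}\wedge d\theta^-_{l,t_i}\Big)$$ $$\qquad+\sum_{i\in I_{\mathrm{ra}}}\sum_{l'=0}^{2n_i-3}dH_{\theta_{l',t_i}}\wedge d\theta_{l',t_i}+\sum_{i\in\{3,4,\dots,\nu\}\cap(I_{\mathrm{reg}}\cup I_{\mathrm{un}})}dH_{t_i}\wedge dt_i ,$$ a $2$-form on $\widehat{\mathcal M}_{\boldsymbol t_{\mathrm{ra}}}\times T_{\boldsymbol\theta}$. Let $\hat\omega$ be the $2$-form on $\widehat{\mathcal M}_{\boldsymbol t_{\mathrm{ra}}}\times T_{\boldsymbol\theta}$ defined in the context by residues. Then the difference $\hat\omega-\hat\omega'$ is a section of $\pi^*\big(\Omega^2_{(T_{\boldsymbol t})_{\boldsymbol t_{\mathrm{ra}}}\times T_{\boldsymbol\theta}}\big)$.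
   Context: **Setting.** Let $\nu\ge2$, $I=\{1,\dots,\nu,\infty\}$, $t_1=0$, $t_2=1$, $t_\infty=\infty\in\mathbb P^1$. Let $n_i\ge1$ ($i\in I$) be integers, $n=\sum_{i\in I}n_i$, and $I=I_{\mathrm{reg}}\sqcup I_{\mathrm{un}}\sqcup I_{\mathrm{ra}}$ with $n_i=1$ for $i\in I_{\mathrm{reg}}$, $n_i>1$ for $i\in I_{\mathrm{un}}\cup I_{\mathrm{ra}}$; assume $I_{\mathrm{ra}}\ne\emptyset$. Let $x$ be the affine coordinate on $U_0=\mathbb P^1\setminus\{\infty\}$, $w=1/x$ the coordinate on $U_\infty=\mathbb P^1\setminus\{0\}$; $x_{t_i}=x-t_i$ ($i\ne\infty$), $x_{t_\infty}=w$. Fix $\boldsymbol t_{\mathrm{ra}}=(t_i)_{i\in\{3,\dots,\nu\}\cap I_{\mathrm{ra}}}$, pairwise distinct and $\notin\{0,1\}$. $(T_{\boldsymbol t})_{\boldsymbol t_{\mathrm{ra}}}$ is the set of $\boldsymbol t=(t_3,\dots,t_\nu)$ with pairwise distinct entries $\notin\{0,1\}$ whose entries with index in $I_{\mathrm{ra}}$ are the prescribed ones. $T_{\boldsymbol\theta}$ is the set of tuples $\boldsymbol\theta$ of complex numbers $\theta^\pm_{l,t_i}$ ($i\in I_{\mathrm{un}},0\le l\le n_i-2$), $\theta_{l',t_i}$ ($i\in I_{\mathrm{ra}},0\le l'\le 2n_i-3$) with $\theta^+_{0,t_i}\neq\theta^-_{0,t_i}$ ($i\in I_{\mathrm{un}}$),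 $\theta_{1,t_i}\ne0$ ($i\in I_{\mathrm{ra}}$). Fix constants $\boldsymbol\theta_0=((\theta^\pm_{n_i-1,t_i})_{i\in I_{\mathrm{reg}}\cup I_{\mathrm{un}}},(\theta_{2n_i-2,t_i})_{i\in I_{\mathrm{ra}}})$ with $\sum_{i\in I_{\mathrm{reg}}\cup I_{\mathrm{un}}}(\theta^+_{n_i-1,t_i}+\theta^-_{n_i-1,t_i})+\sum_{i\in I_{\mathrm{ra}}}(\theta_{2n_i-2,t_i}-\frac12)=-1$ and $\theta^+_{0,t_i}-\theta^-_{0,t_i}\notin\mathbb Z$ for $i\in I_{\mathrm{reg}}$. $\widehat{\mathcal M}_{\boldsymbol t_{\mathrm{ra}}}$ is the set of $(\{(q_1,p_1),\dots,(q_{n-3},p_{n-3})\},\boldsymbol t)\in\mathrm{Sym}^{(n-3)}(\mathbb C^2)\times(T_{\boldsymbol t})_{\boldsymbol t_{\mathrm{ra}}}$ with the $q_j$ pairwise distinct and $q_j\notin\{0,1,t_3,\dots,t_\nu,\infty\}$; $\pi:\widehat{\mathcal M}_{\boldsymbol t_{\mathrm{ra}}}\times T_{\boldsymbol\theta}\to(T_{\boldsymbol t})_{\boldsymbol t_{\mathrm{ra}}}\times T_{\boldsymbol\theta}$ is the projection. $P(x)=P(x;\boldsymbol t)=\prod_{i=1}^\nu(x-t_i)^{n_i}$. **Bundles, local data.** $E_k=\mathcal O_{\mathbb P^1}\oplus\mathcal O_{\mathbb P^1}(k)$ is given by trivializations on $U_0,U_\infty$ with transition matrix $G_k=\mathrm{diag}(1,x^k)$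 from $U_\infty$ to $U_0$; a connection $d+\Omega$ on $U_0$ reads $d+G_k^{-1}dG_k+G_k^{-1}\Omega G_k$ on $U_\infty$. Local formal data at $t_i$ of a connection matrix $\Omega$ (the one on $U_\infty$ if $i=\infty$): for $i\in I_{\mathrm{reg}}\cup I_{\mathrm{un}}$, $(\theta^\pm_{l,t_i})_{0\le l\le n_i-1}$ if some $M\in GL_2(\mathbb C[[x_{t_i}]])$ gives $M^{-1}dM+M^{-1}\Omega M=\sum_{l=0}^{n_i-1}\mathrm{diag}(\theta^+_{l,t_i},\theta^-_{l,t_i})x_{t_i}^{-n_i+l}dx_{t_i}$; for $i\in I_{\mathrm{ra}}$, $(\theta_{l',t_i})_{0\le l'\le2n_i-2}$ if some such $M$ gives $M^{-1}dM+M^{-1}\Omega M=\begin{pmatrix}\alpha&\beta\\ x_{t_i}\beta&\alpha-\frac{dx_{t_i}}{2x_{t_i}}\end{pmatrix}$ with $\alpha=\sum_{l=0}^{n_i-1}\frac{\theta_{2l,t_i}}2x_{t_i}^{-n_i+l}dx_{t_i}$, $\beta=\sum_{l=0}^{n_i-2}\frac{\theta_{2l+1,t_i}}2x_{t_i}^{-n_i+l}dx_{t_i}$. **Normal form (Diarra–Loray).** For each point of $\widehat{\mathcal M}_{\boldsymbol t_{\mathrm{ra}}}\times T_{\boldsymbol\theta}$ there is a unique connection $d+\widehat\Omega^{(n-2)}$ on $E_{n-2}$, with $\widehat\Omega^{(n-2)}=\begin{pmatrix}0&1/P(x)\\ c_0(x)&d_0(x)\end{pmatrix}dx$ on $U_0$,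 $$c_0=\sum_{i=1}^\nu\frac{C_i(x)}{(x-t_i)^{n_i}}+\sum_{j=1}^{n-3}\frac{p_j}{x-q_j}+\tilde C(x)+x^{n-3}C_\infty(x),\qquad d_0=\sum_{i=1}^\nu\frac{D_i(x)}{(x-t_i)^{n_i}}-\sum_{j=1}^{n-3}\frac1{x-q_j}+D_\infty(x),$$ polynomials $C_i,D_i,C_\infty,D_\infty,\tilde C$ with $\deg C_i,\deg D_i\le n_i-1$ ($i\le\nu$), $\deg C_\infty\le n_\infty-1$, $\deg D_\infty\le n_\infty-2$, $\deg\tilde C\le n-4$, such that (a) each $q_j$ is an apparent singularity, i.e. with $\tilde\Phi_{q_j}=\begin{pmatrix}1&0\\ p_j&x-q_j\end{pmatrix}$ the matrix $\tilde\Phi_{q_j}^{-1}d\tilde\Phi_{q_j}+\tilde\Phi_{q_j}^{-1}\widehat\Omega^{(n-2)}\tilde\Phi_{q_j}$ has no pole at $q_j$, and (b) its local formal data at every $t_i$ is given by $(\boldsymbol\theta,\boldsymbol\theta_0)$. The $D_i$ depend only on $(\boldsymbol t,\boldsymbol\theta)$ and $x$; write $D_i(x;\boldsymbol t,\boldsymbol\theta)$. Write $\widehat\Omega^{(n-2)}_\infty=G_{n-2}^{-1}dG_{n-2}+G_{n-2}^{-1}\widehat\Omega^{(n-2)}G_{n-2}$; at $i=\infty$ this matrix is used in place of $\widehat\Omega^{(n-2)}$ throughout. **Formal solutions, $i\in I_{\mathrm{reg}}\cup I_{\mathrm{un}}$.** Let $\Phi_i\in GL_2$ (compatible framing), depending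 only on $(\boldsymbol t,\boldsymbol\theta)$, be such that $\Phi_i^{-1}\widehat\Omega^{(n-2)}\Phi_i$ has leading coefficient $\mathrm{diag}(\theta^+_{0,t_i},\theta^-_{0,t_i})$ of $x_{t_i}^{-n_i}dx_{t_i}$. There are unique functions $\theta^\pm_{l,t_i}$ ($l\ge n_i$) and a unique formal series $\Xi_i=\mathrm{id}+\sum_{s\ge1}\begin{pmatrix}0&*\\ *&0\end{pmatrix}x_{t_i}^s$ such that $\psi_i=\Phi_i\Xi_i\exp(-\Lambda_i)$, $\Lambda_i=\mathrm{diag}(\hat\lambda_i^+,\hat\lambda_i^-)$, $\hat\lambda_i^\pm=\sum_{l\ge0}\theta^\pm_{l,t_i}\int x_{t_i}^{-n_i+l}dx_{t_i}$, formally solves $(d+\widehat\Omega^{(n-2)})\psi_i=0$. **Formal solutions, $i\in I_{\mathrm{ra}}$.** Put $x_{t_i}=\zeta_i^2$, $M_{\zeta_i}=\begin{pmatrix}1&1\\ \zeta_i&-\zeta_i\end{pmatrix}$. A compatible framing $\Phi_i\in GL_2$ is a matrix depending only on $(\boldsymbol t,\boldsymbol\theta)$ such that $\Phi_i^{-1}\widehat\Omega^{(n-2)}\Phi_i$ has leading coefficient $\begin{pmatrix}\theta_{0,t_i}/2&\theta_{1,t_i}/2\\ 0&\theta_{0,t_i}/2\end{pmatrix}$; take it such that there are (unique) functions $\theta_{l',t_i}$ ($l'\ge2n_i-1$) and a (unique) formal series $\Xi_i(x_{t_i})=\mathrm{id}+O(x_{t_i})$ with: (1) the gauge transform of $\widehat\Omega^{(n-2)}$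 by $\Phi_i\Xi_i$ is $\begin{pmatrix}\alpha_i&\beta_i\\ x_{t_i}\beta_i&\alpha_i-\frac{dx_{t_i}}{2x_{t_i}}\end{pmatrix}$ with $\alpha_i=\sum_{l\ge0}\frac{\theta_{2l,t_i}}2x_{t_i}^{-n_i+l}dx_{t_i}$, $\beta_i=\sum_{l\ge0}\frac{\theta_{2l+1,t_i}}2x_{t_i}^{-n_i+l}dx_{t_i}$; (2) $M_{\zeta_i}^{-1}\Xi_i(\zeta_i^2)M_{\zeta_i}=\begin{pmatrix}1&\zeta_i\xi(\zeta_i)\\ -\zeta_i\xi(-\zeta_i)&1\end{pmatrix}$ for some formal power series $\xi$. Put $\hat\lambda_{i,\pm}(\zeta_i)=\sum_{l'\ge0}(\pm1)^{l'}\theta_{l',t_i}\int\zeta_i^{-2n_i+l'+1}d\zeta_i$ and $\psi_{\zeta_i}=\Phi_i\Xi_i(\zeta_i^2)M_{\zeta_i}\exp(-\mathrm{diag}(\hat\lambda_{i,+},\hat\lambda_{i,-}))$, a formal solution of $(d+\widehat\Omega^{(n-2)}(\zeta_i^2))\psi_{\zeta_i}=0$, where $\widehat\Omega^{(n-2)}(\zeta_i^2)$ is the pull-back under $x_{t_i}=\zeta_i^2$. **Solutions at $q_j$.** $\psi_{q_j}=\begin{pmatrix}1&0\\ p_j&1\end{pmatrix}\Xi_{q_j}(x)\,\mathrm{diag}(1,x-q_j)$, with $\Xi_{q_j}$ a convergent power series in $x-q_j$, $\Xi_{q_j}(q_j)=\mathrm{id}$, is a fundamental solution of $(d+\widehat\Omega^{(n-2)})\psi_{q_j}=0$.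 **The 2-form $\hat\omega$.** A vector field $\hat\delta$ on $\widehat{\mathcal M}_{\boldsymbol t_{\mathrm{ra}}}\times T_{\boldsymbol\theta}$ acts on matrices depending on $x$ and the parameters with $x$ fixed (so $\hat\delta(x_{t_i})=-\hat\delta(t_i)$ for $i\neq\infty$, and $\hat\delta(\zeta_i)=0$ for $i\in I_{\mathrm{ra}}$). Put $\hat\delta(A)\wedge\hat\delta(\psi)\psi^{-1}=\hat\delta_1(A)\hat\delta_2(\psi)\psi^{-1}-\hat\delta_1(\psi)\psi^{-1}\hat\delta_2(A)$ and $$\hat\omega(\hat\delta_1,\hat\delta_2)=\tfrac12\sum_{i\in I\setminus I_{\mathrm{ra}}}\mathrm{res}_{x=t_i}\mathrm{Tr}\big(\hat\delta(\widehat\Omega^{(n-2)})\wedge\hat\delta(\psi_i)\psi_i^{-1}\big)+\tfrac14\sum_{i\in I_{\mathrm{ra}}}\mathrm{res}_{\zeta_i=0}\mathrm{Tr}\big(\hat\delta(\widehat\Omega^{(n-2)}(\zeta_i^2))\wedge\hat\delta(\psi_{\zeta_i})\psi_{\zeta_i}^{-1}\big)+\tfrac12\sum_{j=1}^{n-3}\mathrm{res}_{x=q_j}\mathrm{Tr}\big(\hat\delta(\widehat\Omega^{(n-2)})\wedge\hat\delta(\psi_{q_j})\psi_{q_j}^{-1}\big),$$ which is independent of the choices of solutions. **Hamiltonians.** For $i\in I_{\mathrm{un}}$, $0\le l\le n_i-2$: $H_{\theta^\pm_{l,t_i}}=-\frac{\theta^\pm_{2n_i-l-2,t_i}}{n_i-l-1}$.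 For $i\in I_{\mathrm{ra}}$, $0\le l'\le 2n_i-3$: $H_{\theta_{l',t_i}}=-\frac{\theta_{4(n_i-1)-l',t_i}}{2(n_i-1)-l'}$. For $i\in\{3,\dots,\nu\}\cap(I_{\mathrm{reg}}\cup I_{\mathrm{un}})$: $H_{t_i}=-\sum_{l=0}^{n_i-1}\theta^+_{l,t_i}\theta^+_{2n_i-l-1,t_i}-\sum_{l=0}^{n_i-1}\theta^-_{l,t_i}\theta^-_{2n_i-l-1,t_i}$.
   Formalization: With the Hamiltonians as printed the claim fails (e.g. ν=2, t_1, t_2 regular, ∞ ramified with n_∞=2); the theorem is proved with the opposite overall sign of all H_{θ^±_{l,t_i}}, H_{θ_{l',t_i}} and H_{t_i}, the formula for ω̂' being unchanged. *)

(* Defs.v *)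
From HB Require Import structures.
From mathcomp Require Import all_boot all_order all_algebra.
From mathcomp Require Import complex.
From mathcomp Require Import boolp classical_sets functions cardinality fsbigop.
From mathcomp Require Import reals topology normedtype derive.
From mathcomp Require Import zify ring lra.

Set Implicit Arguments.
Unset Strict Implicit.
Unset Printing Implicit Defensive.

Import Order.TTheory GRing.Theory Num.Theory.
Import numFieldNormedType.Exports.

Local Open Scope ring_scope.
Local Open Scope classical_set_scope.

Section LaurentSeries.
Variable K : fieldType.
Implicit Types (a b k : int) (n : nat).

Definition zero_below (f : int -> K) a := forall k, k < a -> f k = 0.

Record laurent := Laurent {
  coefL :> int -> K;
  _ : `[< exists a, zero_below coefL a >] }.

HB.instance Definition _ := [isSub for coefL].
HB.instance Definition _ := [Choice of laurent by <:].

Implicit Types f g h : laurent.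

Lemma laurentP f g : (forall k, f k = g k) -> f = g.
Proof. by move=> fg; apply/val_inj/funext. Qed.

Lemma laurent_zero_below f : exists a, zero_below f a.
Proof. by case: f => f /= /asboolP. Qed.

Fact zero_below0 : `[< exists a, zero_below (fun=> 0) a >].
Proof. by apply/asboolP; exists 0. Qed.
Definition zeroL := Laurent zero_below0.

Fact zero_below_add f g : `[< exists a, zero_below (fun k => f k + g k) a >].
Proof.
have [a fa] := laurent_zero_below f; have [b gb] := laurent_zero_below g.
apply/asboolP; exists (Order.min a b) => k; rewrite lt_min => /andP[ka kb].
by rewrite fa // gb // addr0.
Qed.
Definition addL f g := Laurent (zero_below_add f g).

Fact zero_below_opp f : `[< exists a, zero_below (fun k => - f k) a >].
Proof.
have [a fa] := laurent_zero_below f.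
by apply/asboolP; exists a => k ka; rewrite fa // oppr0.
Qed.
Definition oppL f := Laurent (zero_below_opp f).

(* The sum has finite support, since f and g vanish in low degrees. *)
Definition cauchy (f g : int -> K) k := \sum_(i \in [set: int]) f i * g (k - i).

Lemma cauchyE (f g : int -> K) a b n : zero_below f a -> zero_below g b ->
  cauchy f g (a + b + n%:Z) = \sum_(i < n.+1) f (a + i%:Z) * g (b + (n - i)%N%:Z).
Proof.
move=> fa gb; rewrite /cauchy.
pose r := [seq a + i%:Z | i : nat <- iota 0 n.+1].
have r_uniq : uniq r by rewrite map_inj_uniq ?iota_uniq // => i j /= /addrI [].
have r0 i : [set: int] i -> i \notin r -> f i * g (a + b + n%:Z - i) = 0.
  move=> _ inr; case: (ltrP i a) => [/fa ->|ai]; first by rewrite mul0r.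
  rewrite gb ?mulr0 //; apply: contraNT inr; rewrite -leNgt => bi.
  apply/mapP; exists `|i - a|%N; last by lia.
  by rewrite mem_iota; lia.
rewrite (fsbigE r _ r_uniq (fun _ _ => I) r0) big_mkcond /= /r big_map.
rewrite -[iota 0 n.+1]/(index_iota 0 n.+1) big_mkord; apply: eq_bigr => i _.
rewrite in_setT; congr (_ * g _).
by rewrite -subzn ?(leq_ord i) //; ring.
Qed.

Lemma cauchy_zero_below (f g : int -> K) a b :
  zero_below f a -> zero_below g b -> zero_below (cauchy f g) (a + b).
Proof.
move=> fa gb k kab; rewrite /cauchy fsbig1 // => i _.
case: (ltrP i a) => [/fa ->|ai]; first by rewrite mul0r.
by rewrite gb ?mulr0 //; lia.
Qed.

Fact zero_below_mul f g : `[< exists a, zero_below (cauchy f g) a >].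
Proof.
have [a fa] := laurent_zero_below f; have [b gb] := laurent_zero_below g.
by apply/asboolP; exists (a + b); exact: cauchy_zero_below.
Qed.
Definition mulL f g := Laurent (zero_below_mul f g).

Fact zero_below_mono (c : K) (d : int) :
  `[< exists a, zero_below (fun k => if k == d then c else 0) a >].
Proof. by apply/asboolP; exists d => k kd; rewrite lt_eqF. Qed.
Definition monoL c d := Laurent (zero_below_mono c d).

Lemma addLA : associative addL.
Proof. by move=> f g h; apply: laurentP => k /=; rewrite addrA. Qed.
Lemma addLC : commutative addL.
Proof. by move=> f g; apply: laurentP => k /=; rewrite addrC. Qed.
Lemma add0L : left_id zeroL addL.
Proof. by move=> f; apply: laurentP => k /=; rewrite add0r. Qed.
Lemma addNL : left_inverse zeroL oppL addL.
Proof. by move=> f; apply: laurentP => k /=; rewrite addNr. Qed.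

HB.instance Definition _ := GRing.isZmodule.Build laurent addLA addLC add0L addNL.

Let trunc n a (f : int -> K) := \poly_(i < n) f (a + i%:Z).

Let cauchy_trunc n m (f g : int -> K) a b :
  zero_below f a -> zero_below g b -> (m < n)%N ->
  cauchy f g (a + b + m%:Z) = (trunc n a f * trunc n b g)`_m.
Proof.
move=> fa gb mn; rewrite (cauchyE _ fa gb) coefM; apply: eq_bigr => i _; have im := ltn_ord i.
by rewrite !coef_poly !ifT //; lia.
Qed.

Let coef_ge0 k a : a <= k -> exists n, k = a + n%:Z.
Proof. by move=> ak; exists `|k - a|%N; rewrite gez0_abs ?subr_ge0 //; ring. Qed.

Lemma mulLC : commutative mulL.
Proof.
move=> f g; apply: laurentP => k /=.
have [a fa] := laurent_zero_below f; have [b gb] := laurent_zero_below g.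
case: (ltrP k (a + b)) => [kab|/coef_ge0[n ->]].
  by rewrite (cauchy_zero_below fa gb) // (cauchy_zero_below gb fa) // addrC.
rewrite (cauchy_trunc fa gb (ltnSn n)) (addrC a).
by rewrite (cauchy_trunc gb fa (ltnSn n)) mulrC.
Qed.

Lemma mulLA : associative mulL.
Proof.
move=> f g h; apply: laurentP => k /=.
have [a fa] := laurent_zero_below f; have [b gb] := laurent_zero_below g.
have [c hc] := laurent_zero_below h.
have fg := cauchy_zero_below fa gb; have gh := cauchy_zero_below gb hc.
case: (ltrP k (a + b + c)) => [kab|/coef_ge0[n ->]].
  by rewrite (cauchy_zero_below fg hc) // (cauchy_zero_below fa gh) // addrA.
rewrite (cauchy_trunc fg hc (ltnSn n)) -(addrA a).
rewrite (cauchy_trunc fa gh (ltnSn n)).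
transitivity (trunc n.+1 a f * (trunc n.+1 b g * trunc n.+1 c h))`_n.
  rewrite !coefM; apply: eq_bigr => i _; congr (_ * _); have im := ltn_ord i.
  by rewrite coef_poly ifT ?(cauchy_trunc (n := n.+1) gb hc) //; lia.
rewrite mulrA !coefM; apply: eq_bigr => i _; congr (_ * _); have im := ltn_ord i.
by rewrite [RHS]coef_poly ifT ?(cauchy_trunc (n := n.+1) fa gb) //; lia.
Qed.

Lemma cauchy_mono (c : K) d g k : cauchy (monoL c d) g k = c * g (k - d).
Proof.
have r0 i : [set: int] i -> i \notin [:: d] -> monoL c d i * g (k - i) = 0.
  by move=> _; rewrite inE /= => /negPf ->; rewrite mul0r.
by rewrite /cauchy (fsbigE [:: d] _ isT (fun _ _ => I) r0) big_mkcond /= big_seq1 in_setT eqxx.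
Qed.

Lemma mul1L : left_id (monoL 1 0) mulL.
Proof. by move=> f; apply: laurentP => k /=; rewrite cauchy_mono mul1r subr0. Qed.

Lemma mulLDl : left_distributive mulL addL.
Proof.
move=> f g h; apply: laurentP => k /=.
have [a fa] := laurent_zero_below f; have [b gb] := laurent_zero_below g.
have [c hc] := laurent_zero_below h.
pose d := Order.min a b.
have fd : zero_below f d by move=> i; rewrite lt_min => /andP[/fa].
have gd : zero_below g d by move=> i; rewrite lt_min => /andP[_ /gb].
have fgd : zero_below (fun i => f i + g i) d.
  by move=> i id; rewrite fd // gd // addr0.
case: (ltrP k (d + c)) => [kab|/coef_ge0[n ->]].
  by rewrite !(cauchy_zero_below (a := d) (b := c)) // addr0.
rewrite !(cauchyE (a := d) (b := c)) // -big_split /=.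
by apply: eq_bigr => i _; rewrite mulrDl.
Qed.

Lemma oneL_neq0 : monoL 1 0 != 0.
Proof.
apply/eqP => /(congr1 (fun f : laurent => f 0)) /= /eqP.
by rewrite oner_eq0.
Qed.

HB.instance Definition _ :=
  GRing.Zmodule_isComNzRing.Build laurent mulLA mulLC mul1L mulLDl oneL_neq0.

Definition invL f := xget (0 : laurent) [set g | f * g = 1].

Let inv_seq (s : nat -> K) := fix inv_seq n : seq K :=
  if n is m.+1 then
    rcons (inv_seq m)
      ((s 0%N)^-1 * ((m == 0%N)%:R - \sum_(i < m) (inv_seq m)`_i * s (m - i)%N))
  else [::].

Let size_inv_seq s n : size (inv_seq s n) = n.
Proof. by elim: n => //= n IHn; rewrite size_rcons IHn. Qed.

Let nth_inv_seq s n i : (i < n)%N -> (inv_seq s n)`_i = (inv_seq s i.+1)`_i.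
Proof.
elim: n => // n IHn; rewrite ltnS leq_eqVlt => /predU1P[-> //|lt_in].
by rewrite [LHS]/= nth_rcons size_inv_seq lt_in IHn.
Qed.

Let inv_seqP s n : s 0%N != 0 ->
  \sum_(i < n.+1) (inv_seq s i.+1)`_i * s (n - i)%N = (n == 0%N)%:R.
Proof.
move=> g0; rewrite big_ord_recr /= subnn nth_rcons size_inv_seq ltnn eqxx.
rewrite mulrAC mulVf // mul1r addrC.
have E : \sum_(i < n) (inv_seq s n)`_i * s (n - i)%N =
         \sum_(i < n) (inv_seq s i.+1)`_i * s (n - i)%N.
  by apply: eq_bigr => i _; rewrite nth_inv_seq.
by rewrite -E subrK.
Qed.

Lemma invL_ex f : f != 0 -> exists g, f * g = 1.
Proof.
move=> f0; have [a fa] := laurent_zero_below f.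
have exn : exists n, f (a + n%:Z) != 0.
  apply/not_existsP => fn; case/eqP: f0; apply: laurentP => k /=.
  case: (ltrP k a) => [/fa //|/coef_ge0[n ->]].
  by have /negP/negPn/eqP := fn n.
pose N := ex_minn exn; pose b := a + N%:Z.
have fb0 : f (b + 0%N%:Z) != 0 by rewrite addr0 /b /N; case: ex_minnP.
have fb : zero_below f b.
  move=> k kb; case: (ltrP k a) => [/fa //|/coef_ge0[n kn]].
  move: kb; rewrite kn /b /N; case: ex_minnP => m _ mmin nm.
  by apply/eqP/negPn/negP => /mmin; lia.
pose h (n : nat) := (inv_seq (fun n => f (b + n%:Z)) n.+1)`_n.
pose g (k : int) : K := if k < - b then 0 else h `|(k + b)%R|%N.
have gb : zero_below g (- b) by move=> k kb; rewrite /g kb.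
have gP : `[< exists a, zero_below g a >] by apply/asboolP; exists (- b).
exists (Laurent gP); rewrite mulrC; apply: laurentP => k /=.
rewrite -[X in cauchy X]/g.
have Nbb : - b + b = 0 by lia.
case: (ltrP k (- b + b)) => [kb|/coef_ge0[n ->]].
  by rewrite (cauchy_zero_below gb fb) // lt_eqF //; lia.
rewrite (cauchyE _ gb fb) Nbb add0r.
rewrite (eq_bigr (fun i : 'I_n.+1 => h i * f (b + (n - i)%N%:Z))); last first.
  move=> i _; congr (_ * _); rewrite /g ifF; last by lia.
  by congr h; lia.
by rewrite inv_seqP //; case: n.
Qed.

Lemma mulVL f : f != 0 -> invL f * f = 1.
Proof. by move=> /invL_ex fV; rewrite mulrC /invL; exact: (xgetPex 0 fV). Qed.

Lemma invL0 : invL 0 = 0.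
Proof.
rewrite /invL; case: xgetP => // g _ /= /eqP.
by rewrite mul0r eq_sym oner_eq0.
Qed.

HB.instance Definition _ := GRing.ComNzRing_isField.Build laurent mulVL invL0.

Definition cstL (c : K) : laurent := monoL c 0.

Definition varL : laurent := monoL 1 1.

Definition resL f : K := f (- 1).

(* The series with coefficients s, or 0 if s is not zero in low degrees. *)
Definition seriesL (s : int -> K) : laurent := insubd (0 : laurent) s.

Definition derivL f : laurent := seriesL (fun k => f (k + 1) *~ (k + 1)).

(* Termwise primitive, without constant of integration. It is only applied    *)
(* to series whose z^-1 coefficient is 0; in any case that term is dropped.   *)
Definition primL f : laurent :=
  seriesL (fun k => if k == 0 then 0 else f (k - 1) / k%:~R).

(* f(z^2) *)
Definition squareL f : laurent :=
  seriesL (fun k => if (2 %| k)%Z then f (k %/ 2)%Z else 0).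

(* f(-z) *)
Definition oppvarL f : laurent := seriesL (fun k => (-1) ^ k * f k).

Definition is_power_series f := zero_below f 0.

(* \sum_(l >= 0) th l * z^(l - N) *)
Definition tailL (N : nat) (th : nat -> K) : laurent :=
  seriesL (fun k => if k + N%:Z is Posz l then th l else 0).

Lemma seriesLE (s : int -> K) a : zero_below s a -> seriesL s = s :> (int -> K).
Proof.
by move=> sa; rewrite [LHS]insubdK //; apply/asboolP; exists a.
Qed.

Lemma derivLE f k : derivL f k = f (k + 1) *~ (k + 1).
Proof.
have [a fa] := laurent_zero_below f.
by rewrite /derivL (@seriesLE _ (a - 1)) // => i ia; rewrite fa ?mul0rz //; lia.
Qed.

Lemma primLE f k : primL f k = if k == 0 then 0 else f (k - 1) / k%:~R.
Proof.
have [a fa] := laurent_zero_below f.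
rewrite /primL (@seriesLE _ (a + 1)) // => i ia.
by rewrite fa ?mul0r ?if_same //; lia.
Qed.

Lemma squareLE f k : squareL f k = if (2 %| k)%Z then f (k %/ 2)%Z else 0.
Proof.
have [a fa] := laurent_zero_below f.
rewrite /squareL (@seriesLE _ (a * 2)) // => i ia.
by case: ifP => // _; rewrite fa // ltz_divLR.
Qed.

Lemma oppvarLE f k : oppvarL f k = (-1) ^ k * f k.
Proof.
have [a fa] := laurent_zero_below f.
by rewrite /oppvarL (@seriesLE _ a) // => i ia; rewrite fa ?mulr0.
Qed.

Lemma tailLE N th (l : nat) : tailL N th (l%:Z - N%:Z) = th l.
Proof.
rewrite /tailL (@seriesLE _ (- N%:Z)) ?subrK // => k kN.
have : k + N%:Z < 0 by lia.
by case: (k + N%:Z).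
Qed.

End LaurentSeries.

Section LaurentMatrices.
Variable K : fieldType.

Definition mx2 (T : Type) (a b c d : T) : 'M[T]_2 :=
  \matrix_(i, j) if i == 0 then (if j == 0 then a else b)
                           else (if j == 0 then c else d).

Definition diag2 (T : nmodType) (a d : T) : 'M[T]_2 := mx2 a 0 0 d.

(* Y^-1 dY + Y^-1 A Y, where A is the coefficient of dz. *)
Definition gauge (Y A : 'M[laurent K]_2) : 'M[laurent K]_2 :=
  invmx Y *m map_mx (@derivL K) Y + invmx Y *m A *m Y.

Definition is_power_series_mx (A : 'M[laurent K]_2) :=
  forall i j, is_power_series (A i j).

Definition in_GL2_series (M : 'M[laurent K]_2) :=
  [/\ is_power_series_mx M, M \in unitmx & is_power_series_mx (invmx M)].

Definition coefM (A : 'M[laurent K]_2) (k : int) : 'M[K]_2 :=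
  map_mx (fun f : laurent K => f k) A.

Definition evalL (p : {poly K}) (X : laurent K) : laurent K :=
  (map_poly (@cstL K) p).[X].

(* For psi = Y exp(- L) with L diagonal and D a derivation, the logarithmic   *)
(* derivative D(psi) psi^-1 = (D(Y) - Y D(L)) Y^-1 involves no exponential.   *)
Definition dlog (Y DY DL : 'M[laurent K]_2) : 'M[laurent K]_2 :=
  (DY - Y *m DL) *m invmx Y.

Definition half : K := 2%:R^-1.

End LaurentMatrices.

Definition CC (R : realType) : numFieldType := R[i].

(* Complex differentiability of all orders on an open set U, which is         *)
(* equivalent to holomorphy.                                                  *)
Fixpoint differentiable_upto (R : realType) (V : normedModType (CC R))
    (n : nat) (U : set V) (f : V -> CC R) : Prop :=
  (forall m, U m -> differentiable f m) /\
  if n is n'.+1 then forall v, differentiable_upto n' U (fun m => 'D_v f m)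
  else True.

Definition holomorphic_on (R : realType) (V : normedModType (CC R))
    (U : set V) (f : V -> CC R) :=
  forall n, differentiable_upto n U f.

Inductive sing_type := Reg | Unr | Ram.
Definition is_reg ty := if ty is Reg then true else false.
Definition is_unr ty := if ty is Unr then true else false.
Definition is_ram ty := if ty is Ram then true else false.

(* The index set I is option 'I_nu: Some i stands for the (i+1)-st finite     *)
(* singular point, and None for infinity. So t (Some 0) = 0, t (Some 1) = 1.  *)
Record setting (R : realType) := Setting {
  nu : nat;
  nu_ge2 : (1 < nu)%N;
  typ : option 'I_nu -> sing_type;
  pole : option 'I_nu -> nat;
  poleP : forall i, if is_reg (typ i) then pole i = 1%N else (1 < pole i)%N;
  has_ram : exists i, is_ram (typ i);
  (* t_i for the ramified i >= 3; the other values are irrelevant *)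
  t_ram : 'I_nu -> CC R;
  t_ram01 : forall i : 'I_nu, (1 < i)%N -> is_ram (typ (Some i)) ->
    t_ram i != 0 /\ t_ram i != 1;
  t_ram_inj : forall i j : 'I_nu, (1 < i)%N -> is_ram (typ (Some i)) ->
    (1 < j)%N -> is_ram (typ (Some j)) -> t_ram i = t_ram j -> i = j;
  (* theta^+_(n_i - 1) (true) and theta^-_(n_i - 1) (false), i unramified *)
  th_res : option 'I_nu -> bool -> CC R;
  (* theta_(2 n_i - 2), i ramified *)
  th_res_ram : option 'I_nu -> CC R;
  fuchs : \sum_(i | ~~ is_ram (typ i)) (th_res i true + th_res i false)
          + \sum_(i | is_ram (typ i)) (th_res_ram i - half (CC R)) = -1;
  nonresonant : forall i, is_reg (typ i) ->
    forall k : int, th_res i true - th_res i false != k%:~R }.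

Arguments t_ram {R} s i.
Arguments th_res {R} s i b.
Arguments th_res_ram {R} s i.

Section ParameterSpaces.
Variables (R : realType) (S : setting R).
Let C := CC R.
Local Notation I := (option 'I_(nu S)).

Definition n_tot : nat := \sum_(i : I) pole i.
Definition n_app : nat := n_tot - 3.

Definition t_index := {i : 'I_(nu S) | (1 < i)%N && ~~ is_ram (typ (Some i))}.

(* The indices of the coordinates of T_theta. The coordinate (i, (s, l)) is   *)
(* theta^+_l (s = true) or theta^-_l (s = false) if i is irregular            *)
(* unramified, and theta_(2 l + s) if i is ramified; in both cases            *)
(* l < n_i - 1. There is none if i is regular, as then n_i - 1 = 0.           *)
Definition th_index := {i : I & (bool * 'I_(pole i).-1)%type}.

Definition base : normedModType C :=
  ('rV[C]_#|{: t_index}| * 'rV[C]_#|{: th_index}|)%type.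

(* A point is ((q, p), (t, theta)). *)
Definition phase : normedModType C :=
  (('rV[C]_n_app * 'rV[C]_n_app) * base)%type.

Definition proj (m : phase) : base := m.2.
Definition q_of (m : phase) (j : 'I_n_app) : C := m.1.1 0 j.
Definition p_of (m : phase) (j : 'I_n_app) : C := m.1.2 0 j.

Definition t_of (b : base) (i : 'I_(nu S)) : C :=
  if i == 0%N :> nat then 0
  else if i == 1%N :> nat then 1
  else if insub i is Some c then b.1 0 (enum_rank (c : t_index))
  else t_ram S i.

Definition th_coord (b : base) (i : I) (s : bool) (l : nat) : option C :=
  if insub l is Some l' then
    Some (b.2 0 (enum_rank (existT _ i (s, l') : th_index)))
  else None.

(* theta^+_(l, t_i) or theta^-_(l, t_i), for i unramified and l <= n_i - 1 *)
Definition th_unr (b : base) (i : I) (s : bool) (l : nat) : C :=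
  odflt (th_res S i s) (th_coord b i s l).

(* theta_(l, t_i), for i ramified and l <= 2 n_i - 2 *)
Definition th_ram (b : base) (i : I) (l : nat) : C :=
  odflt (th_res_ram S i) (th_coord b i (odd l) l./2).

(* (T_t)_(t_ra) x T_theta *)
Definition base_set : set base :=
  [set b | [/\ injective (t_of b),
               forall i, is_unr (typ i) -> th_unr b i true 0 != th_unr b i false 0
             & forall i, is_ram (typ i) -> th_ram b i 1 != 0]].

(* The space \hat M_(t_ra) x T_theta, with the pairs (q_j, p_j) labelled by    *)
(* 'I_n_app. Since the q_j are pairwise distinct, this is an etale covering   *)
(* of the space of unordered configurations, and (q, p, t, theta) are local   *)
(* coordinates of the latter.                                                 *)
Definition phase_set : set phase :=
  [set m | [/\ base_set (proj m), injective (q_of m)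
             & forall j i, q_of m j != t_of (proj m) i]].

Record normal_form := NormalForm {
  C_fin : 'I_(nu S) -> {poly C};
  D_fin : 'I_(nu S) -> {poly C};
  C_inf : {poly C};
  D_inf : {poly C};
  C_tld : {poly C} }.

Definition normal_form_degrees (N : normal_form) :=
  [/\ forall i, (size (C_fin N i) <= pole (Some i))%N,
      forall i, (size (D_fin N i) <= pole (Some i))%N,
      (size (C_inf N) <= pole (None : I))%N,
      (size (D_inf N) <= (pole (None : I)).-1)%N
    & (size (C_tld N) <= n_app)%N].

Definition P_pol (b : base) : {poly C} :=
  \prod_(i < nu S) ('X - (t_of b i)%:P) ^+ pole (Some i).

Local Notation cst := (@cstL C).

Definition c0 (m : phase) (N : normal_form) (X : laurent C) : laurent C :=
  \sum_i evalL (C_fin N i) X / (X - cst (t_of (proj m) i)) ^+ pole (Some i)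
  + \sum_j cst (p_of m j) / (X - cst (q_of m j))
  + evalL (C_tld N) X + X ^+ n_app * evalL (C_inf N) X.

Definition d0 (m : phase) (N : normal_form) (X : laurent C) : laurent C :=
  \sum_i evalL (D_fin N i) X / (X - cst (t_of (proj m) i)) ^+ pole (Some i)
  - \sum_j 1 / (X - cst (q_of m j))
  + evalL (D_inf N) X.

(* The coefficient of dz in the pull-back of \hat Omega^(n-2) (on U_0) under   *)
(* x = X(z).                                                                  *)
Definition Omega0 (m : phase) (N : normal_form) (X : laurent C) :
    'M[laurent C]_2 :=
  derivL X *: mx2 0 (evalL (P_pol (proj m)) X)^-1 (c0 m N X) (d0 m N X).

Definition G_mx (X : laurent C) : 'M[laurent C]_2 := diag2 1 (X ^+ (n_tot - 2)).

(* x as a function of the local coordinate u = x_(t_i) *)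
Definition x_of (b : base) (i : I) (u : laurent C) : laurent C :=
  if i is Some i' then cst (t_of b i') + u else u^-1.

(* The coefficient of dz in the pull-back of \hat Omega^(n-2), or of           *)
(* \hat Omega^(n-2)_infty if i = infinity, under x_(t_i) = u(z).              *)
Definition Omega (m : phase) (N : normal_form) (i : I) (u : laurent C) :
    'M[laurent C]_2 :=
  let X := x_of (proj m) i u in
  if i is Some _ then Omega0 m N X else gauge (G_mx X) (Omega0 m N X).

Local Notation z := (varL C).

Definition apparent (m : phase) (N : normal_form) (j : 'I_n_app) :=
  is_power_series_mx
    (gauge (mx2 1 0 (cst (p_of m j)) z) (Omega0 m N (cst (q_of m j) + z))).

Definition ram_form (alpha beta : laurent C) : 'M[laurent C]_2 :=
  mx2 alpha beta (z * beta) (alpha - (2%:R * z)^-1).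

Definition has_formal_data (m : phase) (N : normal_form) (i : I) :=
  let b := proj m in let n := pole i in
  exists2 M, in_GL2_series M & gauge M (Omega m N i z) =
    if is_ram (typ i) then
      ram_form
        (\sum_(l < n) monoL (half C * th_ram b i l.*2) (l%:Z - n%:Z))
        (\sum_(l < n.-1) monoL (half C * th_ram b i l.*2.+1) (l%:Z - n%:Z))
    else
      diag2 (\sum_(l < n) monoL (th_unr b i true l) (l%:Z - n%:Z))
            (\sum_(l < n) monoL (th_unr b i false l) (l%:Z - n%:Z)).

Definition is_normal_form (m : phase) (N : normal_form) :=
  [/\ normal_form_degrees N,
      forall j, apparent m N j
    & forall i, has_formal_data m N i].

Record normal_form_family (N : phase -> normal_form) : Prop := {
  nf_pointwise : forall m, phase_set m -> is_normal_form m (N m);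
  nf_C_fin : forall i k, holomorphic_on phase_set (fun m => (C_fin (N m) i)`_k);
  nf_D_fin : forall i k, holomorphic_on phase_set (fun m => (D_fin (N m) i)`_k);
  nf_C_inf : forall k, holomorphic_on phase_set (fun m => (C_inf (N m))`_k);
  nf_D_inf : forall k, holomorphic_on phase_set (fun m => (D_inf (N m))`_k);
  nf_C_tld : forall k, holomorphic_on phase_set (fun m => (C_tld (N m))`_k) }.

(* All theta^+-_(l, t_i) and theta_(l, t_i) with l >= 0 are part of the data.  *)
Record formal_solutions := FormalSolutions {
  Phi : I -> base -> 'M[C]_2;
  Xi : I -> phase -> 'M[laurent C]_2;
  th : I -> bool -> nat -> phase -> C;
  thr : I -> nat -> phase -> C;
  Xiq : 'I_n_app -> phase -> 'M[laurent C]_2 }.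

Definition cst_mx (A : 'M[C]_2) : 'M[laurent C]_2 := map_mx cst A.

Definition convergent (f : laurent C) :=
  exists r B : C, [/\ 0 < r & forall k : nat, `|f k%:Z| * r ^+ k <= B].

Section Solutions.
Variables (N : phase -> normal_form) (F : formal_solutions).

(* d/dz of the eigenvalues \hat lambda^+-_i of Lambda_i *)
Definition dlambda (i : I) (s : bool) (m : phase) : laurent C :=
  tailL (pole i) (fun l => th F i s l m).

(* d/dz of \hat lambda_(i, +) (s = true) and \hat lambda_(i, -) (s = false),   *)
(* where z is zeta_i                                                          *)
Definition dlambda_ram (i : I) (s : bool) (m : phase) : laurent C :=
  tailL (2 * pole i - 1) (fun l => (-1) ^+ (~~ s * l) * thr F i l m).

Definition framed (i : I) (m : phase) : 'M[laurent C]_2 :=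
  cst_mx (Phi F i (proj m)) *m Xi F i m.

Record unramified_solution (i : I) (m : phase) : Prop := {
  unr_Phi : Phi F i (proj m) \in unitmx;
  unr_compatible :
    coefM (invmx (cst_mx (Phi F i (proj m))) *m Omega m (N m) i z
           *m cst_mx (Phi F i (proj m))) (- (pole i)%:Z) =
    diag2 (th_unr (proj m) i true 0) (th_unr (proj m) i false 0);
  unr_th : forall s l, (l < pole i)%N -> th F i s l m = th_unr (proj m) i s l;
  unr_Xi : is_power_series_mx (Xi F i m);
  unr_Xi0 : coefM (Xi F i m) 0 = 1%:M;
  unr_Xi_diag : forall a k, k != 0 -> coefM (Xi F i m) k a a = 0;
  unr_solves :
    dlog (framed i m) (map_mx (@derivL C) (framed i m))
         (diag2 (dlambda i true m) (dlambda i false m))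
    + Omega m (N m) i z = 0 }.

Definition M_zeta : 'M[laurent C]_2 := mx2 1 1 z (- z).

Record ramified_solution (i : I) (m : phase) : Prop := {
  ram_Phi : Phi F i (proj m) \in unitmx;
  ram_compatible :
    coefM (invmx (cst_mx (Phi F i (proj m))) *m Omega m (N m) i z
           *m cst_mx (Phi F i (proj m))) (- (pole i)%:Z) =
    mx2 (half C * th_ram (proj m) i 0) (half C * th_ram (proj m) i 1)
        0 (half C * th_ram (proj m) i 0);
  ram_th : forall l, (l < 2 * pole i - 1)%N ->
    thr F i l m = th_ram (proj m) i l;
  ram_Xi : is_power_series_mx (Xi F i m);
  ram_Xi0 : coefM (Xi F i m) 0 = 1%:M;
  ram_gauge :
    gauge (framed i m) (Omega m (N m) i z) =
    ram_form (tailL (pole i) (fun l => half C * thr F i l.*2 m))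
             (tailL (pole i) (fun l => half C * thr F i l.*2.+1 m));
  ram_normalized : exists2 xi : laurent C, is_power_series xi &
    invmx M_zeta *m map_mx (@squareL C) (Xi F i m) *m M_zeta =
    mx2 1 (z * xi) (- (z * oppvarL xi)) 1 }.

(* psi_(q_j), in the coordinate z = x - q_j *)
Definition psi_q (j : 'I_n_app) (m : phase) : 'M[laurent C]_2 :=
  mx2 1 0 (cst (p_of m j)) 1 *m Xiq F j m *m diag2 1 z.

Record apparent_solution (j : 'I_n_app) (m : phase) : Prop := {
  app_Xi : is_power_series_mx (Xiq F j m);
  app_Xi_convergent : forall a b, convergent (Xiq F j m a b);
  app_Xi0 : coefM (Xiq F j m) 0 = 1%:M;
  app_solves :
    map_mx (@derivL C) (psi_q j m)
    + Omega0 m (N m) (cst (q_of m j) + z) *m psi_q j m = 0 }.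

Record are_formal_solutions : Prop := {
  fs_unr : forall i m, phase_set m -> ~~ is_ram (typ i) -> unramified_solution i m;
  fs_ram : forall i m, phase_set m -> is_ram (typ i) -> ramified_solution i m;
  fs_app : forall j m, phase_set m -> apparent_solution j m;
  fs_Phi : forall i a b, holomorphic_on base_set (fun x => Phi F i x a b);
  fs_Xi : forall i a b k, holomorphic_on phase_set (fun m => Xi F i m a b k);
  fs_th : forall i s l, ~~ is_ram (typ i) -> holomorphic_on phase_set (th F i s l);
  fs_thr : forall i l, is_ram (typ i) -> holomorphic_on phase_set (thr F i l);
  fs_Xiq : forall j a b k, holomorphic_on phase_set (fun m => Xiq F j m a b k) }.

(* Below v is a tangent vector at m.                                          *)

Definition dcoef (v : phase) (f : phase -> laurent C) (m : phase) : laurent C :=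
  seriesL (fun k => 'D_v (fun m' => f m' k) m).

(* If f(m) is a series in z = x - c(m), its derivative along v with x fixed. *)
Definition vary (c : phase -> C) (v : phase) (f : phase -> laurent C)
    (m : phase) : laurent C :=
  dcoef v f m - cst ('D_v c m) * derivL (f m).

(* The derivative along v, with x fixed, of a primitive of f(m) dz: the       *)
(* constants of integration do not depend on m. Here the z^-1 coefficient of  *)
(* f is a constant, so that the logarithm in the primitive of f does not      *)
(* contribute to the first term.                                              *)
Definition vary_prim (c : phase -> C) (v : phase) (f : phase -> laurent C)
    (m : phase) : laurent C :=
  primL (dcoef v f m) - cst ('D_v c m) * f m.

Definition vary_mx (c : phase -> C) (v : phase) (A : phase -> 'M[laurent C]_2)
    (m : phase) : 'M[laurent C]_2 :=
  \matrix_(a, b) vary c v (fun m' => A m' a b) m.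

(* t_i, or 0 at infinity, where the coordinate w does not depend on m *)
Definition center (i : I) (m : phase) : C :=
  if i is Some i' then t_of (proj m) i' else 0.

Definition Omega_unr (i : I) (m : phase) := Omega m (N m) i z.
Definition Omega_ram (i : I) (m : phase) := Omega m (N m) i (z ^+ 2).
Definition Omega_q (j : 'I_n_app) (m : phase) :=
  Omega0 m (N m) (cst (q_of m j) + z).

Definition framed_ram (i : I) (m : phase) : 'M[laurent C]_2 :=
  cst_mx (Phi F i (proj m)) *m map_mx (@squareL C) (Xi F i m) *m M_zeta.

(* delta(psi) psi^-1 for psi = psi_i, psi_(zeta_i), psi_(q_j) *)
Definition dlog_unr (i : I) (v m : phase) : 'M[laurent C]_2 :=
  dlog (framed i m) (vary_mx (center i) v (framed i) m)
       (diag2 (vary_prim (center i) v (dlambda i true) m)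
              (vary_prim (center i) v (dlambda i false) m)).

Definition dlog_ram (i : I) (v m : phase) : 'M[laurent C]_2 :=
  dlog (framed_ram i m) (vary_mx (fun=> 0) v (framed_ram i) m)
       (diag2 (vary_prim (fun=> 0) v (dlambda_ram i true) m)
              (vary_prim (fun=> 0) v (dlambda_ram i false) m)).

Definition dlog_q (j : 'I_n_app) (v m : phase) : 'M[laurent C]_2 :=
  vary_mx (q_of^~ j) v (psi_q j) m *m invmx (psi_q j m).

(* res Tr (delta(A) /\ delta(psi) psi^-1) *)
Definition res_wedge (dA dlogpsi : phase -> 'M[laurent C]_2) (v1 v2 : phase) : C :=
  resL (\tr (dA v1 *m dlogpsi v2 - dlogpsi v1 *m dA v2)).

Definition omega_hat (m v1 v2 : phase) : C :=
  half C * \sum_(i | ~~ is_ram (typ i))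
    res_wedge (fun v => vary_mx (center i) v (Omega_unr i) m)
              (fun v => dlog_unr i v m) v1 v2
  + 4%:R^-1 * \sum_(i | is_ram (typ i))
    res_wedge (fun v => vary_mx (fun=> 0) v (Omega_ram i) m)
              (fun v => dlog_ram i v m) v1 v2
  + half C * \sum_j
    res_wedge (fun v => vary_mx (q_of^~ j) v (Omega_q j) m)
              (fun v => dlog_q j v m) v1 v2.

(* (df /\ dg)(v1, v2) at m *)
Definition wedge (f g : phase -> C) (m v1 v2 : phase) : C :=
  'D_v1 f m * 'D_v2 g m - 'D_v2 f m * 'D_v1 g m.

Definition eta_q (j : 'I_n_app) (m : phase) : C :=
  p_of m j / (P_pol (proj m)).[q_of m j]
  - \sum_i (D_fin (N m) i).[q_of m j]
           / (q_of m j - t_of (proj m) i) ^+ pole (Some i)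
  - (D_inf (N m)).[q_of m j].

(* The signs of H_th, H_thr and H_t are dictated by omega_hat; with the        *)
(* opposite signs dH /\ dtheta and dH /\ dt would have to be subtracted from   *)
(* the dq_j terms of omega_hat'. Indeed the diagonal part of the residue is   *)
(* 1/2 res Tr(delta(dLambda) /\ delta(- Lambda)). For a diagonal entry lambda *)
(* with lambda' = \sum_l theta_l z^(l-n), it contributes, by parts,           *)
(* - res (delta1(lambda') delta2(lambda)), which is the sum over l <= n-2 of  *)
(* d(theta_(2n-2-l) / (n-l-1)) /\ dtheta_l plus d(1/2 res lambda'^2) /\ dt,    *)
(* and 1/2 res lambda'^2 is the sum over l < n of theta_l theta_(2n-1-l).     *)
Definition H_th (i : I) (s : bool) (l : nat) (m : phase) : C :=
  th F i s (2 * pole i - l - 2) m / (pole i - l - 1)%:R.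

Definition H_thr (i : I) (l : nat) (m : phase) : C :=
  thr F i (4 * (pole i).-1 - l) m / (2 * (pole i).-1 - l)%:R.

Definition H_t (i : 'I_(nu S)) (m : phase) : C :=
  let n := pole (Some i) in
  \sum_(l < n) th F (Some i) true l m * th F (Some i) true (2 * n - l - 1) m
  + \sum_(l < n) th F (Some i) false l m * th F (Some i) false (2 * n - l - 1) m.

Definition omega_hat' (m v1 v2 : phase) : C :=
  \sum_j wedge (eta_q j) (q_of^~ j) m v1 v2
  + \sum_(i | is_unr (typ i)) \sum_(l < (pole i).-1)
      (wedge (H_th i true l) (fun m' => th_unr (proj m') i true l) m v1 v2
       + wedge (H_th i false l) (fun m' => th_unr (proj m') i false l) m v1 v2)
  + \sum_(i | is_ram (typ i)) \sum_(l < 2 * pole i - 2)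
      wedge (H_thr i l) (fun m' => th_ram (proj m') i l) m v1 v2
  + \sum_(i < nu S | (1 < i)%N && ~~ is_ram (typ (Some i)))
      wedge (H_t i) (fun m' => t_of (proj m') i) m v1 v2.

End Solutions.

(* w, a 2-form on phase_set, is a section of proj^* (Omega^2 of base_set). *)
Definition section_of_pullback (w : phase -> phase -> phase -> C) :=
  exists eta : phase -> base -> base -> C,
  [/\ forall m, phase_set m -> forall v1 v2, w m v1 v2 = eta m (proj v1) (proj v2),
      forall m, phase_set m -> forall a x y u,
        eta m (a *: x + y) u = a * eta m x u + eta m y u,
      forall m, phase_set m -> forall x y, eta m x y = - eta m y x
    & forall x y, holomorphic_on phase_set (fun m => eta m x y)].

End ParameterSpaces.

(* Main.v *)
(**
The difference of the two forms is a holomorphic alternating form, so it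
suffices to show that it vanishes as soon as one argument is vertical, that is,
moves only the [q_j] and [p_j].

Let [psi = Y exp (- Lambda)] be a local solution and [B_v = v(psi) psi^-1].
Varying the equation of [psi] gives [v(Omega) = - B_v' - [Omega, B_v]], whence
[res Tr (v1(Omega) B_2 - B_1 v2(Omega)) = 2 res Tr (v1(Omega) B_2)].

At [t_i], with [v1] vertical, [B_1] is a power series because the polar part of
[Lambda] depends on the base only.  The first row of [Omega] is [(0, g)] with
[g] depending on the base only, so the traces of [v1(Omega)] and
[v1(Omega) Omega] determine the second row of [v1(Omega)], which is a power
series as well.  Conjugating by [Y], one sees that the residue reduces to that
of the diagonal exponents, and its coefficients are the Hamiltonians.  At a
ramified point this is done after the pull-back by [x = zeta^2], where parity
provides the one order of vanishing lost by conjugating with [M_zeta].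

At [q_j], for arbitrary [v1] and [v2], half the residue is [de_j /\ dq_j], where
[e_j] is the lower right entry of the first coefficient of [Xi_(q_j)].  The
differential equation gives [e_j = eta_j + \sum_(k != j) (q_j - q_k)^-1], and
the additional terms cancel in the sum over [j].
*)
Require Import Defs.
From HB Require Import structures.
From mathcomp Require Import all_boot all_order all_algebra.
From mathcomp Require Import boolp classical_sets reals topology normedtype derive.
From mathcomp Require Import zify ring.

Set Implicit Arguments.
Unset Strict Implicit.
Unset Printing Implicit Defensive.

Import Order.TTheory GRing.Theory Num.Theory.
Import numFieldNormedType.Exports.
Local Open Scope ring_scope.

(** * Laurent series *)

(** Only [v1] is vertical. Along an arbitrary [v2] the exponents keep a pole, of order at most N =
    n_i (N = 2 n_i - 2 after the pull-back at a ramified point), so regularity of the conjugated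
    v1(Omega) alone does not kill the unwanted part of the residue. Two normalizations do. The
    exponents separate at leading order (theta^+_0 != theta^-_0, respectively theta_1 != 0), which
    forces the off-diagonal entries of y = Y^-1 v1(Y) to vanish to order N. And [Xi] has diagonal 1
    (at a ramified point, its conjugate by [M_zeta]), so that a diagonal entry of y is minus an
    off-diagonal entry of y times a series vanishing at 0: it has order N + 1, and its derivative
    still cancels the pole. No logarithm occurs in the variations, because the residue exponents are
    constants. At q_j the factor diag(1, z) is treated as exp(- Lambda) with Lambda' = diag(0, -
    1/z), so the three kinds of points share one residue form. The coefficients 1/2 and 1/4 undo the
    doubling of the residue and, for 1/4, also the equal contributions of the two branches zeta and
    - zeta. *)

Section Valuation.
Variable K : fieldType.
Implicit Types (f g : laurent K) (a b k : int).

Lemma coefLD f g k : (f + g) k = f k + g k. Proof. by []. Qed.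
Lemma coefLN f k : (- f) k = - f k. Proof. by []. Qed.
Lemma coefL0 k : (0 : laurent K) k = 0. Proof. by []. Qed.
Lemma coefLB f g k : (f - g) k = f k - g k. Proof. by []. Qed.
Lemma coefLE f g k : (f * g) k = Defs.cauchy f g k. Proof. by []. Qed.
Lemma coef_monoL (c : K) d k : monoL c d k = if k == d then c else 0.
Proof. by []. Qed.
Lemma coef_monoLM (c : K) d g k : (monoL c d * g) k = c * g (k - d).
Proof. exact: cauchy_mono. Qed.
Lemma coef_cstL (c : K) k : cstL c k = if k == 0 then c else 0.
Proof. by []. Qed.
Lemma coef_cstLM (c : K) g k : (cstL c * g) k = c * g k.
Proof. by rewrite coef_monoLM subr0. Qed.
Lemma coef_varLM g k : (varL K * g) k = g (k - 1).
Proof. by rewrite coef_monoLM mul1r. Qed.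
Lemma coefL1 k : (1 : laurent K) k = (k == 0)%:R.
Proof. by rewrite [LHS]/=; case: eqP. Qed.

Lemma monoLM (c d : K) a b : monoL c a * monoL d b = monoL (c * d) (a + b).
Proof.
apply: laurentP => k; rewrite coef_monoLM !coef_monoL.
have -> : (k - a == b) = (k == a + b) by apply/eqP/eqP; lia.
by case: eqP; rewrite ?mulr0.
Qed.

Lemma cstL_is_zmod : zmod_morphism (@cstL K).
Proof.
move=> x y; apply: laurentP => k; rewrite coefLB !coef_cstL.
by case: eqP; rewrite ?subr0.
Qed.
HB.instance Definition _ := GRing.isZmodMorphism.Build K (laurent K) (@cstL K) cstL_is_zmod.
Lemma cstL_is_monoid : monoid_morphism (@cstL K).
Proof. by split=> // x y; rewrite /cstL monoLM. Qed.
HB.instance Definition _ := GRing.isMonoidMorphism.Build K (laurent K) (@cstL K) cstL_is_monoid.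

Lemma varL_neq0 : varL K != 0.
Proof.
by apply/eqP => /(congr1 (fun f : laurent K => f 1)) /eqP; rewrite coef_monoL eqxx oner_eq0.
Qed.

Lemma varLX n : varL K ^+ n = monoL 1 n%:Z.
Proof.
elim: n => [|n IH]; first by [].
by rewrite exprS IH monoLM mul1r; congr monoL; lia.
Qed.

Lemma varLV : (varL K)^-1 = monoL 1 (-1).
Proof.
by apply: (mulfI varL_neq0); rewrite divff ?varL_neq0 // monoLM mul1r.
Qed.

Lemma zero_belowW f a b : b <= a -> zero_below f a -> zero_below f b.
Proof. by move=> ba fa k kb; apply: fa; apply: lt_le_trans ba. Qed.

Lemma zero_below0 a : zero_below (0 : laurent K) a. Proof. by []. Qed.

Lemma zero_belowD f g a : zero_below f a -> zero_below g a -> zero_below (f + g) a.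
Proof. by move=> fa ga k ka; rewrite coefLD fa // ga // addr0. Qed.

Lemma zero_belowN f a : zero_below f a -> zero_below (- f) a.
Proof. by move=> fa k ka; rewrite coefLN fa // oppr0. Qed.

Lemma zero_belowB f g a : zero_below f a -> zero_below g a -> zero_below (f - g) a.
Proof. by move=> fa ga; apply/zero_belowD/zero_belowN. Qed.

Lemma zero_below_sum (I : Type) (r : seq I) (P : pred I) (F : I -> laurent K) a :
  (forall i, P i -> zero_below (F i) a) -> zero_below (\sum_(i <- r | P i) F i) a.
Proof. by move=> Fa; elim/big_rec: _ => // i x Pi; apply: zero_belowD; apply: Fa. Qed.

Lemma zero_belowM f g a b c : c <= a + b ->
  zero_below f a -> zero_below g b -> zero_below (f * g) c.
Proof. by move=> cab fa gb; apply: zero_belowW cab _; apply: cauchy_zero_below. Qed.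

Lemma zero_below_mono (c : K) a b : b <= a -> zero_below (monoL c a) b.
Proof. by move=> ba k kb; rewrite coef_monoL ifF //; lia. Qed.

Lemma zero_below_cst (c : K) a : a <= 0 -> zero_below (cstL c) a.
Proof. exact: zero_below_mono. Qed.

Lemma zero_below1 a : a <= 0 -> zero_below (1 : laurent K) a.
Proof. exact: zero_below_mono. Qed.

Lemma zero_belowX f a n : zero_below f a -> zero_below (f ^+ n) (a * n%:Z).
Proof.
move=> fa; elim: n => [|n IH]; first by apply: zero_below1; rewrite mulr0.
by rewrite exprS; apply: zero_belowM fa IH; lia.
Qed.

Lemma zero_below_prod (I : Type) (r : seq I) (P : pred I) (F : I -> laurent K) (a : I -> int) :
  (forall i, zero_below (F i) (a i)) ->
  zero_below (\prod_(i <- r | P i) F i) (\sum_(i <- r | P i) a i).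
Proof.
move=> Fa; elim/big_rec2: _ => [|i x y _ xy]; first exact: zero_below1.
exact: zero_belowM (Fa i) xy.
Qed.

Lemma coefLM_low f g a b : zero_below f a -> zero_below g b ->
  (f * g) (a + b) = f a * g b.
Proof.
move=> fa gb; rewrite coefLE -[a + b]addr0 (Defs.cauchyE 0 fa gb) big_ord1 /=.
by rewrite !addr0.
Qed.

Lemma coefLM0 f g : is_power_series f -> is_power_series g -> (f * g) 0 = f 0 * g 0.
Proof. exact: coefLM_low. Qed.

Lemma coefLM1 f g : is_power_series f -> is_power_series g ->
  (f * g) 1 = f 0 * g 1 + f 1 * g 0.
Proof.
move=> fa ga; rewrite coefLE.
by have := Defs.cauchyE 1 fa ga; rewrite big_ord_recl big_ord1.
Qed.

Lemma laurent_order f : f != 0 -> exists a, zero_below f a /\ f a != 0.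
Proof.
move=> f0; have [a fa] := laurent_zero_below f.
have exn : exists n, f (a + n%:Z) != 0.
  apply/not_existsP => fn; case/eqP: f0; apply: laurentP => k.
  have [/fa //|ak] := ltrP k a; have := fn `|k - a|%N.
  have -> : a + `|k - a|%N%:Z = k by lia.
  by move=> /negP/negPn/eqP.
case: (ex_minnP exn) => n fn nmin; exists (a + n%:Z); split=> // k kn.
have [/fa //|ak] := ltrP k a; apply/eqP/negPn/negP => fk.
have ka_k : a + `|k - a|%N%:Z = k by lia.
have : (n <= `|k - a|)%N by apply: nmin; rewrite ka_k.
by lia.
Qed.

(** The lowest terms of [f] and [f^-1] multiply to the lowest term of 1, so the two orders are
    opposite. *)
Lemma zero_belowV f a : zero_below f a -> f a != 0 ->
  zero_below f^-1%R (- a) /\ f^-1%R (- a) = (f a)^-1.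
Proof.
move=> fa fa0.
have f0 : f != 0 by apply: contraNneq fa0 => ->.
have [b [gb gb0]] : exists b, zero_below f^-1%R b /\ f^-1%R b != 0.
  by apply: laurent_order; rewrite invr_eq0.
have := coefLM_low fa gb; rewrite divff // coefL1.
have [/eqP ab E|_ /esym/eqP] := boolP (a + b == 0); last first.
  by rewrite mulf_eq0 (negPf fa0) (negPf gb0).
have <- : b = - a by lia.
by split=> //; apply: (mulfI fa0); rewrite -E divff.
Qed.

Lemma resLM_eq0 f g a b : 0 <= a + b -> zero_below f a -> zero_below g b ->
  resL (f * g) = 0.
Proof. by move=> ab fa gb; apply: (zero_belowM ab fa gb). Qed.

Lemma resLD f g : resL (f + g) = resL f + resL g. Proof. by []. Qed.
Lemma resLN f : resL (- f) = - resL f. Proof. by []. Qed.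

Lemma derivL_is_zmod : zmod_morphism (@derivL K).
Proof. by move=> f g; apply: laurentP => k; rewrite coefLB !derivLE mulrzBl. Qed.
HB.instance Definition _ :=
  GRing.isZmodMorphism.Build (laurent K) (laurent K) (@derivL K) derivL_is_zmod.

Lemma zero_below_deriv f a : zero_below f a -> zero_below (derivL f) (a - 1).
Proof. by move=> fa k ka; rewrite derivLE fa ?mul0rz //; lia. Qed.

(** Unlike in [zero_below_deriv], no order is lost: the constant term is killed by the
    derivation. *)
Lemma ps_deriv f : is_power_series f -> is_power_series (derivL f).
Proof.
move=> fa k ka; rewrite derivLE; have [->|k1] := eqVneq k (-1); first by rewrite mulr0z.
by rewrite fa ?mul0rz //; lia.
Qed.

Lemma derivLM f g : derivL (f * g) = derivL f * g + f * derivL g.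
Proof.
apply: laurentP => k; rewrite derivLE coefLD !coefLE.
have [a fa] := laurent_zero_below f; have [b gb] := laurent_zero_below g.
have dfa := zero_below_deriv fa; have dgb := zero_below_deriv gb.
have [kab|kab] := ltrP (k + 1) (a + b).
  rewrite (cauchy_zero_below fa gb) // mul0rz.
  by rewrite (cauchy_zero_below dfa gb) ?(cauchy_zero_below fa dgb) ?addr0 //; lia.
pose n := `|(k + 1 - (a + b))%R|%N.
have En : k + 1 = a + b + n%:Z by rewrite /n; lia.
rewrite {1}En (Defs.cauchyE _ fa gb).
have -> : k = a - 1 + b + n%:Z by lia.
rewrite (Defs.cauchyE _ dfa gb).
have -> : a - 1 + b + n%:Z = a + (b - 1) + n%:Z by lia.
rewrite (Defs.cauchyE _ fa dgb) -big_split /= mulrz_suml; apply: eq_bigr => i _.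
rewrite !derivLE.
have -> : a - 1 + i + 1 = a + i :> int by lia.
have -> : b - 1 + (n - i)%N + 1 = b + (n - i)%N :> int by lia.
(* The weights [a + i] and [b + (n - i)] of the two products add up to [k + 1]. *)
rewrite mulrzAl mulrzAr -mulrzDr; congr (_ *~ _).
by have := ltn_ord i; lia.
Qed.

Lemma derivL_cst (c : K) : derivL (cstL c) = 0.
Proof.
apply: laurentP => k; rewrite derivLE coef_cstL; case: eqP => [->|_].
  by rewrite mulr0z.
by rewrite mul0rz.
Qed.

Lemma derivL1 : derivL (1 : laurent K) = 0.
Proof. exact: derivL_cst. Qed.

Lemma derivL_mono (c : K) a : derivL (monoL c a) = monoL (c *~ a) (a - 1).
Proof.
apply: laurentP => k; rewrite derivLE !coef_monoL.
have -> : (k + 1 == a) = (k == a - 1) by apply/eqP/eqP; lia.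
by case: eqP => [->|_]; rewrite ?mul0rz // subrK.
Qed.

Lemma derivL_var : derivL (varL K) = 1.
Proof. exact: derivL_mono. Qed.

Lemma resL_deriv f : resL (derivL f) = 0.
Proof. by rewrite /resL derivLE mulr0z. Qed.

Lemma zero_below_tail N (th : nat -> K) a : a <= - N%:Z -> zero_below (tailL N th) a.
Proof.
move=> aN k ka; rewrite /tailL (@seriesLE _ _ (- N%:Z)).
  have : k + N%:Z < 0 by lia.
  by case: (k + N%:Z).
move=> j jN; have : j + N%:Z < 0 by lia.
by case: (j + N%:Z).
Qed.

Lemma zero_below_square f a : zero_below f a -> zero_below (squareL f) (a * 2).
Proof.
move=> fa k ka; rewrite squareLE; case: ifP => // _; rewrite fa //.
by rewrite ltz_divLR.
Qed.

Lemma coef_square f k : squareL f (k * 2) = f k.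
Proof. by rewrite squareLE dvdz_mull // mulzK. Qed.

Lemma square_odd f k : squareL f (k * 2 + 1) = 0.
Proof. by rewrite squareLE ifF //; apply/negP; lia. Qed.

Lemma sum_even (V : zmodType) (F : nat -> V) n : (forall i, odd i -> F i = 0) ->
  \sum_(i < n.*2.+1) F i = \sum_(i < n.+1) F i.*2.
Proof.
move=> F0; elim: n => [|n IH]; first by rewrite !big_ord1.
rewrite doubleS [LHS]big_ord_recr /= [in LHS]big_ord_recr /= IH F0 ?addr0.
  by rewrite [in RHS]big_ord_recr.
by rewrite /= odd_double.
Qed.

Lemma squareL_is_zmod : zmod_morphism (@squareL K).
Proof.
move=> f g; apply: laurentP => k; rewrite coefLB !squareLE.
by case: ifP; rewrite ?subr0.
Qed.
HB.instance Definition _ :=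
  GRing.isZmodMorphism.Build (laurent K) (laurent K) (@squareL K) squareL_is_zmod.

Lemma squareL_cst (c : K) : squareL (cstL c) = cstL c.
Proof.
apply: laurentP => k; rewrite squareLE !coef_cstL; case: ifPn => [|k2].
  move=> /dvdzP[q ->]; rewrite mulzK //.
  by have -> : (q * 2 == 0) = (q == 0) by apply/eqP/eqP; lia.
by rewrite ifF //; apply/negP; lia.
Qed.

Lemma squareLM f g : squareL (f * g) = squareL f * squareL g.
Proof.
apply: laurentP => k.
have [a fa] := laurent_zero_below f; have [b gb] := laurent_zero_below g.
have sfa := zero_below_square fa; have sgb := zero_below_square gb.
have [kab|kab] := ltrP k (a * 2 + b * 2).
  rewrite [RHS](cauchy_zero_below sfa sgb) //.
  have fg : zero_below (f * g) (a + b) := cauchy_zero_below fa gb.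
  by rewrite (zero_below_square fg) //; lia.
pose n := `|(k - (a * 2 + b * 2))%R|%N.
have -> : k = a * 2 + b * 2 + n%:Z by rewrite /n; lia.
rewrite [RHS]coefLE (Defs.cauchyE _ sfa sgb).
have odd0 i : odd i -> squareL f (a * 2 + i%:Z) = 0.
  move=> oi; have -> : a * 2 + i%:Z = (a + (i./2)%:Z) * 2 + 1 by lia.
  exact: square_odd.
have odd0' i : odd i -> squareL g (b * 2 + i%:Z) = 0.
  move=> oi; have -> : b * 2 + i%:Z = (b + (i./2)%:Z) * 2 + 1 by lia.
  exact: square_odd.
(* For odd [n], one of [i] and [n - i] is odd, so every term vanishes; for even [n] only the even
   [i] survive. *)
have [on|en] := boolP (odd n).
  rewrite [LHS](_ : _ = 0); last first.
    have -> : a * 2 + b * 2 + n%:Z = (a + b + (n./2)%:Z) * 2 + 1 by lia.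
    exact: square_odd.
  rewrite big1 // => i _; have lei := ltn_ord i.
  have [oi|ei] := boolP (odd i); first by rewrite odd0 ?mul0r.
  by rewrite odd0' ?mulr0 //; lia.
have En : n = (n./2).*2 by lia.
rewrite En; move: (n./2) => m.
have -> : a * 2 + b * 2 + m.*2%:Z = (a + b + m%:Z) * 2 by lia.
rewrite coef_square coefLE (Defs.cauchyE _ fa gb).
rewrite (sum_even (F := fun i => squareL f (a * 2 + i%:Z) * squareL g (b * 2 + (m.*2 - i)%N%:Z))).
  apply: eq_bigr => i _; have lei := ltn_ord i.
  have -> : a * 2 + i.*2%:Z = (a + i%:Z) * 2 by lia.
  have -> : b * 2 + (m.*2 - i.*2)%N%:Z = (b + (m - i)%N%:Z) * 2 by lia.
  by rewrite !coef_square.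
by move=> i oi; rewrite odd0 ?mul0r.
Qed.

Lemma squareL_is_monoid : monoid_morphism (@squareL K).
Proof. by split; [exact: squareL_cst | exact: squareLM]. Qed.
HB.instance Definition _ :=
  GRing.isMonoidMorphism.Build (laurent K) (laurent K) (@squareL K) squareL_is_monoid.

Lemma squareL_var : squareL (varL K) = varL K ^+ 2.
Proof.
rewrite varLX; apply: laurentP => k; rewrite squareLE !coef_monoL.
case: ifPn => [/dvdzP[q ->]|k2].
  rewrite mulzK //; have -> // : (q * 2 == 2) = (q == 1) by apply/eqP/eqP; lia.
by rewrite ifF //; apply/negP; lia.
Qed.

Lemma derivL_square f : derivL (squareL f) = 2%:R * varL K * squareL (derivL f).
Proof.
have -> : 2%:R * varL K = monoL 2%:R 1.
  by rewrite -(rmorph_nat (@cstL K)) monoLM mulr1.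
apply: laurentP => k; rewrite coef_monoLM derivLE !squareLE.
have [/dvdzP[q Eq]|k2] := boolP (2 %| k - 1)%Z.
  have -> : k + 1 = (q + 1) * 2 by lia.
  have -> : (2 %| (q + 1) * 2)%Z by lia.
  by rewrite Eq !mulzK // derivLE mulrzA mulr_natl pmulrn.
by rewrite ifF ?mul0rz ?mulr0 //; lia.
Qed.

(** A series z f(z^2) has odd degrees only. This is the parity that gains one order of vanishing at
    a ramified point. *)
Lemma square_parity f : (varL K * squareL f) 0 = 0.
Proof. by rewrite coef_varLM squareLE. Qed.

Lemma evalL_cst (c : K) (X : laurent K) : evalL c%:P X = cstL c.
Proof. by rewrite /evalL map_polyC hornerC. Qed.

Lemma square_evalL (p : {poly K}) X : squareL (evalL p X) = evalL p (squareL X).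
Proof.
rewrite /evalL -horner_map -map_poly_comp; congr (_.[_]).
by apply: eq_map_poly => c; apply: squareL_cst.
Qed.

(** Regularity and value at z = 0 in one predicate, stable under the field operations: it evaluates
    a rational function of [X] at a regular point without expanding it. *)
Definition has_value f (c : K) := is_power_series f /\ f 0 = c.

Lemma has_valueD f g c d : has_value f c -> has_value g d -> has_value (f + g) (c + d).
Proof. by move=> [fp <-] [gp <-]; split=> //; apply: zero_belowD. Qed.

Lemma has_valueN f c : has_value f c -> has_value (- f) (- c).
Proof. by move=> [fp <-]; split=> //; apply: zero_belowN. Qed.

Lemma has_valueM f g c d : has_value f c -> has_value g d -> has_value (f * g) (c * d).
Proof.
by move=> [fp <-] [gp <-]; split; [exact: zero_belowM fp gp|exact: coefLM0].
Qed.

Lemma has_value_cst c : has_value (cstL c) c.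
Proof. by split=> //; apply: zero_below_cst. Qed.

Lemma has_valueX f c n : has_value f c -> has_value (f ^+ n) (c ^+ n).
Proof.
move=> fc; elim: n => [|n IH]; first exact: has_value_cst.
by rewrite !exprS; apply: has_valueM.
Qed.

Lemma has_valueV f c : has_value f c -> c != 0 -> has_value f^-1%R c^-1.
Proof. by move=> [fp <-] f0; have := zero_belowV fp f0; rewrite oppr0. Qed.

Lemma has_value_sum (I : Type) (r : seq I) (P : pred I) (F : I -> laurent K) (c : I -> K) :
  (forall i, P i -> has_value (F i) (c i)) ->
  has_value (\sum_(i <- r | P i) F i) (\sum_(i <- r | P i) c i).
Proof.
move=> Fc; elim/big_rec2: _ => [|i x y Pi yx]; first by split.
by apply: has_valueD; first exact: Fc.
Qed.

Lemma has_value_evalL p X c : has_value X c -> has_value (evalL p X) p.[c].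
Proof.
move=> Xc; elim/poly_ind: p => [|p d IH].
  by rewrite horner0 -polyC0 evalL_cst; apply: has_value_cst.
rewrite hornerMXaddC /evalL rmorphD rmorphM /= map_polyX map_polyC hornerMXaddC.
by apply: has_valueD (has_value_cst d); apply: has_valueM.
Qed.

End Valuation.

Lemma derivL_primL (K : numFieldType) (f : laurent K) : resL f = 0 -> derivL (primL f) = f.
Proof.
move=> f0; apply: laurentP => k; rewrite derivLE primLE.
have [k1|k1] := eqVneq (k + 1) 0.
  by rewrite k1 mulr0z; have -> : k = -1 by lia.
by rewrite addrK -mulrzr mulfVK // intr_eq0.
Qed.

Lemma zero_below_prim (K : fieldType) (f : laurent K) a :
  zero_below f a -> zero_below (primL f) (a + 1).
Proof. by move=> fa k ka; rewrite primLE fa ?mul0r ?if_same //; lia. Qed.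

Lemma primL_linear (K : fieldType) (c : K) (f g : laurent K) :
  primL (cstL c * f + g) = cstL c * primL f + primL g.
Proof.
apply: laurentP => k; rewrite coefLD coef_cstLM !primLE coefLD coef_cstLM.
by case: eqP => _; rewrite ?mulr0 ?addr0 // mulrDl mulrA.
Qed.

(** * Matrices of Laurent series *)

Section Matrices2.

Lemma ord2P (P : 'I_2 -> Prop) : P 0 -> P 1 -> forall i, P i.
Proof.
move=> P0 P1 i; have [->|->] // : i = 0 \/ i = 1.
by case: i => [[|[|m]] lt_m] //; [left|right]; apply/val_inj.
Qed.

Lemma mx2P (T : Type) (A B : 'M[T]_2) :
  A 0 0 = B 0 0 -> A 0 1 = B 0 1 -> A 1 0 = B 1 0 -> A 1 1 = B 1 1 -> A = B.
Proof. by move=> *; apply/matrixP; apply: ord2P; apply: ord2P. Qed.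

Lemma mx2E (T : Type) (a b c d : T) : (mx2 a b c d 0 0 = a) * (mx2 a b c d 0 1 = b) *
  (mx2 a b c d 1 0 = c) * (mx2 a b c d 1 1 = d).
Proof. by rewrite !mxE. Qed.

Lemma diag2E (T : nmodType) (a d : T) : (diag2 a d 0 0 = a) * (diag2 a d 0 1 = 0) *
  (diag2 a d 1 0 = 0) * (diag2 a d 1 1 = d).
Proof. by rewrite !mxE. Qed.

Lemma sum_ord2 (V : nmodType) (F : 'I_2 -> V) : \sum_i F i = F 0 + F 1.
Proof. by rewrite !big_ord_recl big_ord0 addr0; congr (_ + F _); apply/val_inj. Qed.

Lemma mulmx2E (R : pzSemiRingType) m n (A : 'M[R]_(m, 2)) (B : 'M[R]_(2, n)) i j :
  (A *m B) i j = A i 0 * B 0 j + A i 1 * B 1 j.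
Proof. by rewrite mxE sum_ord2. Qed.

Lemma addmxE (V : nmodType) m n (A B : 'M[V]_(m, n)) i j : (A + B) i j = A i j + B i j.
Proof. by rewrite mxE. Qed.

Lemma oppmxE (V : zmodType) m n (A : 'M[V]_(m, n)) i j : (- A) i j = - A i j.
Proof. by rewrite mxE. Qed.

Lemma map_mxE (T U : Type) (f : T -> U) m n (A : 'M[T]_(m, n)) i j :
  map_mx f A i j = f (A i j).
Proof. by rewrite mxE. Qed.

Lemma scalemxE (V : pzSemiRingType) m n (a : V) (A : 'M[V]_(m, n)) i j :
  (a *: A) i j = a * A i j.
Proof. by rewrite mxE. Qed.

Definition entriesE := (mulmx2E, addmxE, oppmxE, map_mxE).

Lemma mxtrace2 (R : pzSemiRingType) (A : 'M[R]_2) : \tr A = A 0 0 + A 1 1.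
Proof. exact: sum_ord2. Qed.

Lemma det_mx2 (R : comPzRingType) (A : 'M[R]_2) : \det A = A 0 0 * A 1 1 - A 0 1 * A 1 0.
Proof.
rewrite (expand_det_row _ 0) sum_ord2 /cofactor !det_mx11 !mxE /=.
rewrite !(expr0, expr1, mul1r, mulN1r, addr0, add0n, mulrN).
by congr (_ * A _ _ - _ * A _ _); apply/val_inj.
Qed.

Lemma invmx_eq (R : comUnitRingType) n (A B : 'M[R]_n) : A *m B = 1%:M -> invmx A = B.
Proof.
move=> AB; have [uA _] := mulmx1_unit AB.
by rewrite -[LHS]mulmx1 -AB mulKmx.
Qed.

Lemma mulmx_diag2 (F : fieldType) (a d : F) : a != 0 -> d != 0 ->
  diag2 a d *m diag2 a^-1 d^-1 = 1%:M.
Proof.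
move=> a0 d0; apply: mx2P; rewrite mulmx2E !diag2E ?mul0r ?mulr0 ?addr0 ?add0r.
- by rewrite mxE divff.
- by rewrite mxE.
- by rewrite mxE.
- by rewrite mxE divff.
Qed.

(** The second factor is the adjugate over the determinant. The product form gives invertibility
    through [mulmx1_unit] and the inverse through [invmx_eq]. *)
Lemma invmx2 (F : fieldType) (A : 'M[F]_2) (d := A 0 0 * A 1 1 - A 0 1 * A 1 0) :
  d != 0 -> A *m (d^-1 *: mx2 (A 1 1) (- A 0 1) (- A 1 0) (A 0 0)) = 1%:M.
Proof.
move=> d0; apply: mx2P; rewrite -scalemxAr mxE mulmx2E !mx2E mxE /=.
- by rewrite -[RHS](mulVf d0) /d; ring.
- by ring.
- by ring.
- by rewrite -[RHS](mulVf d0) /d; ring.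
Qed.

End Matrices2.

Section LaurentMatrices.
Variable K : fieldType.
Implicit Types (A B Y : 'M[laurent K]_2) (a b c : int).

Definition zero_below_mx A a := forall i j, zero_below (A i j) a.

Lemma zero_belowW_mx A a b : b <= a -> zero_below_mx A a -> zero_below_mx A b.
Proof. by move=> ba Aa i j; apply: zero_belowW ba _. Qed.

Lemma zero_below_mxD A B a : zero_below_mx A a -> zero_below_mx B a -> zero_below_mx (A + B) a.
Proof. by move=> Aa Ba i j; rewrite mxE; apply: zero_belowD. Qed.

Lemma zero_below_mxN A a : zero_below_mx A a -> zero_below_mx (- A) a.
Proof. by move=> Aa i j; rewrite mxE; apply: zero_belowN. Qed.

Lemma zero_below_mxM A B a b c : c <= a + b ->
  zero_below_mx A a -> zero_below_mx B b -> zero_below_mx (A *m B) c.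
Proof.
by move=> cab Aa Bb i j; rewrite mulmx2E; apply: zero_belowD; apply: zero_belowM cab _ _.
Qed.

Lemma zero_below_tr A a : zero_below_mx A a -> zero_below (\tr A) a.
Proof. by move=> Aa; rewrite mxtrace2; apply: zero_belowD. Qed.

Lemma ps_mx_deriv A : is_power_series_mx A -> is_power_series_mx (map_mx (@derivL K) A).
Proof. by move=> Aa i j; rewrite mxE; apply: ps_deriv. Qed.

Lemma zero_below_diag2 (f g : laurent K) a :
  zero_below f a -> zero_below g a -> zero_below_mx (diag2 f g) a.
Proof. by move=> fa ga; do 2![apply: ord2P]; rewrite diag2E. Qed.

Lemma zero_below_mx2 (f g h k : laurent K) a : zero_below f a -> zero_below g a ->
  zero_below h a -> zero_below k a -> zero_below_mx (mx2 f g h k) a.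
Proof. by move=> fa ga ha ka; do 2![apply: ord2P]; rewrite mx2E. Qed.

Lemma zero_below_cst_mx (A : 'M[K]_2) : is_power_series_mx (map_mx (@cstL K) A).
Proof. by move=> i j; rewrite mxE; apply: zero_below_cst. Qed.

Lemma derivmxM A B : map_mx (@derivL K) (A *m B) =
  map_mx (@derivL K) A *m B + A *m map_mx (@derivL K) B.
Proof.
apply/matrixP => i j; rewrite mxE [RHS]mxE !mulmx2E !mxE raddfD /= !derivLM.
by rewrite addrACA.
Qed.

Lemma coefMM A B : is_power_series_mx A -> is_power_series_mx B ->
  Defs.coefM (A *m B) 0 = Defs.coefM A 0 *m Defs.coefM B 0.
Proof.
move=> Ap Bp; apply/matrixP => i j; rewrite mxE !mulmx2E !mxE.
by rewrite coefLD !coefLM0.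
Qed.

Lemma det_coef0 A : is_power_series_mx A -> Defs.coefM A 0 \in unitmx ->
  has_value (A 0 0 * A 1 1 - A 0 1 * A 1 0) (\det (Defs.coefM A 0)) /\ \det (Defs.coefM A 0) != 0.
Proof.
move=> Ap uA; split; last by rewrite unitmxE unitfE in uA.
rewrite det_mx2 !mxE; apply: has_valueD; last apply: has_valueN.
  by apply: has_valueM.
by apply: has_valueM.
Qed.

(** The determinant is a power series with nonzero constant term, hence its inverse is one too, and
    the adjugate formula produces no pole. *)
Lemma ps_invmx A : is_power_series_mx A -> Defs.coefM A 0 \in unitmx ->
  A \in unitmx /\ is_power_series_mx (invmx A).
Proof.
move=> Ap uA; have [dA n0] := det_coef0 Ap uA.
pose d : laurent K := A 0 0 * A 1 1 - A 0 1 * A 1 0.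
have d0 : d 0 = \det (Defs.coefM A 0) by case: dA.
have nd : d != 0 by apply: contraNneq n0 => E; rewrite -d0 E.
have E := invmx2 nd; have [uA' _] := mulmx1_unit E; split=> //.
have [Vp _] := has_valueV dA n0.
rewrite (invmx_eq E) => i j; rewrite mxE; apply: (zero_belowM (a := 0) (b := 0) _ Vp) => //.
by apply: zero_below_mx2; try apply: zero_belowN; apply: Ap.
Qed.

End LaurentMatrices.

(* In the following lemmas, a derivation [D] commuting with [d/dz] is applied *)
(* to [Y' - Y L + Om Y = 0], with [l] a primitive of [D L].                   *)
Section Variation.
Variable K : fieldType.
Local Notation "A ^z" := (map_mx (@derivL K) A) (at level 2, format "A ^z").
Implicit Types (Om DOm Y DY L DL l B y : 'M[laurent K]_2).

(** This is psi' + Om psi = 0 for psi = Y exp(- Lambda) with Lambda' = L, after cancelling the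
    exponential. *)
Definition connection_eq Y L Om := Y^z - Y *m L + Om *m Y = 0.

Lemma connection_eq_dlog Y L Om : Y \in unitmx -> Om = - dlog Y Y^z L -> connection_eq Y L Om.
Proof. by move=> uY ->; rewrite /connection_eq mulNmx /dlog (mulmxKV uY) subrr. Qed.

Definition variation_eq Y L Om DY DL DOm :=
  DY^z - (DY *m L + Y *m DL) + (DOm *m Y + Om *m DY) = 0.

Lemma dlog_variation Y L Om DY DL DOm l : Y \in unitmx -> l *m L = L *m l -> l^z = DL ->
  connection_eq Y L Om -> variation_eq Y L Om DY DL DOm ->
  let B := dlog Y DY l in DOm = - B^z - (Om *m B - B *m Om).
Proof.
move=> uY lL dl eqY eqDY B.
have BY : B *m Y = DY - Y *m l by rewrite /B /dlog mulmxKV.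
clearbody B.
have dBY : B^z *m Y = DY^z - (Y^z *m l + Y *m DL) - B *m Y^z.
  by rewrite -dl -derivmxM -map_mxB -BY derivmxM addrK.
have EY : Y^z = Y *m L - Om *m Y.
  by apply/eqP; rewrite -subr_eq0 opprB addrCA addrC -eqY.
have EDY : DOm *m Y = DY *m L + Y *m DL - Om *m DY - DY^z.
  move/eqP: eqDY; rewrite addrC -[X in X == 0]addrA; move: (DOm *m Y) => X.
  rewrite addr_eq0 => /eqP->; move: (Om *m DY) (DY^z) (DY *m L) (Y *m DL) => a b c d.
  by rewrite !opprD !opprK !addrA; apply/matrixP => i j; rewrite !mxE; ring.
have EB : DOm *m Y = (- B^z - (Om *m B - B *m Om)) *m Y.
  rewrite mulmxBl mulmxBl mulNmx dBY -!mulmxA BY EY !mulmxBr !mulmxBl !mulmxA BY EDY.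
  (* [Y l L] comes from [B Y'] and [Y L l] from the derivative of [Y l]; they cancel because [l] and
     [L] commute. *)
  rewrite mulmxBl -(mulmxA Y l) lL mulmxA.
  move: (DY *m L) (Y *m DL) (Om *m DY) (DY^z) (Om *m Y *m l) (Y *m L *m l) (B *m Om *m Y).
  by move=> a b c d e f g; apply/matrixP => i j; rewrite !mxE; ring.
by rewrite -[LHS](mulmxK uY) EB mulmxK.
Qed.

(** In the frame [Y] the connection matrix becomes [L], and [y] acts as an infinitesimal gauge
    transformation. For diagonal [L] the commutator is off-diagonal, with the factor L1 - L2 that
    later bounds [y]. *)
Lemma frame_variation Y L Om DY DL DOm : Y \in unitmx ->
  connection_eq Y L Om -> variation_eq Y L Om DY DL DOm ->
  let y := invmx Y *m DY in invmx Y *m DOm *m Y = DL - y^z - (L *m y - y *m L).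
Proof.
move=> uY eqY eqDY y.
have Yy : DY = Y *m y by rewrite /y mulKVmx.
clearbody y.
have EY : Y^z = Y *m L - Om *m Y.
  by apply/eqP; rewrite -subr_eq0 opprB addrCA addrC -eqY.
have E : DOm *m Y = Y *m (DL - y^z - (L *m y - y *m L)).
  move: eqDY; rewrite /variation_eq Yy derivmxM EY mulmxBl !mulmxBr !mulmxA.
  move: (DOm *m Y) (Y *m L *m y) (Om *m Y *m y) (Y *m y^z) (Y *m y *m L) (Y *m DL).
  move=> a b c d e f /matrixP H; apply/matrixP => i j; have := H i j; rewrite !mxE => H0.
  by rewrite -[LHS]subr0 -H0; ring.
by rewrite -mulmxA E mulKmx.
Qed.

(** By cyclicity of the trace the commutators cancel in Tr (DOm1 B2 + B1 DOm2), which is therefore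
    minus the derivative of Tr (B1 B2) and has no residue. *)
Lemma res_wedge_variation Om DOm1 DOm2 B1 B2 :
  DOm1 = - B1^z - (Om *m B1 - B1 *m Om) -> DOm2 = - B2^z - (Om *m B2 - B2 *m Om) ->
  resL (\tr (DOm1 *m B2 - B1 *m DOm2)) = 2%:R * resL (\tr (DOm1 *m B2)).
Proof.
move=> E1 E2.
have E : \tr (DOm1 *m B2 + B1 *m DOm2) = - derivL (\tr (B1 *m B2)).
  by rewrite E1 E2 !mxtrace2 !entriesE !raddfD /= !derivLM; ring.
have -> : \tr (DOm1 *m B2 - B1 *m DOm2) =
    \tr (DOm1 *m B2) + \tr (DOm1 *m B2) - \tr (DOm1 *m B2 + B1 *m DOm2).
  by rewrite linearB linearD /= opprD addrA addrK.
rewrite E opprK resLD resL_deriv addr0 resLD.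
by rewrite mulr_natl mulr2n.
Qed.
End Variation.

(** * Local residues *)

Section LocalResidues.
Variable K : fieldType.
Local Notation "A ^z" := (map_mx (@derivL K) A) (at level 2, format "A ^z").
Implicit Types (Om DOm Y DY L DL l B y Xi : 'M[laurent K]_2).

(** Separates D(Y) Y^-1 from the exponents. For the latter, cyclicity moves the trace into the frame
    [Y], where [l] is diagonal in the applications. *)
Lemma trace_conj Y DOm DY l : Y \in unitmx ->
  \tr (DOm *m dlog Y DY l) = \tr (DOm *m (DY *m invmx Y)) - \tr (invmx Y *m DOm *m Y *m l).
Proof.
move=> uY; rewrite /dlog mulmxBl mulmxBr raddfB /=; congr (_ - _).
by rewrite !mulmxA mxtrace_mulC !mulmxA.
Qed.

(* The conjugated connection equation gives [(L1 - L2) y_ab = O(1)] off the     *)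
(* diagonal, so [y] is small compared to [l1] and [l2], and only the diagonal  *)
(* exponents contribute to the residue.                                        *)
Lemma residue_vertical (N : int) Y (L1 L2 D1 D2 l1 l2 K01 K10 : laurent K) Om DOm DY1 DY2
    (y := invmx Y *m DY1) : Y \in unitmx ->
  connection_eq Y (diag2 L1 L2) Om -> variation_eq Y (diag2 L1 L2) Om DY1 (diag2 D1 D2) DOm ->
  L1 - L2 != 0 -> zero_below (L1 - L2)^-1%R N ->
  is_power_series_mx y -> y 0 0 = - (K01 * y 1 0) -> y 1 1 = - (K10 * y 0 1) ->
  zero_below K01 1 -> zero_below K10 1 ->
  is_power_series_mx (invmx Y *m DOm *m Y) ->
  is_power_series_mx DOm -> is_power_series_mx (DY2 *m invmx Y) ->
  zero_below l1 (- N) -> zero_below l2 (- N) ->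
  resL (\tr (DOm *m dlog Y DY2 (diag2 l1 l2))) = - resL (D1 * l1) - resL (D2 * l2).
Proof.
move=> uY eqY eqDY L0 LV yp y00 y11 K01p K10p Wp DOmp DYp l1p l2p.
rewrite trace_conj //; set W := invmx Y *m DOm *m Y in Wp *.
have EW : W = diag2 D1 D2 - y^z - (diag2 L1 L2 *m y - y *m diag2 L1 L2).
  exact: (frame_variation uY eqY eqDY).
have yzp := ps_mx_deriv yp.
have y01N : zero_below (y 0 1) N.
  have E : y 0 1 = (L1 - L2)^-1 * (- W 0 1 - y^z 0 1).
    by apply: (mulfI L0); rewrite mulVKf // EW !entriesE !diag2E; ring.
  rewrite E; apply: (zero_belowM (a := N) (b := 0)) => //; first by rewrite addr0.
  exact: zero_belowB (zero_belowN (Wp _ _)) (yzp _ _).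
have y10N : zero_below (y 1 0) N.
  have E : y 1 0 = (L1 - L2)^-1 * (W 1 0 + y^z 1 0).
    by apply: (mulfI L0); rewrite mulVKf // EW !entriesE !diag2E; ring.
  rewrite E; apply: (zero_belowM (a := N) (b := 0)) => //; first by rewrite addr0.
  exact: zero_belowD (Wp _ _) (yzp _ _).
(* Applied to k = y_aa: the factor [f] vanishing at 0 makes up for the order lost by
   differentiation, so [derivL k] still has order [N] and cancels the pole of [l]. *)
have res0 (k f g l : laurent K) : zero_below f 1 -> zero_below g N -> k = - (f * g) -> zero_below l (- N) ->
    resL (derivL k * l) = 0.
  move=> fp gN -> lN; apply: (@resLM_eq0 _ _ _ N (- N)) => //; first by rewrite subrr.
  have kN : zero_below (- (f * g)) (1 + N) by apply/zero_belowN/(zero_belowM _ fp gN).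
  by have := zero_below_deriv kN; rewrite addrAC subrr add0r.
have -> : \tr (W *m diag2 l1 l2) =
    D1 * l1 + D2 * l2 - derivL (y 0 0) * l1 - derivL (y 1 1) * l2.
  by rewrite mxtrace2 EW !entriesE !diag2E; ring.
have R0 : resL (\tr (DOm *m (DY2 *m invmx Y))) = 0.
  have P : is_power_series_mx (DOm *m (DY2 *m invmx Y)) by apply: zero_below_mxM DOmp DYp.
  exact: (zero_below_tr P).
rewrite resLD resLN !resLD !resLN R0.
by rewrite (res0 _ _ _ _ K01p y10N y00 l1p) (res0 _ _ _ _ K10p y01N y11 l2p); ring.
Qed.

(* Since [Om 0 0 = 0], the trace of [DOm *m Om] only involves the second row   *)
(* of [DOm].                                                                  *)
Lemma variation_power_series (e : int) Om DOm B : DOm = - B^z - (Om *m B - B *m Om) ->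
  is_power_series_mx B -> Om 0 0 = 0 -> DOm 0 0 = 0 -> DOm 0 1 = 0 ->
  Om 0 1 != 0 -> zero_below (Om 0 1)^-1%R e -> zero_below_mx Om (- e) ->
  is_power_series_mx DOm.
Proof.
move=> E Bp Om00 DOm00 DOm01 g0 gV Ome.
have Bz := ps_mx_deriv Bp.
(* A commutator is traceless, and [DOm 0 0 = 0]. *)
have E11 : DOm 1 1 = - \tr B^z.
  rewrite -[LHS]add0r -DOm00 E !mxtrace2 !entriesE; ring.
have p11 : is_power_series (DOm 1 1) by rewrite E11; apply/zero_belowN/zero_below_tr.
(* The trace of [Om, B] Om vanishes, so Tr (DOm Om) = - Tr (B' Om). The zero of order [e] of
   [(Om 0 1)^-1] then offsets the pole of [Om]. *)
have E10 : DOm 1 0 = (Om 0 1)^-1 * (- \tr (B^z *m Om) - DOm 1 1 * Om 1 1).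
  apply: (mulfI g0); rewrite mulVKf //.
  have -> : Om 0 1 * DOm 1 0 = \tr (DOm *m Om) - DOm 1 1 * Om 1 1.
    by rewrite mxtrace2 !entriesE DOm00 DOm01; ring.
  by congr (_ - _); rewrite E !mxtrace2 !entriesE; ring.
have p10 : is_power_series (DOm 1 0).
  rewrite E10; apply: (zero_belowM (a := e) (b := - e)) => //; first by rewrite subrr.
  apply: zero_belowB; first apply/zero_belowN/zero_below_tr.
    by apply: zero_below_mxM Bz Ome; rewrite add0r.
  by apply: zero_belowM p11 (Ome _ _); rewrite add0r.
by do 2![apply: ord2P]; rewrite ?DOm00 ?DOm01.
Qed.

(** The exponents are those of diag(1, z) = exp(- Lambda) with z = x - q. As x is fixed, z varies by
    - dq; hence Lambda' = diag(0, - 1/z) varies by diag(0, - dq / z^2), and Lambda by diag(0, dq /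
    z). *)
Lemma residue_apparent (dq1 dq2 : K) Y Om DOm DY1 DY2
    (y1 := invmx Y *m DY1) (y2 := invmx Y *m DY2) : Y \in unitmx ->
  connection_eq Y (diag2 0 (monoL (-1) (-1))) Om ->
  variation_eq Y (diag2 0 (monoL (-1) (-1))) Om DY1 (diag2 0 (monoL (- dq1) (-2))) DOm ->
  is_power_series_mx y1 -> is_power_series_mx y2 ->
  resL (\tr (DOm *m dlog Y DY2 (diag2 0 (monoL dq2 (-1))))) =
  dq2 * y1 1 1 1 - dq1 * y2 1 1 1 + (y1 1 0 0 * y2 0 1 0 - y2 1 0 0 * y1 0 1 0).
Proof.
move=> uY eqY eqDY y1p y2p.
rewrite trace_conj // mulmxA mxtrace_mulC mulmxA.
set W := invmx Y *m DOm *m Y.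
have -> : invmx Y *m DOm *m DY2 = W *m y2 by rewrite /W /y2 -!mulmxA mulKVmx.
rewrite (frame_variation uY eqY eqDY : W = _) -/y1.
have y1z := ps_mx_deriv y1p.
set T := (X in resL X).
have -> : T = - (y1^z 0 0 * y2 0 0 + y1^z 0 1 * y2 1 0 + y1^z 1 0 * y2 0 1 + y1^z 1 1 * y2 1 1)
    - monoL (-1) (-1) * (y1 1 0 * y2 0 1 - y1 0 1 * y2 1 0)
    + monoL dq2 (-1) * y1^z 1 1 + monoL (- dq1) (-2) * y2 1 1
    + monoL (dq1 * dq2) (-3).
  have -> : monoL (dq1 * dq2) (-3) = - (monoL (- dq1) (-2) * monoL dq2 (-1)).
    rewrite monoLM mulNr; apply: laurentP => k; rewrite coefLN !coef_monoL.
    by case: eqP; rewrite ?opprK ?oppr0.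
  by rewrite /T !mxtrace2 !entriesE !diag2E; ring.
have M0 (i j k l : 'I_2) : (y1^z i j * y2 k l) (-1) = 0.
  exact: (resLM_eq0 (a := 0) (b := 0) _ (y1z _ _) (y2p _ _)).
(* Only the explicit poles contribute: z^-1 selects constant terms, z^-2 the degree 1 coefficient of
   [y2 1 1], and z^-3 alone has no residue. *)
rewrite /resL !(coefLD, coefLN) !coef_monoLM coef_monoL !M0.
have [-> ->] : -1 - -1 = 0 :> int /\ -1 - -2 = 1 :> int by [].
rewrite coefLD coefLN !coefLM0 // map_mxE derivLE (_ : (-1 == -3 :> int) = false) //.
by rewrite add0r mulr1z; ring.
Qed.

(* The first coefficients of the logarithmic derivative of [Y = A Xi], where  *)
(* [A] is lower unitriangular with entry [p], along a vector at which [p] and *)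
(* the centre of the coordinate have derivatives [dp] and [dq].               *)
Lemma apparent_frame_coefs (dp dq : K) Xi dXi y :
  is_power_series_mx Xi -> Defs.coefM Xi 0 = 1%:M ->
  is_power_series_mx dXi -> Defs.coefM dXi 0 = 0 -> is_power_series_mx y ->
  Xi *m y = mx2 0 0 (cstL dp) 0 *m Xi + (dXi - cstL dq *: Xi^z) ->
  [/\ y 1 0 0 = dp - dq * Xi 1 0 1, y 0 1 0 = - dq * Xi 0 1 1
    & y 1 1 1 = dp * Xi 0 1 1 + dXi 1 1 1 - dq * (2%:R * Xi 1 1 2)
                + dq * (Xi 1 0 1 * Xi 0 1 1 + Xi 1 1 1 ^+ 2)].
Proof.
move=> Xp X0 dXp dX0 yp E.
have X0E : (Xi 0 0 0 = 1) * (Xi 0 1 0 = 0) * (Xi 1 0 0 = 0) * (Xi 1 1 0 = 1).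
  by have /matrixP H := X0; do !split; [have := H 0 0|have := H 0 1|have := H 1 0|have := H 1 1];
     rewrite !mxE.
have dX0E i j : dXi i j 0 = 0 by have /matrixP/(_ i j) := dX0; rewrite !mxE.
have EE i j k : (Xi *m y) i j k = (mx2 0 0 (cstL dp) 0 *m Xi) i j k + (dXi i j k - dq * (Xi i j (k + 1) *~ (k + 1))).
  by rewrite E !mxE !coefLD coefLN coef_cstLM derivLE.
have y0 i j : y i j 0 = (mx2 0 0 (cstL dp) 0 *m Xi) i j 0 - dq * Xi i j 1.
  have := EE i j 0; rewrite [in X in X = _]mulmx2E coefLD !coefLM0 // dX0E !add0r mulr1z => <-.
  by move: i; apply: ord2P; rewrite !X0E ?mul1r ?mul0r ?addr0 ?add0r.
have y10 : y 1 0 0 = dp - dq * Xi 1 0 1.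
  by rewrite y0 mulmx2E !mx2E coefLD coef_cstLM !X0E mul0r coefL0 addr0 mulr1.
have y01 : y 0 1 0 = - dq * Xi 0 1 1.
  by rewrite y0 mulmx2E !mx2E !mul0r addr0 coefL0; ring.
have y11 : y 1 1 0 = - dq * Xi 1 1 1.
  by rewrite y0 mulmx2E !mx2E coefLD coef_cstLM !X0E mul0r coefL0; ring.
(* In degree 1, [Xi *m y] brings in the first coefficients of [Xi] times the constant terms of [y]
   just found; they produce the last summand. *)
split=> //; have := EE 1 1 1.
rewrite !mulmx2E coefLD !coefLM1 // !X0E !mx2E coefLD coef_cstLM (mul0r (Xi 1 1)) coefL0 y01 y11.
rewrite -[(_ *~ (1 + 1))%R]pmulrn -[_ *+ _]mulr_natl => H.
have -> : y 1 1 1 = 0 * y 0 1 1 + Xi 1 0 1 * (- dq * Xi 0 1 1) +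
    (1 * y 1 1 1 + Xi 1 1 1 * (- dq * Xi 1 1 1)) + dq * (Xi 1 0 1 * Xi 0 1 1 + Xi 1 1 1 ^+ 2).
  by ring.
by rewrite H; ring.
Qed.

End LocalResidues.

From mathcomp Require Import functions landau.

(** * Holomorphic functions *)

Section Holomorphy.
Local Open Scope classical_set_scope.
Variables (R : realType) (V : normedModType (CC R)).
Implicit Types (U : set V) (f g : V -> CC R).

(** The little-o condition only sees a neighbourhood, so the differential of [f] satisfies it for
    [g]; uniqueness then identifies it with that of [g]. *)
Lemma near_eq_differentiable f g x :
  (\near x, f x = g x) -> differentiable f x -> differentiable g x.
Proof.
move=> fg df; have fgx := nbhs_singleton fg.
have dg : g \o shift x = cst (g x) + 'd f x +o_ 0 id.
  apply/eqaddoP => e e0.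
  have /eqaddoP/(_ e e0) := diff_locally df.
  move: fg; rewrite (near_shift 0) subr0.
  by apply: filterS2 => y /= Ey; rewrite !fctE /= Ey fgx.
have dc : continuous ('d f x) by apply: diff_continuous.
apply/diff_locallyP; have E := diff_unique dc dg.
by rewrite E; split; [exact: dc|exact: dg].
Unshelve. all: by end_near. Qed.

Lemma near_open U (P : V -> Prop) x : open U -> U x -> (forall y, U y -> P y) -> \near x, P x.
Proof. by move=> oU Ux UP; apply: filterS (open_nbhs_nbhs (conj oU Ux)). Qed.

Lemma differentiable_upto_eq U n f g : open U -> (forall m, U m -> f m = g m) ->
  differentiable_upto n U f -> differentiable_upto n U g.
Proof.
move=> oU; elim: n f g => [|n IH] f g fg [df Df].
  by split=> [m Um|]; [apply: near_eq_differentiable (near_open oU Um fg) (df m Um)|].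
split=> [m Um|v]; first exact: near_eq_differentiable (near_open oU Um fg) (df m Um).
by apply: IH (Df v) => m Um; apply: near_eq_derive; apply: near_open oU Um fg.
Qed.

Lemma differentiable_uptoW U n f : differentiable_upto n.+1 U f -> differentiable_upto n U f.
Proof.
elim: n f => [|n IH] f [df Df]; first by split.
by split=> [m Um|v]; [exact: df|exact: IH (Df v)].
Qed.

Lemma differentiable_upto_derivable U n f m v :
  differentiable_upto n U f -> U m -> derivable f m v.
Proof. by case: n => [|n] [df _] Um; apply: diff_derivable; apply: df. Qed.

Lemma holomorphic_differentiable U f m : holomorphic_on U f -> U m -> differentiable f m.
Proof. by move=> /(_ 0%N) [df _] /df. Qed.

Lemma holomorphic_derivable U f m v : holomorphic_on U f -> U m -> derivable f m v.
Proof. by move=> /(_ 0%N) /differentiable_upto_derivable; apply. Qed.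

Lemma holomorphic_eq U f g : open U -> (forall m, U m -> f m = g m) ->
  holomorphic_on U f -> holomorphic_on U g.
Proof. by move=> oU fg hf n; apply: differentiable_upto_eq fg (hf n). Qed.

Lemma holomorphic_derive U f v : holomorphic_on U f -> holomorphic_on U (fun m => 'D_v f m).
Proof. by move=> hf n; have [_ Df] := hf n.+1; apply: Df. Qed.

Lemma holomorphic_cst U c : holomorphic_on U (fun=> c).
Proof.
move=> n; elim: n c => [|n IH] c; split=> [m _|]; do ?exact: differentiable_cst; move=> // v.
have -> : (fun m : V => 'D_v (fun=> c) m) = fun=> 0; last exact: IH.
by apply/funext => m; apply: derive_cst.
Qed.

Lemma differentiable_uptoD U n f g : open U ->
  differentiable_upto n U f -> differentiable_upto n U g ->
  differentiable_upto n U (fun m => f m + g m).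
Proof.
move=> oU; elim: n f g => [|n IH] f g hf hg; have [df Df] := hf; have [dg Dg] := hg.
  by split=> [m Um|]; [exact: differentiableD (df m Um) (dg m Um)|].
split=> [m Um|v]; first exact: differentiableD (df m Um) (dg m Um).
apply: differentiable_upto_eq (IH _ _ (Df v) (Dg v)) => // m Um.
by rewrite deriveD //; [apply: differentiable_upto_derivable hf Um|apply: differentiable_upto_derivable hg Um].
Qed.

Lemma differentiable_uptoM U n f g : open U ->
  differentiable_upto n U f -> differentiable_upto n U g ->
  differentiable_upto n U (fun m => f m * g m).
Proof.
move=> oU; elim: n f g => [|n IH] f g hf hg; have [df Df] := hf; have [dg Dg] := hg.
  by split=> [m Um|]; [exact: differentiableM (df m Um) (dg m Um)|].
split=> [m Um|v]; first exact: differentiableM (df m Um) (dg m Um).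
have H := differentiable_uptoD oU (IH _ _ (differentiable_uptoW hf) (Dg v)) (IH _ _ (differentiable_uptoW hg) (Df v)).
apply: differentiable_upto_eq H => // m Um.
by rewrite deriveM //; [apply: differentiable_upto_derivable hf Um|apply: differentiable_upto_derivable hg Um].
Qed.

Lemma holomorphicD U f g : open U -> holomorphic_on U f -> holomorphic_on U g ->
  holomorphic_on U (fun m => f m + g m).
Proof. by move=> oU hf hg n; apply: differentiable_uptoD. Qed.

Lemma holomorphicM U f g : open U -> holomorphic_on U f -> holomorphic_on U g ->
  holomorphic_on U (fun m => f m * g m).
Proof. by move=> oU hf hg n; apply: differentiable_uptoM. Qed.

Lemma holomorphicN U f : open U -> holomorphic_on U f -> holomorphic_on U (fun m => - f m).
Proof.
move=> oU hf; have := holomorphicM oU (holomorphic_cst U (-1)) hf.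
by apply: holomorphic_eq => // m _; rewrite mulN1r.
Qed.

Lemma holomorphicB U f g : open U -> holomorphic_on U f -> holomorphic_on U g ->
  holomorphic_on U (fun m => f m - g m).
Proof. by move=> oU hf hg; apply: holomorphicD => //; apply: holomorphicN. Qed.

Lemma holomorphic_sum U (I : Type) (r : seq I) (P : pred I) (F : I -> V -> CC R) : open U ->
  (forall i, P i -> holomorphic_on U (F i)) ->
  holomorphic_on U (fun m => \sum_(i <- r | P i) F i m).
Proof.
move=> oU hF; elim: r => [|i r IH].
  apply: (holomorphic_eq (f := fun=> 0)) => // [m _|]; last exact: holomorphic_cst.
  by rewrite big_nil.
have [Pi|Pi] := boolP (P i).
  have := holomorphicD oU (hF i Pi) IH.
  by apply: holomorphic_eq => // m _; rewrite big_cons Pi.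
by apply: holomorphic_eq IH => // m _; rewrite big_cons (negPf Pi).
Qed.

(** The derivative of 1/f is - (1/f)^2 f', so regularity of order n of 1/f itself yields order n +
    1. *)
Lemma holomorphicV U f : open U -> (forall m, U m -> f m != 0) -> holomorphic_on U f ->
  holomorphic_on U (fun m => (f m)^-1).
Proof.
move=> oU f0 hf.
have dV m (Um : U m) := differentiableV (holomorphic_differentiable hf Um) (f0 m Um).
elim=> [|n IH]; first by split=> [m /dV|].
split=> [m /dV //|v].
have H := differentiable_uptoM oU (differentiable_uptoM oU (holomorphic_cst U (-1) n) (differentiable_uptoM oU IH IH)) (holomorphic_derive v hf n).
apply: differentiable_upto_eq H => // m Um.
rewrite deriveV ?f0 //; last exact: holomorphic_derivable hf Um.
by rewrite -exprVn expr2 mulN1r.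
Qed.

End Holomorphy.

Section HolomorphyProd.
Local Open Scope classical_set_scope.
Variables (R : realType).

Lemma holomorphic_coord n (U : set 'rV[CC R]_n) j : holomorphic_on U (fun M => M 0 j).
Proof.
have D M v : 'D_v (fun N : 'rV[CC R]_n => N 0 j) M = v 0 j.
  rewrite /derive; apply: cvg_lim => //.
  apply: (@cvg_trans _ ((fun=> v 0 j) @ 0^')); last exact: cvg_cst.
  apply: near_eq_cvg; near=> h.
  rewrite /= !mxE addrK [RHS]/GRing.scale /= mulrA mulVf ?mul1r //.
  by near: h; exact: nbhs_dnbhs_neq.
case=> [|k]; split=> [M _|]; do ?exact: differentiable_coord; move=> // v.
have -> : (fun M => 'D_v (fun N : 'rV[CC R]_n => N 0 j) M) = fun=> v 0 j.
  by apply/funext => M; apply: D.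
exact: holomorphic_cst.
Unshelve. all: by end_near. Qed.

Variables (A B : normedModType (CC R)).

Lemma derive_snd (f : B -> CC R) (m v : (A * B)%type) :
  'D_v (fun x => f x.2) m = 'D_v.2 f m.2.
Proof. by []. Qed.

Lemma holomorphic_fst (U : set (A * B)%type) (W : set A) f :
  (forall m, U m -> W m.1) -> holomorphic_on W f -> holomorphic_on U (fun m => f m.1).
Proof.
move=> UW hf n; have := hf n; elim: n f {hf} => [|n IH] f [df Df].
  split=> [m Um|//]; apply: (@differentiable_comp _ _ _ _ (@fst A B) f) (df _ (UW _ Um)).
  by apply: linear_differentiable => x; apply: cvg_fst.
split=> [m Um|v]; last by apply: (IH (fun m => 'D_v.1 f m)); apply: Df.
apply: (@differentiable_comp _ _ _ _ (@fst A B) f) (df _ (UW _ Um)).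
by apply: linear_differentiable => x; apply: cvg_fst.
Qed.

Lemma holomorphic_snd (U : set (A * B)%type) (W : set B) f :
  (forall m, U m -> W m.2) -> holomorphic_on W f -> holomorphic_on U (fun m => f m.2).
Proof.
move=> UW hf n; have := hf n; elim: n f {hf} => [|n IH] f [df Df].
  split=> [m Um|//]; apply: (@differentiable_comp _ _ _ _ (@snd A B) f) (df _ (UW _ Um)).
  by apply: linear_differentiable => x; apply: cvg_snd.
split=> [m Um|v]; last by apply: (IH (fun m => 'D_v.2 f m)); apply: Df.
apply: (@differentiable_comp _ _ _ _ (@snd A B) f) (df _ (UW _ Um)).
by apply: linear_differentiable => x; apply: cvg_snd.
Qed.

End HolomorphyProd.

(** * Coordinates of the phase space, vertical vectors and openness *)

Section Coordinates.
Local Open Scope classical_set_scope.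
Variables (R : realType) (S : setting R).
Local Notation C := (CC R).

Lemma near_neq0 (V : normedModType C) (W : set V) (f : V -> C) x :
  holomorphic_on W f -> W x -> f x != 0 -> \near x, f x != 0.
Proof.
move=> hf Wx fx; have /differentiable_continuous fc := holomorphic_differentiable hf Wx.
have fx0 : 0 < `|f x| by rewrite normr_gt0.
have /cvgrPdist_lt/(_ _ fx0) := fc; apply: filterS => y; apply: contraTneq => ->.
by rewrite subr0 ltxx.
Qed.

Lemma holomorphic_t (W : set (base S)) i : holomorphic_on W (fun b => t_of b i).
Proof.
rewrite /t_of; case: eqP => _; first exact: holomorphic_cst.
case: eqP => _; first exact: holomorphic_cst.
case: insubP => [k _ _|_]; last exact: holomorphic_cst.
have H := @holomorphic_coord R _ setT (enum_rank (k : t_index S)).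
exact: (@holomorphic_fst R _ _ W setT _ (fun _ _ => I) H).
Qed.

Lemma holomorphic_th_unr (W : set (base S)) i s l : holomorphic_on W (fun b => th_unr b i s l).
Proof.
rewrite /th_unr /th_coord; case: insubP => [k _ _|_] /=; last exact: holomorphic_cst.
have H := @holomorphic_coord R _ setT (enum_rank (existT _ i (s, k) : th_index S)).
exact: (@holomorphic_snd R _ _ W setT _ (fun _ _ => I) H).
Qed.

Lemma holomorphic_th_ram (W : set (base S)) i l : holomorphic_on W (fun b => th_ram b i l).
Proof.
rewrite /th_ram /th_coord; case: insubP => [k _ _|_] /=; last exact: holomorphic_cst.
have H := @holomorphic_coord R _ setT (enum_rank (existT _ i (odd l, k) : th_index S)).
exact: (@holomorphic_snd R _ _ W setT _ (fun _ _ => I) H).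
Qed.

Lemma holomorphic_proj (W : set (phase S)) (B : set (base S)) f :
  (forall m, W m -> B (proj m)) -> holomorphic_on B f -> holomorphic_on W (fun m => f (proj m)).
Proof. exact: holomorphic_snd. Qed.

Lemma holomorphic_q (W : set (phase S)) j : holomorphic_on W (fun m => q_of m j).
Proof.
have H := @holomorphic_fst R _ 'rV[C]_(n_app S) setT setT _ (fun _ _ => I)
  (@holomorphic_coord R (n_app S) setT j).
exact: (@holomorphic_fst R _ _ W setT _ (fun _ _ => I) H).
Qed.

Lemma holomorphic_p (W : set (phase S)) j : holomorphic_on W (fun m => p_of m j).
Proof.
have H := @holomorphic_snd R 'rV[C]_(n_app S) _ setT setT _ (fun _ _ => I)
  (@holomorphic_coord R (n_app S) setT j).
exact: (@holomorphic_fst R _ _ W setT _ (fun _ _ => I) H).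
Qed.

Lemma derive_vertical (f : base S -> C) (m v : phase S) : proj v = 0 ->
  'D_v (fun x => f (proj x)) m = 0.
Proof.
move=> v0; rewrite (_ : 'D_v _ m = 'D_(proj v) f (proj m)); last exact: derive_snd.
by rewrite v0 derive0.
Qed.

Lemma vary_vertical c (f : base S -> laurent C) (m v : phase S) : proj v = 0 -> 'D_v c m = 0 ->
  vary c v (fun x => f (proj x)) m = 0.
Proof.
move=> v0 c0; rewrite /vary c0 rmorph0 mul0r subr0 /dcoef.
have E : (fun k => 'D_v (fun x => f (proj x) k) m) = (0 : laurent C).
  by apply/funext => k; apply: (derive_vertical (fun b => f b k)).
transitivity (seriesL (0 : laurent C)); first exact: (congr1 (@seriesL _) E).
by apply: laurentP => k; rewrite (@seriesLE _ _ 0).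
Qed.

(** Over a finite index set, injectivity is a finite conjunction of conditions f_i - f_j != 0, each
    of them open. *)
Lemma near_injective (I : finType) (V : normedModType C) (f : V -> I -> C) x :
  (forall i, holomorphic_on setT (f^~ i)) -> injective (f x) -> \near x, injective (f x).
Proof.
move=> hf fi.
have H (ij : I * I) : \forall y \near x, ij.1 != ij.2 -> f y ij.1 - f y ij.2 != 0.
  have [eq_ij|ne_ij] := boolP (ij.1 == ij.2); first by apply: filterE.
  have d0 : f x ij.1 - f x ij.2 != 0 by rewrite subr_eq0 (inj_eq fi).
  have hd := holomorphicB openT (hf ij.1) (hf ij.2).
  by apply: filterS (near_neq0 hd Logic.I d0).
apply: filterS (filter_forall _ H) => y fy i j fij; apply/eqP; apply: contraT => ne_ij.
by have := fy (i, j) ne_ij; rewrite fij subrr eqxx.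
Qed.

(** Finitely many holomorphic functions are required not to vanish. Openness is what lets identities
    valid on [phase_set] be differentiated. *)
Lemma open_phase_set : open (@phase_set R S).
Proof.
rewrite openE => m [[ti tu tr] qi qt]; rewrite /interior.
have ht i : holomorphic_on setT (fun x : phase S => t_of (proj x) i).
  exact: (holomorphic_proj (B := setT)) (holomorphic_t _ _).
have hu i s l : holomorphic_on setT (fun x : phase S => th_unr (proj x) i s l).
  exact: (holomorphic_proj (B := setT)) (holomorphic_th_unr _ _ _ _).
have hr i l : holomorphic_on setT (fun x : phase S => th_ram (proj x) i l).
  exact: (holomorphic_proj (B := setT)) (holomorphic_th_ram _ _ _).
have N1 := near_injective ht ti.
have N2 := near_injective (fun i => holomorphic_q setT i) qi.
have N3 (ji : 'I_(n_app S) * 'I_(nu S)) :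
    \forall x \near m, q_of x ji.1 - t_of (proj x) ji.2 != 0.
  have d0 : q_of m ji.1 - t_of (proj m) ji.2 != 0 by rewrite subr_eq0.
  exact: (near_neq0 (holomorphicB openT (holomorphic_q setT ji.1) (ht ji.2)) I d0).
have N4 i : \forall x \near m, is_unr (typ i) ->
    th_unr (proj x) i true 0 - th_unr (proj x) i false 0 != 0.
  have [ui|_] := boolP (is_unr (typ i)); last by apply: filterE.
  have d0 : th_unr (proj m) i true 0 - th_unr (proj m) i false 0 != 0.
    by rewrite subr_eq0 tu.
  by apply: filterS (near_neq0 (holomorphicB openT (hu i true 0%N) (hu i false 0%N)) I d0).
have N5 i : \forall x \near m, is_ram (typ i) -> th_ram (proj x) i 1 != 0.
  have [ri|_] := boolP (is_ram (typ i)); last by apply: filterE.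
  by apply: filterS (near_neq0 (hr i 1%N) I (tr i ri)).
have N3' : \forall x \near m, forall ji : 'I_(n_app S) * 'I_(nu S),
    q_of x ji.1 - t_of (proj x) ji.2 != 0.
  by apply: filterS (filter_forall _ N3) => x H i; apply: H.
have N4' : \forall x \near m, forall i, is_unr (typ i) ->
    th_unr (proj x) i true 0 - th_unr (proj x) i false 0 != 0.
  by apply: filterS (filter_forall _ N4) => x H i; apply: H.
have N5' : \forall x \near m, forall i, is_ram (typ i) -> th_ram (proj x) i 1 != 0.
  by apply: filterS (filter_forall _ N5) => x H i; apply: H.
suff : \forall x \near m, phase_set x by [].
near=> x.
have x1 : injective (t_of (proj x)) by near: x.
have x2 : injective (q_of x) by near: x.
have x3 : forall ji : 'I_(n_app S) * 'I_(nu S), q_of x ji.1 - t_of (proj x) ji.2 != 0 by near: x.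
have x4 : forall i, is_unr (typ i) -> th_unr (proj x) i true 0 - th_unr (proj x) i false 0 != 0.
  by near: x.
have x5 : forall i, is_ram (typ i) -> th_ram (proj x) i 1 != 0 by near: x.
split=> //; first split=> //.
  by move=> i ui; rewrite -subr_eq0; apply: x4.
by move=> j i; rewrite -subr_eq0; apply: (x3 (j, i)).
Unshelve. all: by end_near. Qed.

End Coordinates.

(** * The connection matrix near a pole *)

Section ShapeOfOmega.
Variables (R : realType) (S : setting R).
Local Notation C := (CC R).
Local Notation I := (option 'I_(nu S)).
Local Notation cst := (@cstL C).
Local Notation z := (varL C).
Implicit Types (m : phase S) (b : base S) (X : laurent C) (N : normal_form S).

Lemma evalL_P b X :
  evalL (P_pol b) X = \prod_(i < nu S) (X - cst (t_of b i)) ^+ pole (Some i).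
Proof.
rewrite /evalL /P_pol rmorph_prod horner_prod; apply: eq_bigr => i _.
by rewrite rmorphXn rmorphB /= map_polyX map_polyC horner_exp hornerXsubC.
Qed.

Lemma Omega0_entries m N X : (Omega0 m N X 0 0 = 0) *
  (Omega0 m N X 0 1 = derivL X * (evalL (P_pol (proj m)) X)^-1) *
  (Omega0 m N X 1 0 = derivL X * c0 m N X) * (Omega0 m N X 1 1 = derivL X * d0 m N X).
Proof. by rewrite /Omega0 !scalemxE !mx2E mulr0. Qed.

Lemma invmx_G X : X != 0 -> invmx (G_mx S X) = diag2 1 (X ^+ (n_tot S - 2))^-1.
Proof.
move=> X0; apply: invmx_eq; rewrite -{1}[1]invr1; apply: mulmx_diag2; first exact: oner_neq0.
by rewrite expf_neq0.
Qed.

(** The entry called g in the overview. At infinity, conjugation by [G_mx] multiplies it by x^(n-2).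
    It is written as a function of the base point, so that vertical vectors annihilate it. *)
Definition upper_entry (i : I) b : laurent C :=
  let X := x_of b i z in
  derivL X * (evalL (P_pol b) X)^-1 * (if i is Some _ then 1 else X ^+ (n_tot S - 2)).

Lemma Omega_row0 m N i :
  Omega m N i z 0 0 = 0 /\ Omega m N i z 0 1 = upper_entry i (proj m).
Proof.
rewrite /Omega /upper_entry; case: i => [i|] /=; first by rewrite !Omega0_entries mulr1.
have z0 : z^-1 != 0 by rewrite invr_eq0 varL_neq0.
rewrite /gauge invmx_G // !entriesE !diag2E !Omega0_entries derivL1 raddf0.
split; ring.
Qed.

Lemma sub_cst_neq0 (i : I) b c : x_of b i z - cst c != 0.
Proof.
apply/eqP; case: i => [i|] /= E.
  have := congr1 (fun f : laurent C => f 1) E.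
  rewrite coefLB coefLD !coef_cstL coef_monoL add0r subr0 coefL0 => /eqP.
  by rewrite oner_eq0.
have := congr1 (fun f : laurent C => f (-1)) E.
rewrite varLV coefLB coef_cstL coef_monoL subr0 coefL0 => /eqP.
by rewrite oner_eq0.
Qed.

Lemma deriv_x_of_neq0 (i : I) b : derivL (x_of b i z) != 0.
Proof.
case: i => [i|] /=; first by rewrite raddfD /= derivL_cst derivL_var add0r oner_neq0.
rewrite varLV derivL_mono; apply/eqP => /(congr1 (fun f : laurent C => f (-2))) /eqP.
by rewrite coef_monoL coefL0 /= mulrN1z oppr_eq0 oner_eq0.
Qed.

Lemma upper_entry_neq0 i b : upper_entry i b != 0.
Proof.
apply: mulf_neq0; last first.
  by case: i => [i|]; rewrite ?oner_neq0 ?expf_neq0 ?invr_eq0 ?varL_neq0.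
apply: mulf_neq0; first exact: deriv_x_of_neq0.
rewrite invr_eq0 evalL_P; apply/prodf_neq0 => k _.
by apply: expf_neq0; apply: sub_cst_neq0.
Qed.

Lemma n_totE : n_tot S = (pole (None : I) + \sum_(i < nu S) pole (Some i))%N.
Proof.
rewrite /n_tot (bigD1 None) //= (reindex_omap Some id) /=; last by case.
by congr (_ + _)%N; apply: eq_bigl => i; rewrite eqxx.
Qed.

Lemma pole_gt0 (i : I) : (0 < pole i)%N.
Proof. by have := poleP i; case: ifP => [_ -> //|_ /ltnW]. Qed.

Lemma n_tot_gt2 : (2 < n_tot S)%N.
Proof.
rewrite n_totE; have H : (nu S <= \sum_(i < nu S) pole (Some i))%N.
  rewrite -[X in (X <= _)%N]card_ord -sum1_card; apply: leq_sum => i _; exact: pole_gt0.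
by have := nu_ge2 S; have := pole_gt0 None; lia.
Qed.

Lemma upper_entry_someV i b :
  (upper_entry (Some i) b)^-1 = monoL 1 (pole (Some i))%:Z *
  \prod_(k < nu S | k != i) (cst (t_of b i) + z - cst (t_of b k)) ^+ pole (Some k).
Proof.
rewrite /upper_entry /= raddfD /= derivL_cst derivL_var add0r mul1r mulr1 invrK.
by rewrite evalL_P (bigD1 i) //= addrAC subrr add0r varLX.
Qed.

Lemma upper_entry_infV b :
  (upper_entry None b)^-1 =
  monoL (-1) 2 * evalL (P_pol b) z^-1 * monoL 1 (n_tot S - 2)%N%:Z.
Proof.
have E (a c d : laurent C) : (a * c^-1 * d)^-1 = a^-1 * c * d^-1 by rewrite !invfM invrK.
have E1 : (derivL z^-1)^-1 = monoL (-1) 2 :> laurent C.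
  rewrite varLV derivL_mono; apply: invr_inj; rewrite invrK.
  apply: (mulfI (x := monoL (-1) 2)).
    by apply/eqP => /(congr1 (fun f : laurent C => f 2)) /eqP; rewrite coef_monoL oppr_eq0 oner_eq0.
  rewrite divff ?monoLM ?mulrN1z ?mulrNN ?mulr1 //.
  by apply/eqP => /(congr1 (fun f : laurent C => f 2)) /eqP; rewrite coef_monoL oppr_eq0 oner_eq0.
have E2 : (z^-1 ^+ (n_tot S - 2))^-1 = monoL 1 (n_tot S - 2)%N%:Z :> laurent C.
  by rewrite exprVn invrK varLX.
by rewrite -E1 -E2; apply: E.
Qed.

(** At a finite t_i the inverse is P(x), with its zero of order n_i. At infinity dx = - w^-2 dw
    makes it - w^2 P(1/w) w^(n-2), of order n minus the sum of the finite n_i. *)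
Lemma zero_below_upper_entryV i b : zero_below (upper_entry i b)^-1%R (pole i)%:Z.
Proof.
case: i => [i|].
  rewrite upper_entry_someV.
  apply: (zero_belowM (a := (pole (Some i))%:Z) (b := 0)); first by rewrite addr0.
    exact: zero_below_mono.
  have H k : zero_below ((cst (t_of b i) + z - cst (t_of b k)) ^+ pole (Some k)) 0.
    rewrite -[0](mul0r (pole (Some k))%:Z); apply: zero_belowX.
    apply: zero_belowB; last exact: zero_below_cst.
    by apply: zero_belowD; [apply: zero_below_cst|apply: zero_below_mono].
  elim/big_rec: _ => [|k x _ x0]; first exact: zero_below1.
  exact: zero_belowM (H k) x0.
rewrite upper_entry_infV.
have Pz : zero_below (evalL (P_pol b) z^-1) (\sum_(k < nu S) (-1 * (pole (Some k))%:Z)).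
  rewrite evalL_P; apply: zero_below_prod => k.
  apply: zero_belowX; apply: zero_belowB; last exact: zero_below_cst.
  by rewrite varLV; apply: zero_below_mono.
have H1 := zero_belowM (lexx _) (zero_below_mono (-1 : C) (lexx 2)) Pz.
apply: zero_belowM H1 (zero_below_mono (1 : C) (lexx _)).
(* The truncated subtraction [n_tot S - 2] is exact, by [n_tot_gt2]. *)
rewrite -mulr_sumr mulN1r -(big_morph Posz PoszD erefl).
have := n_tot_gt2; have := n_totE; move: (\sum_(k < nu S) _)%N (n_tot S) (pole _) => s n p; lia.
Qed.

Lemma square_c0 m N X : squareL (c0 m N X) = c0 m N (squareL X).
Proof.
rewrite /c0 !rmorphD rmorphM rmorphXn /= !square_evalL !rmorph_sum /=.
congr (_ + _ + _ + _); apply: eq_bigr => i _; rewrite fmorph_div /=.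
  by rewrite square_evalL rmorphXn rmorphB /= squareL_cst.
by rewrite rmorphB /= !squareL_cst.
Qed.

Lemma square_d0 m N X : squareL (d0 m N X) = d0 m N (squareL X).
Proof.
rewrite /d0 rmorphD rmorphB /= !square_evalL !rmorph_sum /=.
congr (_ - _ + _); apply: eq_bigr => i _; rewrite fmorph_div /=.
  by rewrite square_evalL rmorphXn rmorphB /= squareL_cst.
by rewrite rmorphB rmorph1 /= !squareL_cst.
Qed.

Lemma square_Omega0 m N X :
  Omega0 m N (squareL X) = (2%:R * z) *: map_mx (@squareL C) (Omega0 m N X).
Proof.
rewrite /Omega0 -square_c0 -square_d0 -square_evalL derivL_square; apply/matrixP => i j.
rewrite !scalemxE map_mxE scalemxE rmorphM /= -mulrA; congr (_ * (_ * _)).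
by move: i j; do 2![apply: ord2P]; rewrite !mx2E ?rmorph0 ?fmorphV.
Qed.

Lemma gauge_square (Y A : 'M[laurent C]_2) :
  gauge (map_mx (@squareL C) Y) ((2%:R * z) *: map_mx (@squareL C) A) =
  (2%:R * z) *: map_mx (@squareL C) (gauge Y A).
Proof.
rewrite /gauge map_mxD !map_mxM -map_invmx scalerDr -!scalemxAr -scalemxAl.
congr (_ + _); rewrite scalemxAr; congr (_ *m _); apply/matrixP => i j.
by rewrite map_mxE [RHS]mxE !map_mxE derivL_square.
Qed.

(** Pull-back of a 1-form along u = z^2, with du/dz = 2 z. At infinity this also needs that gauge
    transformations commute with the pull-back. *)
Lemma Omega_square m N i :
  Omega m N i (z ^+ 2) = (2%:R * z) *: map_mx (@squareL C) (Omega m N i z).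
Proof.
rewrite /Omega -squareL_var; case: i => [i|] /=.
  by rewrite -square_Omega0 rmorphD /= squareL_cst.
have E X : map_mx (@squareL C) (G_mx S X) = G_mx S (squareL X).
  apply: mx2P; rewrite [LHS]map_mxE diag2E.
  - by rewrite rmorph1 diag2E.
  - by rewrite rmorph0 diag2E.
  - by rewrite rmorph0 diag2E.
  - by rewrite rmorphXn diag2E.
by rewrite -gauge_square -square_Omega0 E fmorphV.
Qed.

End ShapeOfOmega.

Local Opaque derive seriesL.

(** * Families of Laurent series and their variations *)

Section Families.
Local Open Scope classical_set_scope.
Variables (R : realType) (S : setting R) (U : set (phase S)).
Hypothesis oU : open U.
Local Notation C := (CC R).
Implicit Types (f g : phase S -> laurent C) (m v : phase S) (c h : phase S -> C).

(** The lower bound on the degrees is uniform in [m]: it makes every coefficient of a product one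
    finite sum of holomorphic functions, and the coefficientwise derivative a Laurent series
    again. *)
Definition holomorphic_family f :=
  (exists a, forall m, U m -> zero_below (f m) a) /\
  forall k, holomorphic_on U (fun m => f m k).

Lemma family_eq f g : (forall m, U m -> f m = g m) ->
  holomorphic_family f -> holomorphic_family g.
Proof.
move=> fg [[a fa] hf]; split; first by exists a => m Um; rewrite -fg //; apply: fa.
by move=> k; apply: holomorphic_eq (hf k) => // m Um; rewrite fg.
Qed.

Lemma family_mono h d : holomorphic_on U h -> holomorphic_family (fun m => monoL (h m) d).
Proof.
move=> hh; split; first by exists d => m _; apply: zero_below_mono.
move=> k; apply: (holomorphic_eq (f := fun m => if k == d then h m else 0)) => //.
by case: eqP => // _; apply: holomorphic_cst.
Qed.

Lemma family_cst h : holomorphic_on U h -> holomorphic_family (fun m => cstL (h m)).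
Proof. exact: family_mono. Qed.

Lemma family_const (l : laurent C) : holomorphic_family (fun=> l).
Proof.
split; last by move=> k; apply: holomorphic_cst.
by have [a la] := laurent_zero_below l; exists a.
Qed.

Lemma familyD f g : holomorphic_family f -> holomorphic_family g ->
  holomorphic_family (fun m => f m + g m).
Proof.
move=> [[a fa] hf] [[b gb] hg]; split; last first.
  by move=> k; apply: (holomorphic_eq (f := fun m => f m k + g m k)) => //; apply: holomorphicD.
exists (Order.min a b) => m Um; apply: zero_belowD.
  by apply: zero_belowW (fa m Um); rewrite ge_min lexx.
by apply: zero_belowW (gb m Um); rewrite ge_min lexx orbT.
Qed.

Lemma familyN f : holomorphic_family f -> holomorphic_family (fun m => - f m).
Proof.
move=> [[a fa] hf]; split; first by exists a => m Um; apply/zero_belowN/fa.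
by move=> k; apply: (holomorphic_eq (f := fun m => - f m k)) => //; apply: holomorphicN.
Qed.

Lemma familyB f g : holomorphic_family f -> holomorphic_family g ->
  holomorphic_family (fun m => f m - g m).
Proof. by move=> hf hg; apply: familyD => //; apply: familyN. Qed.

Lemma familyM f g : holomorphic_family f -> holomorphic_family g ->
  holomorphic_family (fun m => f m * g m).
Proof.
move=> [[a fa] hf] [[b gb] hg]; split.
  by exists (a + b) => m Um; apply: cauchy_zero_below; [apply: fa|apply: gb].
move=> k; have [kab|kab] := ltrP k (a + b).
  apply: (holomorphic_eq (f := fun=> 0)) => //; last exact: holomorphic_cst.
  by move=> m Um; rewrite coefLE (cauchy_zero_below (fa m Um) (gb m Um)).
have [n ->] : exists n, k = a + b + n%:Z by exists `|(k - (a + b))%R|%N; lia.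
apply: (holomorphic_eq (f := fun m => \sum_(i < n.+1) f m (a + i%:Z) * g m (b + (n - i)%N%:Z))) => //.
  by move=> m Um; rewrite coefLE (Defs.cauchyE _ (fa m Um) (gb m Um)).
by apply: holomorphic_sum => // i _; apply: holomorphicM.
Qed.

Lemma family_deriv f : holomorphic_family f -> holomorphic_family (fun m => derivL (f m)).
Proof.
move=> [[a fa] hf]; split; first by exists (a - 1) => m Um; apply/zero_below_deriv/fa.
move=> k; apply: (holomorphic_eq (f := fun m => f m (k + 1) * (k + 1)%:~R)) => //.
  by move=> m Um; rewrite derivLE mulrzr.
by apply: holomorphicM => //; apply: holomorphic_cst.
Qed.

Lemma family_square f : holomorphic_family f -> holomorphic_family (fun m => squareL (f m)).
Proof.
move=> [[a fa] hf]; split; first by exists (a * 2) => m Um; apply/zero_below_square/fa.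
move=> k; apply: (holomorphic_eq (f := fun m => if (2 %| k)%Z then f m (k %/ 2)%Z else 0)) => //.
  by move=> m Um; rewrite squareLE.
by case: (2 %| k)%Z; [apply: hf|apply: holomorphic_cst].
Qed.

Lemma coef_tailL (K : fieldType) N (th : nat -> K) k :
  tailL N th k = if k + N%:Z is Posz l then th l else 0.
Proof.
case E: (k + N%:Z) => [l|l].
  have -> : k = l%:Z - N%:Z by rewrite -E addrK.
  exact: tailLE.
by rewrite (@zero_below_tail _ N th _ (lexx _)) //; lia.
Qed.

Lemma family_tail N (th : nat -> phase S -> C) : (forall l, holomorphic_on U (th l)) ->
  holomorphic_family (fun m => tailL N (th^~ m)).
Proof.
move=> hth; split; first by exists (- N%:Z) => m _; apply: zero_below_tail.
move=> k; apply: (holomorphic_eq (f := fun m => if k + N%:Z is Posz l then th l m else 0)) => //.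
  by move=> m _; rewrite coef_tailL.
by case: (k + N%:Z) => [l|_]; [apply: hth|apply: holomorphic_cst].
Qed.

Lemma familyV f : holomorphic_family f ->
  (forall m, U m -> is_power_series (f m) /\ f m 0 != 0) -> holomorphic_family (fun m => (f m)^-1).
Proof.
move=> [_ hf] f0.
have Vp m : U m -> is_power_series (f m)^-1.
  by move=> /f0[fp fn]; have [] := has_valueV (conj fp erefl) fn.
split; first by exists 0.
suff H n : holomorphic_on U (fun m => (f m)^-1 n%:Z).
  case=> n; first exact: H.
  apply: (holomorphic_eq (f := fun=> 0)) => //; last exact: holomorphic_cst.
  by move=> m Um; rewrite Vp.
elim/ltn_ind: n => n IH.
(* The degree n part of f f^-1 = 1, solved for the n-th coefficient of f^-1 in terms of the earlier
   ones. *)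
apply: (holomorphic_eq (f := fun m => (f m 0)^-1 *
    ((n == 0%N)%:R - \sum_(i < n) f m i.+1%:Z * (f m)^-1 (n - i.+1)%N%:Z))) => //.
  move=> m Um; have [fp fn] := f0 m Um.
  have nz : f m != 0 by apply: contraNneq fn => ->.
  have := coefL1 C n%:Z; rewrite -(divff nz) coefLE -[n%:Z]add0r -[0]addr0.
  rewrite (Defs.cauchyE _ fp (Vp m Um)) big_ord_recl subn0 => E.
  apply: (mulfI fn); rewrite mulVKf // !add0r in E *.
  rewrite -[n == 0%N]/(n%:Z == 0) -E.
  by rewrite [X in _ + X - _](eq_bigr (fun i : 'I_n => f m i.+1%:Z * (f m)^-1 (n - i.+1)%N%:Z)) ?addrK // => i _; rewrite !add0r.
apply: holomorphicM => //.
  by apply: holomorphicV => // m Um; case: (f0 m Um).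
apply: holomorphicB => //; first exact: holomorphic_cst.
apply: holomorphic_sum => // i _; apply: holomorphicM => //.
by apply: IH; have := ltn_ord i; lia.
Qed.

Lemma derive_linear h (a : C) m v w : differentiable h m ->
  'D_(a *: v + w) h m = a * 'D_v h m + 'D_w h m.
Proof. by move=> dh; rewrite !deriveE // linearP. Qed.

Lemma derive_eq h h' m v : U m -> (forall x, U x -> h x = h' x) -> 'D_v h m = 'D_v h' m.
Proof. by move=> Um E; apply: near_eq_derive; apply: near_open oU Um E. Qed.

Lemma derive_eq_cst h m v (a : C) : U m -> (forall x, U x -> h x = a) -> 'D_v h m = 0.
Proof. by move=> Um E; rewrite (derive_eq v Um E); apply: derive_cst. Qed.

Lemma dcoefE f v m k : holomorphic_family f -> U m -> dcoef v f m k = 'D_v (fun x => f x k) m.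
Proof.
move=> [[a fa] hf] Um; rewrite /dcoef (@seriesLE _ _ a) // => i ia.
by apply: (@derive_eq_cst _ _ _ 0) => // x Ux; apply: fa.
Qed.

(** A bound at [m] alone would not do, as the derivative of a coefficient sees a whole
    neighbourhood. *)
Lemma zero_below_dcoef f v m a : U m -> (forall x, U x -> zero_below (f x) a) ->
  zero_below (dcoef v f m) a.
Proof.
move=> Um fa.
have D0 : zero_below (fun k => 'D_v (fun x => f x k) m) a.
  by move=> i ia; apply: (@derive_eq_cst _ _ _ 0) => // x Ux; apply: fa.
by rewrite /dcoef => i ia; rewrite (seriesLE D0) D0.
Qed.

Lemma family_dcoef f v : holomorphic_family f -> holomorphic_family (dcoef v f).
Proof.
move=> hf; have [[a fa] hfk] := hf; split.
  by exists a => m Um; apply: zero_below_dcoef.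
move=> k; apply: (holomorphic_eq (f := fun m => 'D_v (fun x => f x k) m)) => //.
  by move=> m Um; rewrite dcoefE.
exact: holomorphic_derive.
Qed.

Lemma dcoef_eq f g v m : U m -> (forall x, U x -> f x = g x) -> dcoef v f m = dcoef v g m.
Proof.
move=> Um fg.
suff E : (fun k => 'D_v (fun x => f x k) m) = (fun k => 'D_v (fun x => g x k) m).
  exact: (congr1 (@seriesL _) E).
by apply/funext => k; apply: derive_eq Um _ => x Ux; rewrite fg.
Qed.

Lemma dcoef_const (l : laurent C) v m : dcoef v (fun=> l) m = 0.
Proof.
have E : (fun k => 'D_v (fun=> l k) m) = (0 : laurent C).
  by apply/funext => k; apply: derive_cst.
transitivity (seriesL (0 : laurent C)); first exact: (congr1 (@seriesL _) E).
by apply: laurentP => k; rewrite (@seriesLE _ _ 0).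
Qed.

Local Opaque dcoef.

Lemma dcoefD f g v m : holomorphic_family f -> holomorphic_family g -> U m ->
  dcoef v (fun x => f x + g x) m = dcoef v f m + dcoef v g m.
Proof.
move=> hf hg Um; apply: laurentP => k.
rewrite [LHS](dcoefE v k (familyD hf hg) Um) [RHS]coefLD [X in _ = X + _](dcoefE v k hf Um).
rewrite [X in _ = _ + X](dcoefE v k hg Um).
exact: (deriveD (holomorphic_derivable (v := v) (hf.2 k) Um) (holomorphic_derivable (v := v) (hg.2 k) Um)).
Qed.

Lemma derive_sum_on n (F G : 'I_n -> phase S -> C) m v : U m ->
  (forall i, holomorphic_on U (F i)) -> (forall i, holomorphic_on U (G i)) ->
  'D_v (fun x => \sum_i F i x * G i x) m =
  \sum_i ('D_v (F i) m * G i m) + \sum_i (F i m * 'D_v (G i) m).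
Proof.
move=> Um hF hG; rewrite -big_split /=.
have -> : (fun x => \sum_i F i x * G i x) = \sum_i (fun x => F i x * G i x).
  by apply/funext => x; rewrite fct_sumE.
have dF i := holomorphic_derivable (v := v) (hF i) Um; have dG i := holomorphic_derivable (v := v) (hG i) Um.
rewrite derive_sum; last by move=> i; apply: derivableM (dF i) (dG i).
apply: eq_bigr => i _; rewrite (deriveM (dF i) (dG i)).
by rewrite -[LHS]/(F i m * 'D_v (G i) m + G i m * 'D_v (F i) m) addrC (mulrC (G i m)).
Qed.

Lemma dcoefM f g v m : holomorphic_family f -> holomorphic_family g -> U m ->
  dcoef v (fun x => f x * g x) m = dcoef v f m * g m + f m * dcoef v g m.
Proof.
move=> hf hg Um; have [[a fa] hfk] := hf; have [[b gb] hgk] := hg.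
apply: laurentP => k; rewrite (dcoefE v k (familyM hf hg) Um) [RHS]coefLD.
have dfa := zero_below_dcoef v Um fa; have dgb := zero_below_dcoef v Um gb.
rewrite !coefLE; have [kab|kab] := ltrP k (a + b).
  rewrite (cauchy_zero_below dfa (gb m Um)) // (cauchy_zero_below (fa m Um) dgb) // addr0.
  apply: (@derive_eq_cst _ _ _ 0 Um) => x Ux.
  by rewrite coefLE (cauchy_zero_below (fa x Ux) (gb x Ux)).
have [n ->] : exists n, k = a + b + n%:Z by exists `|(k - (a + b))%R|%N; lia.
rewrite (Defs.cauchyE _ dfa (gb m Um)) (Defs.cauchyE _ (fa m Um) dgb).
rewrite (derive_eq (h' := fun x => \sum_(i < n.+1) f x (a + i%:Z) * g x (b + (n - i)%N%:Z))) //.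
  rewrite (derive_sum_on v Um (fun i => hfk _) (fun i => hgk _)).
  by congr (_ + _); apply: eq_bigr => i _; rewrite (dcoefE v _ hf Um, dcoefE v _ hg Um).
by move=> x Ux; rewrite coefLE (Defs.cauchyE _ (fa x Ux) (gb x Ux)).
Qed.

Lemma dcoef_deriv f v m : holomorphic_family f -> U m ->
  dcoef v (fun x => derivL (f x)) m = derivL (dcoef v f m).
Proof.
move=> hf Um; apply: laurentP => k; rewrite (dcoefE v k (family_deriv hf) Um).
rewrite derivLE (dcoefE v (k + 1) hf Um) -mulrzr [RHS]mulrC.
rewrite -(deriveMr _ (holomorphic_derivable (v := v) (hf.2 (k + 1)) Um)).
by apply: derive_eq Um _ => x _; rewrite derivLE /= ?mulrzr ?mulrzl.
Qed.

Lemma dcoef_square f v m : holomorphic_family f -> U m ->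
  dcoef v (fun x => squareL (f x)) m = squareL (dcoef v f m).
Proof.
move=> hf Um; apply: laurentP => k; rewrite (dcoefE v k (family_square hf) Um).
rewrite squareLE; case: ifPn => k2.
  by rewrite (dcoefE v _ hf Um); apply: derive_eq Um _ => x _; rewrite squareLE k2.
by apply: (@derive_eq_cst _ _ _ 0 Um) => x _; rewrite squareLE (negPf k2).
Qed.

Lemma dcoef_mono h d v m : holomorphic_on U h -> U m ->
  dcoef v (fun x => monoL (h x) d) m = monoL ('D_v h m) d.
Proof.
move=> hh Um; apply: laurentP => k; rewrite (dcoefE v k (family_mono d hh) Um).
rewrite coef_monoL; case: eqP => [->|/eqP/negPf kd].
  by apply: derive_eq Um _ => x _; rewrite coef_monoL eqxx.
by apply: (@derive_eq_cst _ _ _ 0 Um) => x _; rewrite coef_monoL kd.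
Qed.

Lemma dcoef_tail N (th : nat -> phase S -> C) v m : (forall l, holomorphic_on U (th l)) -> U m ->
  dcoef v (fun x => tailL N (th^~ x)) m = tailL N (fun l => 'D_v (th l) m).
Proof.
move=> hth Um; apply: laurentP => k; rewrite (dcoefE v k (family_tail N hth) Um).
rewrite coef_tailL; case E: (k + N%:Z) => [l|l].
  by apply: derive_eq Um _ => x _; rewrite coef_tailL E.
by apply: (@derive_eq_cst _ _ _ 0 Um) => x _; rewrite coef_tailL E.
Qed.

Lemma dcoef_linear f (a : C) v w m : holomorphic_family f -> U m ->
  dcoef (a *: v + w) f m = cstL a * dcoef v f m + dcoef w f m.
Proof.
move=> hf Um; apply: laurentP => k; rewrite [LHS](dcoefE _ k hf Um) [RHS]coefLD [X in _ = X + _]coef_cstLM.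
rewrite [X in _ = _ * X + _](dcoefE v k hf Um) [X in _ = _ + X](dcoefE w k hf Um).
exact: derive_linear (holomorphic_differentiable (hf.2 k) Um).
Qed.

End Families.

Local Opaque dcoef.

Section VariationsOfFamilies.
Local Open Scope classical_set_scope.
Variables (R : realType) (S : setting R) (U : set (phase S)).
Hypothesis oU : open U.
Local Notation C := (CC R).
Local Notation family := (holomorphic_family U).
Implicit Types (f g : phase S -> laurent C) (m v w : phase S) (c h : phase S -> C).
Implicit Types (A B : phase S -> 'M[laurent C]_2).

Lemma family_prim f : family f -> family (fun m => primL (f m)).
Proof.
move=> [[a fa] hf]; split; first by exists (a + 1) => m Um; apply/zero_below_prim/fa.
move=> k; apply: (holomorphic_eq (f := fun m => if k == 0 then 0 else f m (k - 1) * k%:~R^-1)) => //.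
  by move=> m Um; rewrite primLE.
case: eqP => _; first exact: holomorphic_cst.
by apply: holomorphicM => //; apply: holomorphic_cst.
Qed.

Lemma vary_eq c v f g m : U m -> (forall x, U x -> f x = g x) -> vary c v f m = vary c v g m.
Proof. by move=> Um fg; rewrite /vary (dcoef_eq oU v Um fg) fg. Qed.

Lemma vary_const c v (l : laurent C) m : vary c v (fun=> l) m = - (cstL ('D_v c m) * derivL l).
Proof. by rewrite /vary dcoef_const sub0r. Qed.

Lemma varyD c v f g m : family f -> family g -> U m ->
  vary c v (fun x => f x + g x) m = vary c v f m + vary c v g m.
Proof.
move=> hf hg Um; rewrite /vary (dcoefD oU v hf hg Um) raddfD /=.
by move: (dcoef v f m) (dcoef v g m) => a b; ring.
Qed.

Lemma varyM c v f g m : family f -> family g -> U m ->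
  vary c v (fun x => f x * g x) m = vary c v f m * g m + f m * vary c v g m.
Proof.
move=> hf hg Um; rewrite /vary (dcoefM oU v hf hg Um) derivLM /=.
by move: (dcoef v f m) (dcoef v g m) => a b; ring.
Qed.

(** The derivative of the centre does not depend on z, so both parts of [vary] commute with d/dz.
    With [varyM], this makes [vary] a derivation of the kind assumed in the section [Variation]. *)
Lemma vary_deriv c v f m : family f -> U m ->
  vary c v (fun x => derivL (f x)) m = derivL (vary c v f m).
Proof.
move=> hf Um; rewrite /vary (dcoef_deriv oU v hf Um) raddfB /= derivLM derivL_cst.
by rewrite mul0r add0r.
Qed.

Lemma vary_mono c v h d m : holomorphic_on U h -> U m ->
  vary c v (fun x => monoL (h x) d) m =
  monoL ('D_v h m) d - cstL ('D_v c m) * derivL (monoL (h m) d).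
Proof. by move=> hh Um; rewrite /vary (dcoef_mono oU d v hh Um). Qed.

Lemma vary_cst c v h m : holomorphic_on U h -> U m ->
  vary c v (fun x => cstL (h x)) m = cstL ('D_v h m).
Proof.
by move=> hh Um; rewrite (vary_mono _ _ _ hh Um) -/(cstL (h m)) derivL_cst mulr0 subr0.
Qed.

Lemma family_vary c v f : holomorphic_on U c -> family f -> family (vary c v f).
Proof.
move=> hc hf; apply: familyB => //; first exact: family_dcoef.
by apply: familyM => //; [apply/family_cst/holomorphic_derive|apply: family_deriv].
Qed.

Lemma vary_linear c (a : C) v w f m : holomorphic_on U c -> family f -> U m ->
  vary c (a *: v + w) f m = cstL a * vary c v f m + vary c w f m.
Proof.
move=> hc hf Um; rewrite /vary (dcoef_linear oU a v w hf Um).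
rewrite (derive_linear a v w (holomorphic_differentiable hc Um)).
rewrite rmorphD rmorphM /=.
have E (b x y p q d : laurent C) : b * x + y - (b * p + q) * d = b * (x - p * d) + (y - q * d).
  by ring.
exact: E.
Qed.

Lemma ps_vary c v f m : U m -> (forall x, U x -> is_power_series (f x)) ->
  is_power_series (vary c v f m).
Proof.
move=> Um fa; apply: zero_belowB (zero_below_dcoef oU v Um fa) _.
exact: (zero_belowM (a := 0) (b := 0) _ (zero_below_cst _ _) (ps_deriv (fa m Um))).
Qed.

(** Stated for a fixed centre: the d/dz term of [vary] does not commute with z -> z^2. This
    suffices, since the ramified t_i are prescribed. *)
Lemma vary_square v f m : family f -> U m ->
  vary (fun=> 0) v (fun x => squareL (f x)) m = squareL (vary (fun=> 0) v f m).
Proof.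
move=> hf Um; rewrite /vary (dcoef_square oU v hf Um) derive_cst !rmorph0 !mul0r.
by rewrite !subr0.
Qed.

(** The vanishing residue means that the variation of the primitive contains no logarithm, which
    [primL] would drop. *)
Lemma derivL_vary_prim c v f m : resL (dcoef v f m) = 0 ->
  derivL (vary_prim c v f m) = vary c v f m.
Proof.
move=> f0; rewrite /vary_prim raddfB /= derivL_primL // derivLM derivL_cst.
by rewrite mul0r add0r.
Qed.

Lemma vary_fixed c v f m : 'D_v c m = 0 -> vary c v f m = dcoef v f m.
Proof. by move=> c0; rewrite /vary c0 rmorph0 mul0r subr0. Qed.

Lemma vary_primE c v f m :
  vary_prim c v f m = primL (dcoef v f m) - cstL ('D_v c m) * f m.
Proof. by []. Qed.

Lemma zero_below_vary_prim c v f m a : U m -> (forall x, U x -> zero_below (f x) a) ->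
  zero_below (vary_prim c v f m) a.
Proof.
move=> Um fa; apply: zero_belowB.
  by apply: zero_belowW (zero_below_prim (zero_below_dcoef oU v Um fa)); lia.
by apply: (zero_belowM (a := 0) _ (zero_below_cst _ _) (fa m Um)); rewrite ?add0r.
Qed.

Lemma family_vary_prim c v f : holomorphic_on U c -> family f -> family (vary_prim c v f).
Proof.
move=> hc hf; apply: familyB => //; first exact/family_prim/family_dcoef.
by apply: familyM => //; apply/family_cst/holomorphic_derive.
Qed.

Lemma vary_prim_linear c (a : C) v w f m : holomorphic_on U c -> family f -> U m ->
  vary_prim c (a *: v + w) f m = cstL a * vary_prim c v f m + vary_prim c w f m.
Proof.
move=> hc hf Um; rewrite /vary_prim (dcoef_linear oU a v w hf Um) primL_linear.
rewrite (derive_linear a v w (holomorphic_differentiable hc Um)).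
rewrite rmorphD rmorphM /=.
have E (b x y p q d : laurent C) : b * x + y - (b * p + q) * d = b * (x - p * d) + (y - q * d).
  by ring.
exact: E.
Qed.

Local Opaque vary vary_prim.

Definition family_mx A := forall i j, family (fun m => A m i j).

Lemma family_mx_eq A B : (forall m, U m -> A m = B m) -> family_mx A -> family_mx B.
Proof. by move=> AB hA i j; apply: family_eq (hA i j) => // m Um; rewrite AB. Qed.

Lemma family_mxD A B : family_mx A -> family_mx B -> family_mx (fun m => A m + B m).
Proof.
move=> hA hB i j; apply: family_eq (familyD oU (hA i j) (hB i j)) => // m _.
by rewrite addmxE.
Qed.

Lemma family_mxN A : family_mx A -> family_mx (fun m => - A m).
Proof. by move=> hA i j; apply: family_eq (familyN oU (hA i j)) => // m _; rewrite oppmxE. Qed.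

Lemma family_mxB A B : family_mx A -> family_mx B -> family_mx (fun m => A m - B m).
Proof. by move=> hA hB; apply/family_mxD/family_mxN. Qed.

Lemma family_mxM A B : family_mx A -> family_mx B -> family_mx (fun m => A m *m B m).
Proof.
move=> hA hB i j.
apply: family_eq (familyD oU (familyM oU (hA i 0) (hB 0 j)) (familyM oU (hA i 1) (hB 1 j))) => //.
by move=> m _; rewrite mulmx2E.
Qed.

Lemma family_mx_const (A : 'M[laurent C]_2) : family_mx (fun=> A).
Proof. by move=> i j; apply: family_const. Qed.

Lemma family_mx_deriv A : family_mx A -> family_mx (fun m => map_mx (@derivL C) (A m)).
Proof.
by move=> hA i j; apply: family_eq (family_deriv oU (hA i j)) => // m _; rewrite map_mxE.
Qed.

Lemma family_mx_square A : family_mx A -> family_mx (fun m => map_mx (@squareL C) (A m)).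
Proof.
by move=> hA i j; apply: family_eq (family_square oU (hA i j)) => // m _; rewrite map_mxE.
Qed.

Lemma family_mx2 f g f' g' : family f -> family g -> family f' -> family g' ->
  family_mx (fun m => mx2 (f m) (g m) (f' m) (g' m)).
Proof.
move=> hf hg hf' hg'; do 2![apply: ord2P].
- by apply: family_eq hf => // m _; rewrite mx2E.
- by apply: family_eq hg => // m _; rewrite mx2E.
- by apply: family_eq hf' => // m _; rewrite mx2E.
- by apply: family_eq hg' => // m _; rewrite mx2E.
Qed.

Lemma family_diag2 f g : family f -> family g -> family_mx (fun m => diag2 (f m) (g m)).
Proof. by move=> hf hg; apply: family_mx2 => //; apply: family_const. Qed.

Lemma family_tr A : family_mx A -> family (fun m => \tr (A m)).
Proof.
move=> hA; apply: family_eq (familyD oU (hA 0 0) (hA 1 1)) => // m _.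
by rewrite mxtrace2.
Qed.

Lemma family_invmx A : family_mx A ->
  (forall m, U m -> is_power_series_mx (A m) /\ Defs.coefM (A m) 0 \in unitmx) ->
  family_mx (fun m => invmx (A m)).
Proof.
move=> hA uA; pose d m : laurent C := A m 0 0 * A m 1 1 - A m 0 1 * A m 1 0.
have d0 m : U m -> is_power_series (d m) /\ d m 0 != 0.
  by move=> /uA[Ap uA0]; have [[dp ->]] := det_coef0 Ap uA0.
have hd : family d by apply: familyB => //; apply: familyM.
have hV := familyV oU hd d0.
have H : family_mx (fun m => mx2 ((d m)^-1 * A m 1 1) ((d m)^-1 * - A m 0 1)
                           ((d m)^-1 * - A m 1 0) ((d m)^-1 * A m 0 0)).
  by apply: family_mx2; apply: familyM => //; apply: familyN.
apply: family_mx_eq H => m Um; apply/esym/invmx_eq.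
have nz : d m != 0 by have [_] := d0 m Um; apply: contraNneq => ->.
rewrite -[RHS](invmx2 nz); congr (_ *m _); apply/matrixP.
by do 2![apply: ord2P]; rewrite [RHS]mxE !mx2E.
Qed.

Lemma vary_mxE c v A m i j : vary_mx c v A m i j = vary c v (fun x => A x i j) m.
Proof. by rewrite mxE. Qed.

Local Opaque vary_mx.

Lemma vary_mx_eq c v A B m : U m -> (forall x, U x -> A x = B x) ->
  vary_mx c v A m = vary_mx c v B m.
Proof.
move=> Um AB; apply/matrixP => i j; rewrite !vary_mxE; apply: vary_eq Um _ => x Ux.
by rewrite AB.
Qed.

Lemma vary_mxD c v A B m : family_mx A -> family_mx B -> U m ->
  vary_mx c v (fun x => A x + B x) m = vary_mx c v A m + vary_mx c v B m.
Proof.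
move=> hA hB Um; apply/matrixP => i j; rewrite addmxE !vary_mxE.
rewrite -(varyD _ _ (hA i j) (hB i j) Um).
by apply: vary_eq Um _ => x _; rewrite addmxE.
Qed.

Lemma vary_mxM c v A B m : family_mx A -> family_mx B -> U m ->
  vary_mx c v (fun x => A x *m B x) m = vary_mx c v A m *m B m + A m *m vary_mx c v B m.
Proof.
move=> hA hB Um; apply/matrixP => i j; rewrite [RHS]addmxE [X in _ = X + _]mulmx2E [X in _ = _ + X]mulmx2E.
rewrite [LHS]vary_mxE !vary_mxE addrACA -(varyM _ _ (hA i 0) (hB 0 j) Um) -(varyM _ _ (hA i 1) (hB 1 j) Um).
rewrite -(varyD _ _ (familyM oU (hA i 0) (hB 0 j)) (familyM oU (hA i 1) (hB 1 j)) Um).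
by apply: vary_eq Um _ => x _; rewrite mulmx2E.
Qed.

Lemma vary_mxN c v A m : family_mx A -> U m ->
  vary_mx c v (fun x => - A x) m = - vary_mx c v A m.
Proof.
move=> hA Um; apply/matrixP => i j; rewrite oppmxE !vary_mxE; apply/eqP.
rewrite -addr_eq0 -(varyD _ _ (family_mxN hA i j) (hA i j) Um).
rewrite (vary_eq (g := fun=> 0) _ _ Um) => [|x _]; last by rewrite oppmxE addNr.
by rewrite vary_const raddf0 mulr0 oppr0.
Qed.

Lemma vary_mx_deriv c v A m : family_mx A -> U m ->
  vary_mx c v (fun x => map_mx (@derivL C) (A x)) m = map_mx (@derivL C) (vary_mx c v A m).
Proof.
move=> hA Um; apply/matrixP => i j; rewrite map_mxE !vary_mxE.
rewrite -(vary_deriv _ _ (hA i j) Um).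
by apply: vary_eq Um _ => x _; rewrite map_mxE.
Qed.

Lemma vary_mx_fixed c v (A : 'M[laurent C]_2) m : 'D_v c m = 0 ->
  vary_mx c v (fun=> A) m = 0.
Proof.
by move=> c0; apply/matrixP => i j; rewrite vary_mxE vary_const c0 rmorph0 mul0r oppr0 mxE.
Qed.

Lemma vary_diag2 c v f g m : U m ->
  vary_mx c v (fun x => diag2 (f x) (g x)) m = diag2 (vary c v f m) (vary c v g m).
Proof.
move=> Um.
have E0 : vary c v (fun=> 0) m = 0 by rewrite vary_const raddf0 mulr0 oppr0.
apply: mx2P; rewrite [LHS]vary_mxE diag2E.
- by apply: vary_eq Um _ => x _; rewrite diag2E.
- by rewrite -[RHS]E0; apply: vary_eq Um _ => x _; rewrite diag2E.
- by rewrite -[RHS]E0; apply: vary_eq Um _ => x _; rewrite diag2E.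
- by apply: vary_eq Um _ => x _; rewrite diag2E.
Qed.

Lemma vary_mx_linear c (a : C) v w A m : holomorphic_on U c -> family_mx A -> U m ->
  vary_mx c (a *: v + w) A m = cstL a *: vary_mx c v A m + vary_mx c w A m.
Proof.
move=> hc hA Um; apply/matrixP => i j; rewrite [RHS]addmxE [X in _ = X + _]mxE.
rewrite [LHS]vary_mxE [X in _ = _ * X + _]vary_mxE [X in _ = _ + X]vary_mxE.
exact: (vary_linear a v w hc (hA i j) Um).
Qed.

Lemma family_vary_mx c v A : holomorphic_on U c -> family_mx A -> family_mx (vary_mx c v A).
Proof.
move=> hc hA i j; apply: family_eq (family_vary v hc (hA i j)) => // m _.
by rewrite vary_mxE.
Qed.

Lemma ps_vary_mx c v A m : U m -> (forall x, U x -> is_power_series_mx (A x)) ->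
  is_power_series_mx (vary_mx c v A m).
Proof.
by move=> Um Ap i j; rewrite vary_mxE; apply: ps_vary => // x Ux; apply: Ap.
Qed.

Lemma vary_connection c v Y L Om m : family_mx Y -> family_mx L -> family_mx Om -> U m ->
  (forall x, U x -> connection_eq (Y x) (L x) (Om x)) ->
  variation_eq (Y m) (L m) (Om m) (vary_mx c v Y m) (vary_mx c v L m) (vary_mx c v Om m).
Proof.
move=> hY hL hO Um eqY.
have hYz := family_mx_deriv hY; have hYL := family_mxM hY hL; have hOY := family_mxM hO hY.
rewrite /variation_eq -(vary_mx_deriv _ _ hY Um) -(vary_mxM _ _ hY hL Um).
rewrite -(vary_mxM _ _ hO hY Um) -(vary_mxN _ _ hYL Um).
rewrite -(vary_mxD _ _ hYz (family_mxN hYL) Um).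
rewrite -(vary_mxD _ _ (family_mxB hYz hYL) hOY Um).
rewrite (vary_mx_eq (B := fun=> 0) _ _ Um) => [|x Ux]; last exact: eqY.
by apply/matrixP => i j; rewrite vary_mxE !mxE vary_const raddf0 mulr0 oppr0.
Qed.

(** * The residue form of a formal solution, common to the three kinds of points *)

Section ResidueForm.
Variables (c : phase S -> C) (Y Om : phase S -> 'M[laurent C]_2) (L1 L2 : phase S -> laurent C).
Hypotheses (hc : holomorphic_on U c) (hY : family_mx Y) (hYV : family_mx (fun m => invmx (Y m))).
Hypotheses (hL1 : family L1) (hL2 : family L2) (hOm : family_mx Om).
Hypothesis uY : forall m, U m -> Y m \in unitmx.
Hypothesis eqY : forall m, U m -> connection_eq (Y m) (diag2 (L1 m) (L2 m)) (Om m).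
Hypothesis resL1 : forall m v, U m -> resL (dcoef v L1 m) = 0.
Hypothesis resL2 : forall m v, U m -> resL (dcoef v L2 m) = 0.

(** The common shape of [dlog_unr], [dlog_ram] and, by [dlog_qE], [dlog_q]. *)
Definition log_variation v m :=
  dlog (Y m) (vary_mx c v Y m) (diag2 (vary_prim c v L1 m) (vary_prim c v L2 m)).

Definition residue_form m :=
  res_wedge (fun v => vary_mx c v Om m) (fun v => log_variation v m).

Lemma variation_family v m : U m ->
  variation_eq (Y m) (diag2 (L1 m) (L2 m)) (Om m) (vary_mx c v Y m)
    (diag2 (vary c v L1 m) (vary c v L2 m)) (vary_mx c v Om m).
Proof.
by move=> Um; rewrite -(vary_diag2 c v L1 L2 Um); apply: vary_connection => //; apply: family_diag2.
Qed.

Lemma variation_dlog v m : U m ->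
  vary_mx c v Om m = - map_mx (@derivL C) (log_variation v m)
    - (Om m *m log_variation v m - log_variation v m *m Om m).
Proof.
move=> Um; apply: dlog_variation (uY Um) _ _ (eqY Um) (variation_family v Um).
  by apply: mx2P; rewrite !mulmx2E !diag2E; ring.
apply: mx2P; rewrite map_mxE !diag2E ?raddf0 // derivL_vary_prim //.
  exact: resL1.
exact: resL2.
Qed.

Lemma residue_formE m v1 v2 : U m ->
  residue_form m v1 v2 = 2%:R * resL (\tr (vary_mx c v1 Om m *m log_variation v2 m)).
Proof.
by move=> Um; apply: res_wedge_variation; apply: variation_dlog.
Qed.

Lemma log_variation_linear a v w m : U m ->
  log_variation (a *: v + w) m = cstL a *: log_variation v m + log_variation w m.
Proof.
move=> Um; rewrite /log_variation /dlog (vary_mx_linear _ _ _ hc hY Um).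
rewrite (vary_prim_linear _ _ _ hc hL1 Um) (vary_prim_linear _ _ _ hc hL2 Um).
have -> (x y z t k : laurent C) : diag2 (k * x + y) (k * z + t) = k *: diag2 x z + diag2 y t.
  by apply: mx2P; rewrite [RHS]addmxE [X in _ = X + _]mxE !diag2E // mulr0 addr0.
rewrite mulmxDr -scalemxAr opprD addrACA -scalerBr mulmxDl.
by rewrite -scalemxAl.
Qed.

Lemma residue_form_linear m a v w u : U m ->
  residue_form m (a *: v + w) u = a * residue_form m v u + residue_form m w u.
Proof.
move=> Um; rewrite /residue_form /res_wedge (log_variation_linear _ _ _ Um).
rewrite (vary_mx_linear _ _ _ hc hOm Um) !mulmxDl -!scalemxAl opprD addrACA -scalerBr.
have E (X Z : 'M[laurent C]_2) : resL (\tr (cstL a *: X + Z)) = a * resL (\tr X) + resL (\tr Z).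
  by rewrite mxtraceD mxtraceZ resLD; congr (_ + _); apply: coef_cstLM.
exact: E.
Qed.

Lemma residue_form_antisym m v w : residue_form m v w = - residue_form m w v.
Proof.
have E (X1 X2 Z1 Z2 : 'M[laurent C]_2) :
    resL (\tr (X1 *m Z2 - Z1 *m X2)) = - resL (\tr (X2 *m Z1 - Z2 *m X1)).
  by rewrite -resLN; congr resL; rewrite !mxtrace2 !entriesE; ring.
exact: E.
Qed.

Lemma holomorphic_residue_form v w : holomorphic_on U (fun m => residue_form m v w).
Proof.
have hB u : family_mx (log_variation u).
  apply: family_mxM => //; apply: family_mxB; first exact: family_vary_mx.
  by apply: family_mxM => //; apply: family_diag2; apply: family_vary_prim.
have H : family_mx (fun m => vary_mx c v Om m *m log_variation w m
                         - log_variation v m *m vary_mx c w Om m).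
  by apply: family_mxB; apply: family_mxM => //; apply: family_vary_mx.
exact: (family_tr H).2.
Qed.

End ResidueForm.

End VariationsOfFamilies.

Local Opaque vary vary_prim vary_mx.

Lemma ps_tail (K : fieldType) n (a : nat -> K) :
  (forall l, (l < n)%N -> a l = 0) -> is_power_series (tailL n a).
Proof.
move=> a0 k k0; rewrite coef_tailL; case E: (k + n%:Z) => [l|//].
by apply: a0; lia.
Qed.

(** The source of the Hamiltonians. Here [a] and [b] stand for the variations of the exponents [th]
    along [v1] and [v2], and [d] for that of the centre. A term a_k z^(k-n) meets the primitive
    z^(l-n+1) / (l-n+1) in degree -1 when k + l = 2n - 2, and the shift d th_l z^(l-n) when k + l =
    2n - 1. The vanishing of a_k for k < n bounds l. *)
Lemma res_tail_prim (K : numFieldType) n (a b th : nat -> K) (d : K) : (0 < n)%N ->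
  (forall l, (l < n)%N -> a l = 0) ->
  - resL (tailL n a * (primL (tailL n b) - cstL d * tailL n th)) =
  \sum_(l < n.-1) a (2 * n - l - 2)%N / (n - l - 1)%:R * b l
  + \sum_(l < n) th l * a (2 * n - l - 1)%N * d.
Proof.
case: n => // n _ a0; set g := primL _ - _.
have ta : zero_below (tailL n.+1 a) 0 by apply: ps_tail.
have tg : zero_below g (- n.+1%:Z).
  apply: zero_belowB.
    by apply: zero_belowW (zero_below_prim (zero_below_tail b (lexx _))); lia.
  by apply: (zero_belowM (a := 0) _ (zero_below_cst _ _) (zero_below_tail th (lexx _))); rewrite ?add0r.
(* The pole order is now [n.+1]. The summand [i] pairs degree i of the first factor with degree - 1
   - i of [g]; for i = n the primitive has no term that low. *)
have -> : resL (tailL n.+1 a * g) = \sum_(i < n.+1) a (n.+1 + i)%N *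
    ((if (i < n)%N then - (b (n.-1 - i)%N / i.+1%:R) else 0) - d * th (n - i)%N).
  rewrite /resL coefLE (_ : -1 = 0 + - n.+1%:Z + n%:Z); last by lia.
  rewrite (Defs.cauchyE _ ta tg); apply: eq_bigr => i _; have lei := ltn_ord i.
  rewrite coef_tailL (_ : 0 + i%:Z + n.+1%:Z = (n.+1 + i)%N); last by lia.
  congr (_ * _); rewrite coefLB coef_cstLM coef_tailL primLE coef_tailL.
  rewrite (_ : - n.+1%:Z + (n - i)%N%:Z + n.+1%:Z = (n - i)%N); last by lia.
  congr (_ - _); rewrite ifF; last by apply/eqP; lia.
  rewrite (_ : (- n.+1%:Z + (n - i)%N%:Z)%:~R = - (i.+1%:R) :> K); last first.
    rewrite -[i.+1%:R]/((i.+1%:Z)%:~R) -mulrNz; congr (_%:~R); lia.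
  case: ifPn => lin.
    rewrite (_ : - n.+1%:Z + (n - i)%N%:Z - 1 + n.+1%:Z = (n.-1 - i)%N); last by lia.
    by rewrite invrN mulrN.
  have -> : - n.+1%:Z + (n - i)%N%:Z - 1 + n.+1%:Z = Negz 0 by lia.
  by rewrite mul0r.
rewrite -sumrN.
rewrite (eq_bigr (fun i : 'I_n.+1 => (if (i < n)%N then a (n.+1 + i)%N * (b (n.-1 - i)%N / i.+1%:R) else 0)
    + th (n - i)%N * a (n.+1 + i)%N * d)); last first.
  by move=> i _; case: ifP => _; ring.
rewrite big_split /=; congr (_ + _).
  rewrite big_ord_recr /= ltnn addr0 [RHS](reindex_inj rev_ord_inj) /=.
  apply: eq_bigr => i _; have lei := ltn_ord i; rewrite lei mulrA mulrAC.
  congr (a _ / _%:R * b _); lia.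
rewrite [RHS](reindex_inj rev_ord_inj) /=; apply: eq_bigr => i _; have lei := ltn_ord i.
by congr (th _ * a _ * d); lia.
Qed.

(** * Unramified points *)

Section LocalContributions.
Local Open Scope classical_set_scope.
Variables (R : realType) (S : setting R) (N : phase S -> normal_form S) (F : formal_solutions S).
Hypothesis solF : are_formal_solutions N F.
Local Notation C := (CC R).
Local Notation I := (option 'I_(nu S)).
Local Notation U := (@phase_set R S).
Local Notation z := (varL C).
Local Notation family := (holomorphic_family U).
Local Notation family_mx := (@family_mx R S U).
Let oU : open U := @open_phase_set R S.

Lemma base_of_phase m : U m -> base_set (proj m).
Proof. by case. Qed.

Lemma holomorphic_center i : holomorphic_on U (Defs.center i).
Proof.
case: i => [i|]; last exact: holomorphic_cst.
exact: holomorphic_proj base_of_phase (holomorphic_t _ _).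
Qed.

Lemma derive_center_vertical i (m v : phase S) : proj v = 0 -> 'D_v (Defs.center i) m = 0.
Proof.
move=> v0; case: i => [i|]; last exact: derive_cst.
exact: (derive_vertical (fun b => t_of b i)).
Qed.

Lemma family_cst_Phi i : family_mx (fun m => cst_mx (Phi F i (proj m))).
Proof.
move=> a b; have H := holomorphic_proj base_of_phase (fs_Phi solF i a b).
by apply: family_eq (family_cst oU H) => // m _; rewrite map_mxE.
Qed.

Lemma vary_cst_Phi i c v m : U m -> proj v = 0 -> 'D_v c m = 0 ->
  vary_mx c v (fun m => cst_mx (Phi F i (proj m))) m = 0.
Proof.
move=> Um v0 c0; apply/matrixP => a b; rewrite vary_mxE [RHS]mxE.
have H := holomorphic_proj base_of_phase (fs_Phi solF i a b).
transitivity (vary c v (fun m => cstL (Phi F i (proj m) a b)) m).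
  by apply: (vary_eq oU) => // x _; rewrite map_mxE.
by rewrite (vary_cst oU c v H Um) (derive_vertical (fun b' => Phi F i b' a b) m v0) rmorph0.
Qed.

Lemma Phi_unit i m : U m -> Phi F i (proj m) \in unitmx.
Proof.
move=> Um; have [ri|ri] := boolP (is_ram (typ i)).
  by case: (fs_ram solF Um ri).
by case: (fs_unr solF Um ri).
Qed.

Lemma Xi_ps i m : U m -> is_power_series_mx (Xi F i m).
Proof.
move=> Um; have [ri|ri] := boolP (is_ram (typ i)).
  by case: (fs_ram solF Um ri).
by case: (fs_unr solF Um ri).
Qed.

Lemma Xi_coef0 i m : U m -> Defs.coefM (Xi F i m) 0 = 1%:M.
Proof.
move=> Um; have [ri|ri] := boolP (is_ram (typ i)).
  by case: (fs_ram solF Um ri).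
by case: (fs_unr solF Um ri).
Qed.

Lemma Xi_entry0 i m a b : U m -> Xi F i m a b 0 = (a == b)%:R.
Proof. by move=> /(Xi_coef0 i)/matrixP/(_ a b); rewrite !mxE. Qed.

Lemma family_Xi i : family_mx (Xi F i).
Proof.
move=> a b; split; first by exists 0 => m Um; apply: Xi_ps.
by move=> k; exact: (fs_Xi solF i a b k).
Qed.

Lemma coefM_cst_mx (A : 'M[C]_2) : Defs.coefM (cst_mx A) 0 = A.
Proof. by apply/matrixP => i j; rewrite !mxE coef_cstL. Qed.

(* [cst_mx Phi *m X] for a power series [X] with constant term 1, that is for *)
(* [X = Xi] or [X = Xi(z^2)] *)
Section Framed.
Variables (i : I) (X : phase S -> 'M[laurent C]_2).
Hypotheses (hX : family_mx X) (Xp : forall m, U m -> is_power_series_mx (X m)).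
Hypothesis X0 : forall m, U m -> Defs.coefM (X m) 0 = 1%:M.
Let Y m := cst_mx (Phi F i (proj m)) *m X m.

Lemma framed_ps m : U m -> is_power_series_mx (Y m).
Proof. by move=> Um; apply: (zero_below_mxM _ (zero_below_cst_mx _) (Xp Um)). Qed.

Lemma framed_coef0 m : U m -> Defs.coefM (Y m) 0 \in unitmx.
Proof.
move=> Um; rewrite (coefMM (zero_below_cst_mx _) (Xp Um)) X0 // mulmx1.
by rewrite coefM_cst_mx Phi_unit.
Qed.

Lemma framed_unit m : U m -> Y m \in unitmx /\ is_power_series_mx (invmx (Y m)).
Proof. by move=> Um; apply: ps_invmx; [apply: framed_ps|apply: framed_coef0]. Qed.

Lemma family_framed : family_mx Y.
Proof. by apply: family_mxM => //; apply: family_cst_Phi. Qed.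

Lemma family_framedV : family_mx (fun m => invmx (Y m)).
Proof.
apply: (family_invmx oU family_framed) => m Um; split; first exact: framed_ps.
exact: framed_coef0.
Qed.

Lemma vary_framed_vertical c v m : U m -> proj v = 0 -> 'D_v c m = 0 ->
  vary_mx c v Y m = cst_mx (Phi F i (proj m)) *m vary_mx c v X m.
Proof.
move=> Um v0 c0; rewrite (vary_mxM oU _ _ (family_cst_Phi i) hX Um).
by rewrite vary_cst_Phi // mul0mx add0r.
Qed.

End Framed.

Section Unramified.
Variable i : I.
Hypothesis unr_i : ~~ is_ram (typ i).
Let n : nat := pole i.
Let Y := framed F i.
Let Om := Omega_unr N i.
Let L s := dlambda F i s.

Let sol m (Um : U m) : unramified_solution N F i m := fs_unr solF Um unr_i.

Let hY : family_mx Y.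
Proof. by apply: family_framed; [apply: family_Xi]. Qed.

Let hYV : family_mx (fun m => invmx (Y m)).
Proof. by apply: family_framedV => [|m Um|m Um]; [apply: family_Xi|apply: Xi_ps|apply: Xi_coef0]. Qed.

Let uY m : U m -> Y m \in unitmx.
Proof. by move=> Um; have [] := framed_unit i (Xi_ps i) (Xi_coef0 i) Um. Qed.

Let YVp m : U m -> is_power_series_mx (invmx (Y m)).
Proof. by move=> Um; have [] := framed_unit i (Xi_ps i) (Xi_coef0 i) Um. Qed.

Let Yp m : U m -> is_power_series_mx (Y m).
Proof. by move=> Um; apply: (framed_ps i (Xi_ps i)). Qed.

Let hth s l : holomorphic_on U (th F i s l).
Proof. exact: (fs_th solF s l unr_i). Qed.

Let hL s : family (L s).
Proof. exact: (family_tail oU n (hth s)). Qed.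

Let OmE m : U m -> Om m = - dlog (Y m) (map_mx (@derivL C) (Y m)) (diag2 (L true m) (L false m)).
Proof. by move=> Um; have /eqP := unr_solves (sol Um); rewrite addrC addr_eq0 => /eqP. Qed.

Let eqY m : U m -> connection_eq (Y m) (diag2 (L true m) (L false m)) (Om m).
Proof. by move=> Um; apply: connection_eq_dlog (uY Um) (OmE Um). Qed.

Let hOm : family_mx Om.
Proof.
have H : family_mx (fun m => - ((map_mx (@derivL C) (Y m) - Y m *m diag2 (L true m) (L false m)) *m invmx (Y m))).
  apply: family_mxN => //; apply: family_mxM => //; apply: family_mxB => //.
    exact: family_mx_deriv.
  by apply: family_mxM => //; apply: family_diag2 => //; apply: hL.
by apply: (family_mx_eq oU _ H) => m Um; rewrite (OmE Um).
Qed.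

(** The residue exponent is a fixed constant on the whole phase space. *)
Let resL0 s m v : U m -> resL (dcoef v (L s) m) = 0.
Proof.
move=> Um; rewrite (dcoef_tail oU n v (hth s) Um) /resL coef_tailL.
have -> : -1 + n%:Z = n.-1 by have := pole_gt0 i; rewrite -/n; lia.
rewrite -[LHS]/('D_v (th F i s n.-1) m).
apply: (derive_eq_cst oU (a := th_res S i s) _ Um) => x Ux.
rewrite (unr_th (sol Ux)); last by have := pole_gt0 i; rewrite -/n; lia.
(* The index n - 1 is outside ['I_n.-1], so [th_unr] falls back on its default [th_res]. *)
by rewrite /th_unr /th_coord insubF //= ltnn.
Qed.

Let form := residue_form (Defs.center i) Y Om (L true) (L false).

Let hc := holomorphic_center i.

Lemma unr_linear m a v w u : U m -> form m (a *: v + w) u = a * form m v u + form m w u.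
Proof. exact: (residue_form_linear oU hc hY (hL true) (hL false) hOm). Qed.

Lemma unr_holomorphic v w : holomorphic_on U (fun m => form m v w).
Proof. exact: (holomorphic_residue_form oU hc hY hYV (hL true) (hL false) hOm). Qed.

Let th_eigen0 m : U m -> th F i true 0 m - th F i false 0 m != 0.
Proof.
move=> Um; rewrite !(unr_th (sol Um)) ?pole_gt0 // subr_eq0.
have [[_ H _] _ _] := Um; have := poleP i; case E: (typ i) => [||] /= => [p1|_|].
(* At a regular point the leading exponents are the residues; they differ by [nonresonant] with the
   integer 0. *)
- rewrite /th_unr /th_coord !insubF ?p1 //= -subr_eq0.
  by have := nonresonant (s := S) (i := i); rewrite E => /(_ isT 0).
- by apply: H; rewrite E.
- by move: unr_i; rewrite E.
Qed.

Let OmN m : U m -> zero_below_mx (Om m) (- n%:Z).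
Proof.
move=> Um; rewrite (OmE Um); apply: zero_below_mxN.
apply: (zero_below_mxM (b := 0) _ _ (YVp Um)); first by rewrite addr0.
apply: zero_below_mxD; first by apply: zero_belowW_mx (ps_mx_deriv (Yp Um)); lia.
apply/zero_below_mxN/(zero_below_mxM (a := 0) _ (Yp Um)); first by rewrite add0r.
by apply: zero_below_diag2; apply: zero_below_tail.
Qed.

Section Vertical.
Variables (m v1 v2 : phase S).
Hypotheses (Um : U m) (v0 : proj v1 = 0).
Local Notation c := (Defs.center i).

Let c0 : 'D_v1 c m = 0 := derive_center_vertical i m v0.

Let Dth0 s l : (l < n)%N -> 'D_v1 (th F i s l) m = 0.
Proof.
move=> ln; rewrite -[RHS](derive_vertical (fun b => th_unr b i s l) m v0).
by apply: (derive_eq oU _ Um) => x Ux; rewrite (unr_th (sol Ux)).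
Qed.

Let DLE s : vary c v1 (L s) m = tailL n (fun l => 'D_v1 (th F i s l) m).
Proof. by rewrite (vary_fixed _ c0); apply: (dcoef_tail oU n v1 (hth s) Um). Qed.

Let logp : is_power_series_mx (log_variation c Y (L true) (L false) v1 m).
Proof.
have lp s : is_power_series (vary_prim c v1 (L s) m).
  rewrite vary_primE c0 rmorph0 mul0r subr0 -(vary_fixed _ c0) DLE.
  by apply: zero_belowW (zero_below_prim (ps_tail (Dth0 s))).
apply: (zero_below_mxM (a := 0) (b := 0) _ _ (YVp Um)); first by rewrite addr0.
apply: zero_below_mxD; first exact: (ps_vary_mx oU c v1 Um Yp).
apply/zero_below_mxN/(zero_below_mxM (a := 0) (b := 0) _ (Yp Um)); first by rewrite addr0.
by apply: zero_below_diag2; apply: lp.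
Qed.

Let DOmp : is_power_series_mx (vary_mx c v1 Om m).
Proof.
have E := variation_dlog oU c hY (hL true) (hL false) hOm uY eqY (resL0 true) (resL0 false) v1 Um.
have [Om00 Om01] := Omega_row0 m (N m) i.
apply: (variation_power_series (e := n%:Z) E logp).
- exact: Om00.
- rewrite vary_mxE (vary_eq oU (g := fun=> 0) c v1 Um); last first.
    by move=> x _; have [] := Omega_row0 x (N x) i.
  exact: (vary_vertical (fun=> 0) v0 c0).
- rewrite vary_mxE (vary_eq oU (g := fun x => upper_entry i (proj x)) c v1 Um); last first.
    by move=> x _; have [] := Omega_row0 x (N x) i.
  exact: (vary_vertical (upper_entry i) v0 c0).
- by rewrite [X in X != 0]Om01; apply: upper_entry_neq0.
- by rewrite [X in X^-1%R]Om01; apply: zero_below_upper_entryV.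
- exact: OmN.
Qed.

(** The first inner sum is to become the dH_theta /\ dtheta terms, the second the dH_t /\ dt term.
    The factor [half] cancels the 2 of [residue_formE]. *)
Lemma unr_vertical :
  Defs.half C * form m v1 v2 =
  \sum_s (\sum_(l < n.-1) 'D_v1 (th F i s (2 * n - l - 2)%N) m / (n - l - 1)%:R * 'D_v2 (th F i s l) m
  + \sum_(l < n) th F i s l m * 'D_v1 (th F i s (2 * n - l - 1)%N) m * 'D_v2 c m).
Proof.
rewrite /form (residue_formE oU c hY (hL true) (hL false) hOm uY eqY (resL0 true) (resL0 false)) //.
rewrite mulrA mulVf ?pnatr_eq0 // mul1r.
have V := variation_family oU c hY (hL true) (hL false) hOm eqY v1 Um.
pose X := Xi F i m.
have Xp : is_power_series_mx X := Xi_ps i Um.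
have X0 : Defs.coefM X 0 = 1%:M := Xi_coef0 i Um.
have [uX XVp] : X \in unitmx /\ is_power_series_mx (invmx X).
  by apply: ps_invmx => //; rewrite X0 unitmx1.
(* As this holds on all of [U], the diagonal of the variation of [Xi] vanishes, which expresses
   [y 0 0] and [y 1 1] by the off-diagonal entries. *)
have Xdiag a x : U x -> Xi F i x a a = 1.
  move=> Ux; apply: laurentP => k; rewrite coefL1; have [->|k0] := eqVneq k 0.
    by rewrite Xi_entry0 // eqxx.
  by have := unr_Xi_diag (sol Ux) a k0; rewrite mxE.
pose DX := vary_mx c v1 (Xi F i) m.
have DXd a : DX a a = 0.
  rewrite /DX vary_mxE (vary_eq oU (g := fun=> 1) c v1 Um) => [|x Ux]; last exact: Xdiag.
  by rewrite vary_const derivL1 mulr0 oppr0.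
pose y := invmx (Y m) *m vary_mx c v1 Y m.
(* [Phi] depends on the base only, so it is constant along [v1] and cancels. *)
have Xy : X *m y = DX.
  have E : vary_mx c v1 Y m = cst_mx (Phi F i (proj m)) *m DX.
    exact: (vary_framed_vertical i (family_Xi i) Um v0 c0).
  have uP : cst_mx (Phi F i (proj m)) \in unitmx by rewrite map_unitmx Phi_unit.
  have EYy : Y m *m y = vary_mx c v1 Y m := mulKVmx (uY Um) _.
  by apply: (can_inj (mulKmx uP)); rewrite mulmxA -E -EYy.
have yp : is_power_series_mx y.
  exact: (zero_below_mxM (a := 0) (b := 0) _ (YVp Um) (ps_vary_mx oU c v1 Um Yp)).
have X01 a b : a != b -> zero_below (X a b) 1.
  move=> ab k k1; have [k0|k0] := ltrP k 0; first exact: Xp.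
  by have -> : k = 0 by [lia]; rewrite Xi_entry0 // (negPf ab).
have y00 : y 0 0 = - (X 0 1 * y 1 0).
  apply/eqP; rewrite -addr_eq0; apply/eqP.
  by rewrite -[RHS](DXd 0) -Xy (mulmx2E X y) (Xdiag 0 m Um : X 0 0 = 1) mul1r.
have y11 : y 1 1 = - (X 1 0 * y 0 1).
  apply/eqP; rewrite -addr_eq0 addrC; apply/eqP.
  by rewrite -[RHS](DXd 1) -Xy (mulmx2E X y) (Xdiag 1 m Um : X 1 1 = 1) mul1r.
have LNn : zero_below (L true m - L false m) (- n%:Z).
  by apply: zero_belowB; apply: zero_below_tail.
have Ln : (L true m - L false m) (- n%:Z) != 0.
  by rewrite coefLB !coef_tailL addNr; apply: th_eigen0.
have [LV _] := zero_belowV LNn Ln; rewrite opprK in LV.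
have L0 : L true m - L false m != 0 by apply: contraNneq Ln => ->.
have ln s : zero_below (vary_prim c v2 (L s) m) (- n%:Z).
  by apply: (zero_below_vary_prim oU c v2 Um) => x _; apply: zero_below_tail.
have Wp : is_power_series_mx (invmx (Y m) *m vary_mx c v1 Om m *m Y m).
  apply: (zero_below_mxM (a := 0) (b := 0) _ _ (Yp Um)); first by rewrite addr0.
  exact: (zero_below_mxM (a := 0) (b := 0) _ (YVp Um) DOmp).
have D2p : is_power_series_mx (vary_mx c v2 Y m *m invmx (Y m)).
  exact: (zero_below_mxM (a := 0) (b := 0) _ (ps_vary_mx oU c v2 Um Yp) (YVp Um)).
have H := residue_vertical (uY Um) (eqY Um) V L0 LV yp y00 y11 (X01 0 1 isT) (X01 1 0 isT)
  Wp DOmp D2p (ln true) (ln false).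
rewrite [LHS]H big_bool.
have E s : - resL (vary c v1 (L s) m * vary_prim c v2 (L s) m) =
    \sum_(l < n.-1) 'D_v1 (th F i s (2 * n - l - 2)%N) m / (n - l - 1)%:R * 'D_v2 (th F i s l) m
  + \sum_(l < n) th F i s l m * 'D_v1 (th F i s (2 * n - l - 1)%N) m * 'D_v2 c m.
  rewrite vary_primE DLE (dcoef_tail oU n v2 (hth s) Um).
  by apply: (res_tail_prim _ _ _ (pole_gt0 i)) => l; apply: Dth0.
by rewrite !E.
Qed.

End Vertical.
End Unramified.

End LocalContributions.

Lemma mul_mx2_zeta (K : fieldType) (x : K) : x != 0 -> 2%:R != 0 :> K ->
  mx2 1 1 x (- x) *m mx2 2%:R^-1 (2%:R * x)^-1 2%:R^-1 (- (2%:R * x)^-1) = 1%:M.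
Proof.
by move=> x0 t0; apply: mx2P; rewrite mulmx2E !mx2E mxE /=; field; rewrite ?x0 ?t0.
Qed.

Lemma mx2_zeta_diagonal (K : fieldType) (x a b : K) : x != 0 -> 2%:R != 0 :> K ->
  (2%:R * x) *: mx2 a b (x ^+ 2 * b) (a - (2%:R * x ^+ 2)^-1) *m mx2 1 1 x (- x)
    + mx2 0 0 1 (- 1) =
  mx2 1 1 x (- x) *m diag2 (2%:R * x * (a + x * b)) (2%:R * x * (a - x * b)).
Proof.
by move=> x0 t0; apply: mx2P; rewrite !entriesE !scalemxE !diag2E !mx2E; field; rewrite ?x0 ?t0.
Qed.

(** * Ramified points *)

Section RamifiedFrame.
Variable R : realType.
Local Notation C := (CC R).
Local Notation z := (varL C).
Local Notation M := (M_zeta R).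

Lemma two_neq0 : (2%:R : laurent C) != 0.
Proof.
rewrite -(rmorph_nat (@cstL C)); apply/eqP => /(congr1 (fun f : laurent C => f 0)) /eqP.
by rewrite coef_cstL eqxx coefL0 pnatr_eq0.
Qed.

Lemma mul_M_zeta : M *m mx2 2%:R^-1 (2%:R * z)^-1 2%:R^-1 (- (2%:R * z)^-1) = 1%:M.
Proof.
exact: mul_mx2_zeta (varL_neq0 C) two_neq0.
Qed.

Lemma M_zeta_unit : M \in unitmx. Proof. exact: (mulmx1_unit mul_M_zeta).1. Qed.

Lemma zero_below_two_var : zero_below ((2%:R * z)^-1)%R (-1).
Proof.
have -> : (2%:R * z)^-1 = cstL 2%:R^-1 * monoL 1 (-1) :> laurent C.
  by rewrite invfM varLV fmorphV rmorph_nat.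
exact: (zero_belowM (a := 0) (b := -1) _ (zero_below_cst _ _) (zero_below_mono _ _)).
Qed.

Lemma zero_below_half : zero_below (2%:R^-1 : laurent C)%R 0.
Proof.
by have -> : 2%:R^-1 = cstL 2%:R^-1 :> laurent C; [rewrite fmorphV rmorph_nat|apply: zero_below_cst].
Qed.

(** The determinant of [M_zeta] is - 2 z: conjugating by it may cost one order. *)
Lemma zero_below_M_zetaV : zero_below_mx (invmx M) (-1).
Proof.
rewrite (invmx_eq mul_M_zeta); apply: zero_below_mx2.
- exact: zero_belowW zero_below_half.
- exact: zero_below_two_var.
- exact: zero_belowW zero_below_half.
- exact/zero_belowN/zero_below_two_var.
Qed.

Lemma ps_var : is_power_series z. Proof. exact: zero_below_mono. Qed.

Lemma ps_M_zeta : is_power_series_mx M.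
Proof.
by apply: zero_below_mx2; [exact: zero_below1|exact: zero_below1|exact: ps_var|apply/zero_belowN/ps_var].
Qed.

Lemma ps_oppvar (f : laurent C) : is_power_series f -> is_power_series (oppvarL f).
Proof. by move=> fp k k0; rewrite oppvarLE fp // mulr0. Qed.

(* Pulling [ram_form] back along [x = z^2] and conjugating by [M_zeta] makes   *)
(* it diagonal.                                                               *)
Lemma ram_form_diagonal (al be : laurent C) :
  (2%:R * z) *: map_mx (@squareL C) (ram_form al be) *m M + map_mx (@derivL C) M =
  M *m diag2 (2%:R * z * (squareL al + z * squareL be)) (2%:R * z * (squareL al - z * squareL be)).
Proof.
have z0 := varL_neq0 C; have t0 := two_neq0.
have sqV : squareL ((2%:R * z)^-1) = (2%:R * z ^+ 2)^-1.
  by rewrite fmorphV rmorphM rmorph_nat /= squareL_var.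
have <- : mx2 (squareL al) (squareL be) (z ^+ 2 * squareL be) (squareL al - (2%:R * z ^+ 2)^-1) =
    map_mx (@squareL C) (ram_form al be).
  apply: mx2P; rewrite [RHS]map_mxE !mx2E.
  - by [].
  - by [].
  - by rewrite rmorphM /= squareL_var.
  - by rewrite rmorphB /= sqV.
have <- : mx2 0 0 1 (- 1) = map_mx (@derivL C) M.
  apply: mx2P; rewrite [RHS]map_mxE !mx2E.
  - by rewrite derivL1.
  - by rewrite derivL1.
  - by rewrite derivL_var.
  - by rewrite raddfN /= derivL_var.
exact: mx2_zeta_diagonal z0 t0.
Qed.

(** For x = z^2 one has x^(l-n) dx = 2 z^(2l-2n+1) dz, so the diagonal part of [ram_form] supplies
    the exponents of even index and z times the off-diagonal part those of odd index. The signs e =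
    1 and e = -1 are the two branches, and 2 cancels [half]. *)
Lemma tail_square (n : nat) (th : nat -> C) (e : C) : (0 < n)%N -> e ^+ 2 = 1 ->
  2%:R * z * (squareL (tailL n (fun l => Defs.half C * th l.*2))
    + cstL e * (z * squareL (tailL n (fun l => Defs.half C * th l.*2.+1)))) =
  tailL (2 * n - 1) (fun l => e ^+ l * th l).
Proof.
move=> n0 e2; have two : (2%:R : laurent C) = cstL 2%:R by rewrite rmorph_nat.
have half2 (x : C) : 2%:R * (Defs.half C * x) = x by rewrite mulrA divff ?mul1r // pnatr_eq0.
have eX l : e ^+ l = if odd l then e else 1.
  rewrite -{1}[l]odd_double_half exprD -mul2n exprM e2 expr1n mulr1.
  by case: (odd l).
apply: laurentP => k; rewrite two -mulrA coef_cstLM coef_varLM coefLD coef_cstLM coef_varLM.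
rewrite !squareLE !coef_tailL.
(* The parity of [k - 1] decides which of the two series contributes in degree [k]. *)
have [/dvdzP[j Ej]|k2] := boolP (2 %| k - 1)%Z.
  rewrite ifF; last by apply/negP; lia.
  rewrite mulr0 addr0 Ej mulzK //.
  case E : (j + n%:Z) => [l|l]; last first.
    have -> : k + (2 * n - 1)%N%:Z = Negz l.*2.+1 by lia.
    by rewrite mulr0.
  have -> : k + (2 * n - 1)%N%:Z = l.*2 by lia.
  by rewrite half2 eX odd_double mul1r.
rewrite add0r.
have [/dvdzP[j Ej]|k3] := boolP (2 %| k - 1 - 1)%Z; last by exfalso; lia.
rewrite Ej mulzK //; case E : (j + n%:Z) => [l|l]; last first.
  have -> : k + (2 * n - 1)%N%:Z = Negz l.*2 by lia.
  by rewrite !mulr0.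
have -> : k + (2 * n - 1)%N%:Z = l.*2.+1 by lia.
by rewrite eX /= odd_double /= mulrCA half2.
Qed.

End RamifiedFrame.

Lemma gauge_eqE (K : fieldType) (Y A B : 'M[laurent K]_2) : Y \in unitmx -> gauge Y A = B ->
  A = (Y *m B - map_mx (@derivL K) Y) *m invmx Y.
Proof.
move=> uY <-; rewrite /gauge mulmxDr mulmxA mulmxV // mul1mx addrC addKr.
by rewrite !mulmxA mulmxV // mul1mx mulmxK.
Qed.

Lemma square_cst_mx (R : realType) (A : 'M[CC R]_2) :
  map_mx (@squareL (CC R)) (cst_mx A) = cst_mx A.
Proof. by apply/matrixP => a b; rewrite !mxE squareL_cst. Qed.

Lemma conj_mulmx_eq (K : fieldType) (P B X y D : 'M[K]_2) : P \in unitmx ->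
  P *m X *m B *m y = P *m D *m B -> invmx B *m X *m B *m y = invmx B *m D *m B.
Proof.
by move=> uP; rewrite -!mulmxA => /(can_inj (mulKmx uP)) ->.
Qed.

(** A right factor [B] killed by the derivation only conjugates the exponents. *)
Lemma dlog_mulr (K : fieldType) (V DV B l : 'M[laurent K]_2) : V \in unitmx -> B \in unitmx ->
  dlog (V *m B) (DV *m B) l = (DV - V *m (B *m l *m invmx B)) *m invmx V.
Proof.
move=> uV uB; rewrite /dlog; have -> : invmx (V *m B) = invmx B *m invmx V.
  by apply: invmx_eq; rewrite -mulmxA (mulmxA B) mulmxV // mul1mx mulmxV.
by rewrite !mulmxBl !mulmxA mulmxK.
Qed.

Lemma mulmx_cancel (K : fieldType) (A B D : 'M[K]_2) : B \in unitmx ->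
  A *m B *m (invmx B *m D) = A *m D.
Proof. by move=> uB; rewrite mulmxA mulmxK. Qed.

(** The coefficient 1/4: the 2 comes from [residue_formE], and [a] and [b] are the equal
    contributions of the two branches. *)
Lemma quarter_twice (K : numFieldType) (a b T : K) :
  a = T -> b = T -> 4%:R^-1 * (2%:R * (a + b)) = T.
Proof. by move=> -> ->; field. Qed.

Section Ramified.
Local Open Scope classical_set_scope.
Variables (R : realType) (S : setting R) (N : phase S -> normal_form S) (F : formal_solutions S).
Hypothesis solF : are_formal_solutions N F.
Local Notation C := (CC R).
Local Notation U := (@phase_set R S).
Local Notation z := (varL C).
Local Notation family := (holomorphic_family U).
Local Notation family_mx := (@family_mx R S U).
Local Notation "A ^z" := (map_mx (@derivL C) A) (at level 2, format "A ^z").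
Local Notation sq := (map_mx (@squareL C)).
Local Notation M := (M_zeta R).
Let oU : open U := @open_phase_set R S.
Variable i : option 'I_(nu S).
Hypothesis ram_i : is_ram (typ i).
Let n : nat := pole i.

Let sol m (Um : U m) : ramified_solution N F i m := fs_ram solF Um ram_i.

Let n_gt1 : (1 < n)%N.
Proof. by have := poleP i; case: (typ i) ram_i. Qed.

Let thr_hol l : holomorphic_on U (thr F i l).
Proof. exact: (fs_thr solF l ram_i). Qed.

Let V := framed F i.
Let al m := tailL n (fun l => Defs.half C * thr F i l.*2 m).
Let be m := tailL n (fun l => Defs.half C * thr F i l.*2.+1 m).
Let Rm m := ram_form (al m) (be m).
Let Omx := Omega_unr N i.
Let Om := Omega_ram N i.
(** Kept apart from [M_zeta], because [Vs] has a power series inverse while [Y] does not. *)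
Let Vs m := cst_mx (Phi F i (proj m)) *m sq (Xi F i m).
Let Y := framed_ram F i.
Let L s := dlambda_ram F i s.

Let sqXi_family : family_mx (fun m => sq (Xi F i m)).
Proof. by apply: family_mx_square => //; apply: family_Xi solF i. Qed.

Let sqXi_ps m : U m -> is_power_series_mx (sq (Xi F i m)).
Proof.
move=> Um a b; rewrite map_mxE.
by have := zero_below_square (Xi_ps solF i Um a b); rewrite mul0r.
Qed.

Let sqXi0 m : U m -> Defs.coefM (sq (Xi F i m)) 0 = 1%:M.
Proof.
move=> Um; rewrite -(Xi_coef0 solF i Um); apply/matrixP => a b; rewrite !mxE.
by rewrite squareLE.
Qed.

Let hV : family_mx V. Proof. exact: (family_framed solF i (family_Xi solF i)). Qed.
Let hVV : family_mx (fun m => invmx (V m)).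
Proof. exact: (family_framedV solF i (family_Xi solF i) (Xi_ps solF i) (Xi_coef0 solF i)). Qed.
Let Vu m (Um : U m) := framed_unit solF i (Xi_ps solF i) (Xi_coef0 solF i) Um.
Let Vp m (Um : U m) : is_power_series_mx (V m) := framed_ps F i (Xi_ps solF i) Um.

Let hVs : family_mx Vs. Proof. exact: (family_framed solF i sqXi_family). Qed.
Let hVsV : family_mx (fun m => invmx (Vs m)).
Proof. exact: (family_framedV solF i sqXi_family sqXi_ps sqXi0). Qed.
Let Vsu m (Um : U m) := framed_unit solF i sqXi_ps sqXi0 Um.
Let Vsp m (Um : U m) : is_power_series_mx (Vs m) := framed_ps F i sqXi_ps Um.

Let YE m : Y m = Vs m *m M. Proof. by []. Qed.

Let YVE m : U m -> invmx (Y m) = invmx M *m invmx (Vs m).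
Proof.
move=> Um; apply: invmx_eq; rewrite YE -mulmxA (mulmxA M) mulmxV ?M_zeta_unit // mul1mx.
by rewrite mulmxV //; case: (Vsu Um).
Qed.

Let uY m : U m -> Y m \in unitmx.
Proof. by move=> Um; rewrite YE unitmx_mul M_zeta_unit; case: (Vsu Um) => ->. Qed.

Let hY : family_mx Y.
Proof. by apply: (family_mxM oU hVs); apply: family_mx_const. Qed.

Let hYV : family_mx (fun m => invmx (Y m)).
Proof.
apply: (family_mx_eq oU (A := fun m => invmx M *m invmx (Vs m))) => [m Um|].
  by rewrite (YVE Um).
by apply: (family_mxM oU _ hVsV); apply: family_mx_const.
Qed.

Let sign s l : C := (-1) ^+ (~~ s * l).

Let hthr s l : holomorphic_on U (fun m => sign s l * thr F i l m).
Proof. by apply: (holomorphicM oU _ (thr_hol l)); apply: holomorphic_cst. Qed.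

Let hL s : family (L s).
Proof. exact: (family_tail oU (2 * n - 1) (hthr s)). Qed.

Let OmxE m : U m -> Omx m = (V m *m Rm m - (V m)^z) *m invmx (V m).
Proof.
by move=> Um; have [uV _] := Vu Um; apply: gauge_eqE uV (ram_gauge (sol Um)).
Qed.

Let OmE m : Om m = (2%:R * z) *: sq (Omx m).
Proof. exact: Omega_square. Qed.

Let hRm : family_mx Rm.
Proof.
have hh k : holomorphic_on U (fun m => Defs.half C * thr F i k m).
  by apply: (holomorphicM oU _ (thr_hol k)); apply: holomorphic_cst.
have ha : family al by apply: (family_tail oU n (th := fun l m => Defs.half C * thr F i l.*2 m)).
have hb : family be by apply: (family_tail oU n (th := fun l m => Defs.half C * thr F i l.*2.+1 m)).
apply: (family_mx2 oU ha hb).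
  by apply: (familyM oU _ hb); apply: family_const.
by apply: (familyB oU ha); apply: family_const.
Qed.

Let hOmx : family_mx Omx.
Proof.
have H := family_mxM oU (family_mxB oU (family_mxM oU hV hRm) (family_mx_deriv oU hV)) hVV.
by apply: (family_mx_eq oU _ H) => m Um; rewrite (OmxE Um).
Qed.

Let hOm : family_mx Om.
Proof.
have H := family_mx_square oU hOmx.
move=> a b; apply: (family_eq oU _ (familyM oU (family_const U (2%:R * z)) (H a b))) => m Um.
by rewrite OmE scalemxE.
Qed.

Let LE m : diag2 (2%:R * z * (squareL (al m) + z * squareL (be m)))
    (2%:R * z * (squareL (al m) - z * squareL (be m))) = diag2 (L true m) (L false m).
Proof.
have n0 : (0 < n)%N := ltnW n_gt1.
congr diag2.
  have := tail_square (thr F i ^~ m) n0 (expr1n _ 2); rewrite rmorph1 mul1r => ->.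
  by rewrite /L /dlambda_ram; congr tailL; apply/funext => l; rewrite mul0n expr0 expr1n.
have := tail_square (thr F i ^~ m) n0 (sqrr_sign C 1); rewrite rmorphN1 mulN1r => ->.
by rewrite /L /dlambda_ram; congr tailL; apply/funext => l; rewrite mul1n expr1.
Qed.

(** [V] brings the connection to [ram_form] in the coordinate x; after the pull-back, [M_zeta]
    diagonalizes it. *)
Let eqY m : U m -> connection_eq (Y m) (diag2 (L true m) (L false m)) (Om m).
Proof.
move=> Um; have [uV _] := Vu Um.
have VsE : Vs m = sq (V m).
  by rewrite /V /framed map_mxM square_cst_mx.
have VsD : (Vs m)^z = (2%:R * z) *: sq (V m)^z.
  by rewrite VsE; apply/matrixP => a b; rewrite scalemxE !map_mxE derivL_square.
have OV : Om m *m Vs m = (2%:R * z) *: (Vs m *m sq (Rm m)) - (Vs m)^z.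
  have E : Omx m *m V m = V m *m Rm m - (V m)^z by rewrite (OmxE Um) mulmxKV.
  rewrite OmE VsD VsE -scalemxAl -scalerBr; congr (_ *: _).
  by rewrite -!map_mxM -map_mxB E.
have D := ram_form_diagonal (al m) (be m).
rewrite /connection_eq -LE YE derivmxM (mulmxA (Om m)) OV -(mulmxA (Vs m) M) -D.
rewrite mulmxDr scalemxAr mulmxBl mulmxA.
move: ((Vs m)^z *m M) (Vs m *m M^z) (Vs m *m _ *m M) => x y w.
by rewrite opprD [X in X + _]addrACA subrr addr0 -(opprB x w) subrr.
Qed.

Let resL0 s m v : U m -> resL (dcoef v (L s) m) = 0.
Proof.
move=> Um; rewrite (dcoef_tail oU (2 * n - 1) v (hthr s) Um) /resL coef_tailL.
have -> : -1 + (2 * n - 1)%N%:Z = (2 * n.-1)%N by lia.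
rewrite -[LHS]/('D_v (fun x => sign s (2 * n.-1)%N * thr F i (2 * n.-1)%N x) m).
apply: (derive_eq_cst oU (a := sign s (2 * n.-1)%N * th_res_ram S i) _ Um) => x Ux.
rewrite (ram_th (sol Ux)); last by rewrite -/n; lia.
(* The index 2(n - 1) is even with half n - 1, which is no coordinate index, so the default
   [th_res_ram] is returned. *)
by rewrite /th_ram /th_coord insubF // mul2n doubleK -/n ltnn.
Qed.

Let form := residue_form (fun=> 0) Y Om (L true) (L false).

Let hc : holomorphic_on U (fun=> 0 : C) := holomorphic_cst U 0.

Lemma ram_linear m a v w u : U m -> form m (a *: v + w) u = a * form m v u + form m w u.
Proof. exact: (residue_form_linear oU hc hY (hL true) (hL false) hOm). Qed.

Lemma ram_holomorphic v w : holomorphic_on U (fun m => form m v w).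
Proof. exact: (holomorphic_residue_form oU hc hY hYV (hL true) (hL false) hOm). Qed.

Let OmxN m : U m -> zero_below_mx (Omx m) (- n%:Z).
Proof.
move=> Um; rewrite (OmxE Um); have [_ VVp] := Vu Um.
apply: (zero_below_mxM (b := 0) _ _ VVp); first by rewrite addr0.
apply: zero_below_mxD; last first.
  by apply/zero_below_mxN/(zero_belowW_mx _ (ps_mx_deriv (Vp Um))); lia.
apply: (zero_below_mxM (a := 0) _ (Vp Um)); first by rewrite add0r.
have tN th : zero_below (tailL n th : laurent C) (- n%:Z) by apply: zero_below_tail.
apply: zero_below_mx2; [exact: tN|exact: tN| |].
  by apply: (zero_belowM (a := 0) _ (@ps_var R) (tN _)); rewrite add0r.
by apply: (zero_belowB (tN _)); apply: zero_belowW (@zero_below_two_var R); lia.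
Qed.

Let OmN m : U m -> zero_below_mx (Om m) (- (2 * n - 1)%N%:Z).
Proof.
move=> Um a b; rewrite OmE scalemxE map_mxE -mulrA.
have H := zero_below_square (OmxN Um a b).
apply: (zero_belowM (a := 0) (b := 1 - 2 * n%:Z)); first by lia.
  by rewrite -(rmorph_nat (@cstL C)); apply: zero_below_cst.
by apply: (zero_belowM (a := 1) _ _ H); [lia|apply: zero_below_mono].
Qed.

Section Vertical.
Variables (m v1 v2 : phase S).
Hypotheses (Um : U m) (v0 : proj v1 = 0).
Local Notation c := (fun=> 0 : C).

Let c0 v : 'D_v c m = 0. Proof. exact: derive_cst. Qed.

Let Dth0 s l : (l < 2 * n - 1)%N -> 'D_v1 (fun x => sign s l * thr F i l x) m = 0.
Proof.
move=> ln; rewrite -[RHS](derive_vertical (fun b => sign s l * th_ram b i l) m v0).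
by apply: (derive_eq oU _ Um) => x Ux; rewrite (ram_th (sol Ux)).
Qed.

Let DLE s v :
  dcoef v (L s) m = tailL (2 * n - 1) (fun l => 'D_v (fun x => sign s l * thr F i l x) m).
Proof. exact: (dcoef_tail oU (2 * n - 1) v (hthr s) Um). Qed.

Let lE s v : vary_prim c v (L s) m = primL (dcoef v (L s) m).
Proof. by rewrite vary_primE c0 rmorph0 mul0r subr0. Qed.

Let VsVp : is_power_series_mx (invmx (Vs m)).
Proof. by have [] := Vsu Um. Qed.

Let DYE v : vary_mx c v Y m = vary_mx c v Vs m *m M.
Proof.
rewrite (vary_mxM oU c v hVs (family_mx_const U M) Um) (vary_mx_fixed M (c0 v)).
by rewrite mulmx0 addr0.
Qed.

Let logp : is_power_series_mx (log_variation c Y (L true) (L false) v1 m).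
Proof.
(* Order 1 and not just 0: a primitive without constant term gains a degree, which the conjugation
   by [M_zeta] then uses up. *)
have lp s : zero_below (vary_prim c v1 (L s) m) 1.
  by rewrite lE DLE; apply: (zero_below_prim (ps_tail (Dth0 s))).
rewrite /log_variation; set l := diag2 _ _.
have l1 : zero_below_mx l 1 by apply: zero_below_diag2; apply: lp.
have MlM : is_power_series_mx (M *m l *m invmx M).
  apply: (zero_below_mxM (a := 1) (b := -1) _ _ (@zero_below_M_zetaV R)); first by [].
  exact: (zero_below_mxM (a := 0) (b := 1) _ (@ps_M_zeta R) l1).
have [uVs _] := Vsu Um.
rewrite DYE YE (dlog_mulr _ _ uVs (@M_zeta_unit R)).
apply: (zero_below_mxM (a := 0) (b := 0) _ _ VsVp); first by rewrite addr0.
apply: zero_below_mxD; first exact: (ps_vary_mx oU c v1 Um Vsp).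
exact/zero_below_mxN/(zero_below_mxM (a := 0) (b := 0) _ (Vsp Um) MlM).
Qed.

Let Om01 x : Om x 0 1 = 2%:R * z * squareL (upper_entry i (proj x)).
Proof. by have [_ E] := Omega_row0 x (N x) i; rewrite OmE scalemxE map_mxE [Omx x 0 1]E. Qed.

Let Om00 x : Om x 0 0 = 0.
Proof.
have [E _] := Omega_row0 x (N x) i.
by rewrite OmE scalemxE map_mxE [Omx x 0 0]E rmorph0 mulr0.
Qed.

Let DOmp : is_power_series_mx (vary_mx c v1 Om m).
Proof.
have E := variation_dlog oU c hY (hL true) (hL false) hOm uY eqY (resL0 true) (resL0 false) v1 Um.
apply: (variation_power_series (e := (2 * n - 1)%N%:Z) E logp).
- exact: Om00.
- rewrite vary_mxE (vary_eq oU (g := fun=> 0) c v1 Um) => [|x _]; last exact: Om00.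
  exact: (vary_vertical (fun=> 0) v0 (c0 v1)).
- rewrite vary_mxE.
  rewrite (vary_eq oU (g := fun x => 2%:R * z * squareL (upper_entry i (proj x))) c v1 Um).
    exact: (vary_vertical (fun b => 2%:R * z * squareL (upper_entry i b)) v0 (c0 v1)).
  by move=> x _; apply: Om01.
- rewrite Om01; apply: mulf_neq0; first exact: (mulf_neq0 (@two_neq0 R) (varL_neq0 C)).
  by rewrite fmorph_eq0 upper_entry_neq0.
- rewrite Om01 invfM -fmorphV.
  have H := zero_below_square (@zero_below_upper_entryV _ _ i (proj m)).
  by apply: (zero_belowM _ (@zero_below_two_var R) H); rewrite -/n; lia.
- exact: OmN.
Qed.

(** Each entry is 2 z times a series in z^2, so it has no constant term. The order gained here
    compensates the pole of [invmx M] inside Y^-1 v1(Om) Y. *)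
Let DOm1 : zero_below_mx (vary_mx c v1 Om m) 1.
Proof.
move=> a b k k1; have [k0|k0] := ltrP k 0; first exact: DOmp.
have -> : k = 0 by lia.
rewrite vary_mxE (vary_eq oU (g := fun x => 2%:R * z * squareL (Omx x a b)) c v1 Um); last first.
  by move=> x _; rewrite OmE scalemxE map_mxE.
rewrite (varyM oU c v1 (family_const U (2%:R * z)) (family_square oU (hOmx a b)) Um).
rewrite vary_const (c0 v1) rmorph0 mul0r oppr0 mul0r add0r (vary_square oU v1 (hOmx a b) Um).
by rewrite -mulrA -(rmorph_nat (@cstL C)) coef_cstLM square_parity mulr0.
Qed.

(** Since Y = Phi M_zeta Kf, this matrix takes the place that [Xi] has at an unramified point; its
    diagonal is 1 by [ram_normalized]. *)
Let Kf x := invmx M *m sq (Xi F i x) *m M.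

Let KE x : U x -> exists2 xi : laurent C, is_power_series xi &
  Kf x = mx2 1 (z * xi) (- (z * oppvarL xi)) 1.
Proof. by move=> Ux; apply: ram_normalized (sol Ux). Qed.

Let zxi1 (xi : laurent C) : is_power_series xi -> zero_below (z * xi) 1.
Proof. exact: (zero_belowM (a := 1) (b := 0) _ (zero_below_mono _ _)). Qed.

Let K_off x a b : U x -> a != b -> zero_below (Kf x a b) 1.
Proof.
move=> Ux; have [xi xip ->] := KE Ux; move: a b.
do 2![apply: ord2P] => // _; rewrite mx2E; first exact: zxi1.
exact/zero_belowN/zxi1/ps_oppvar.
Qed.

Let K_diag x a : U x -> Kf x a a = 1.
Proof.
by move=> Ux; have [xi _ ->] := KE Ux; move: a; apply: ord2P; rewrite mx2E.
Qed.

Let Kp x : U x -> is_power_series_mx (Kf x).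
Proof.
move=> Ux a b; have [->|ab] := eqVneq a b; last exact: zero_belowW (K_off Ux ab).
by rewrite K_diag //; apply: zero_below1.
Qed.

Let K0 : Defs.coefM (Kf m) 0 = 1%:M.
Proof.
apply/matrixP => a b; rewrite /Defs.coefM map_mxE [RHS]mxE; have [->|ab] := eqVneq a b.
  by rewrite (K_diag b Um) coefL1.
by rewrite (K_off Um ab).
Qed.

Let y := invmx (Y m) *m vary_mx c v1 Y m.
Let DK := vary_mx c v1 Kf m.

Let DKE : DK = invmx M *m vary_mx c v1 (fun x => sq (Xi F i x)) m *m M.
Proof.
rewrite /DK (vary_mxM oU c v1 (family_mxM oU (family_mx_const U (invmx M)) sqXi_family)
  (family_mx_const U M) Um).
rewrite (vary_mxM oU c v1 (family_mx_const U (invmx M)) sqXi_family Um).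
by rewrite !(vary_mx_fixed _ (c0 v1)) mul0mx add0r mulmx0 addr0.
Qed.

Let Ky : Kf m *m y = DK.
Proof.
have E : vary_mx c v1 Vs m = cst_mx (Phi F i (proj m)) *m vary_mx c v1 (fun x => sq (Xi F i x)) m.
  exact: (vary_framed_vertical solF i sqXi_family Um v0 (c0 v1)).
have uP : cst_mx (Phi F i (proj m)) \in unitmx by rewrite map_unitmx (Phi_unit solF).
have EYy : Y m *m y = vary_mx c v1 Y m := mulKVmx (uY Um) _.
rewrite DKE; apply: (conj_mulmx_eq uP).
by rewrite -E -DYE -EYy.
Qed.

Let DKd a : DK a a = 0.
Proof.
rewrite /DK vary_mxE (vary_eq oU (g := fun=> 1) c v1 Um) => [|x Ux]; last exact: K_diag.
by rewrite vary_const derivL1 mulr0 oppr0.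
Qed.

Let yp : is_power_series_mx y.
Proof.
have [uK KVp] : Kf m \in unitmx /\ is_power_series_mx (invmx (Kf m)).
  by apply: ps_invmx; [exact: Kp|rewrite K0 unitmx1].
have -> : y = invmx (Kf m) *m DK by rewrite -Ky mulKmx.
exact: (zero_below_mxM (a := 0) (b := 0) _ KVp (ps_vary_mx oU c v1 Um Kp)).
Qed.

Let y00 : y 0 0 = - (Kf m 0 1 * y 1 0).
Proof.
apply/eqP; rewrite -addr_eq0; apply/eqP.
by rewrite -[RHS](DKd 0) -Ky (mulmx2E (Kf m) y) (K_diag 0 Um) mul1r.
Qed.

Let y11 : y 1 1 = - (Kf m 1 0 * y 0 1).
Proof.
apply/eqP; rewrite -addr_eq0 addrC; apply/eqP.
by rewrite -[RHS](DKd 1) -Ky (mulmx2E (Kf m) y) (K_diag 1 Um) mul1r.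
Qed.

Let th1 : thr F i 1 m != 0.
Proof.
rewrite (ram_th (sol Um)); last by rewrite -/n; lia.
by have [[_ _ H] _ _] := Um; apply: H.
Qed.

(** The exponents of even index are common to the two branches, so theta_0 drops out of the
    difference and its leading term comes from theta_1. *)
Let L_low (k : int) : k <= - (2 * n - 2)%N%:Z ->
  (L true m - L false m) k = if k == - (2 * n - 2)%N%:Z then 2%:R * thr F i 1 m else 0.
Proof.
move=> kn; rewrite coefLB !coef_tailL; have [->|k1] := eqVneq k (- (2 * n - 2)%N%:Z).
  have -> : - (2 * n - 2)%N%:Z + (2 * n - 1)%N%:Z = 1%N by lia.
  by rewrite mul0n mul1n expr0 expr1 mul1r mulN1r opprK mulr_natl mulr2n.
case E : (k + (2 * n - 1)%N%:Z) => [l|l]; last by rewrite subrr.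
by have -> : l = 0%N by [lia]; rewrite !muln0 !expr0 subrr.
Qed.

(** The pole order on the double cover is 2n - 1, hence the indices 4(n - 1) - l and the
    denominators 2(n - 1) - l. The centre does not move, so there is no second sum as in
    [unr_vertical]. *)
Lemma ram_vertical :
  4%:R^-1 * form m v1 v2 =
  \sum_(l < 2 * n - 2) 'D_v1 (thr F i (4 * n.-1 - l)%N) m / (2 * n.-1 - l)%:R * 'D_v2 (thr F i l) m.
Proof.
rewrite /form (residue_formE oU c hY (hL true) (hL false) hOm uY eqY (resL0 true) (resL0 false)) //.
have V1 := variation_family oU c hY (hL true) (hL false) hOm eqY v1 Um.
have LNn : zero_below (L true m - L false m) (- (2 * n - 2)%N%:Z).
  by move=> k kn; rewrite L_low ?(ltW kn) // lt_eqF.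
have Ln : (L true m - L false m) (- (2 * n - 2)%N%:Z) != 0.
  by rewrite L_low // eqxx mulf_neq0 ?th1 // pnatr_eq0.
have [LV _] := zero_belowV LNn Ln; rewrite opprK in LV.
have L0 : L true m - L false m != 0 by apply: contraNneq Ln => ->.
have ln s : zero_below (vary_prim c v2 (L s) m) (- (2 * n - 2)%N%:Z).
  rewrite lE DLE; apply: zero_belowW (zero_below_prim (zero_below_tail _ (lexx _))); lia.
have Wp : is_power_series_mx (invmx (Y m) *m vary_mx c v1 Om m *m Y m).
  have Yp : is_power_series_mx (Y m).
    exact: (zero_below_mxM (a := 0) (b := 0) _ (Vsp Um) (@ps_M_zeta R)).
  apply: (zero_below_mxM (a := 0) (b := 0) _ _ Yp); first by rewrite addr0.
  apply: (zero_below_mxM (a := -1) (b := 1) _ _ DOm1); first by [].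
  rewrite (YVE Um).
  exact: (zero_below_mxM (a := -1) (b := 0) _ (@zero_below_M_zetaV R) VsVp).
(* [M_zeta] does not vary and cancels between the two factors, so no order is lost here. *)
have D2p : is_power_series_mx (vary_mx c v2 Y m *m invmx (Y m)).
  rewrite DYE (YVE Um) (mulmx_cancel _ _ (@M_zeta_unit R)).
  exact: (zero_below_mxM (a := 0) (b := 0) _ (ps_vary_mx oU c v2 Um Vsp) VsVp).
have H := residue_vertical (uY Um) (eqY Um) V1 L0 LV yp y00 y11 (K_off Um (isT : 0 != 1 :> 'I_2))
  (K_off Um (isT : 1 != 0 :> 'I_2)) Wp DOmp D2p (ln true) (ln false).
rewrite [X in _ * (_ * X)]H.
have E s : - resL (vary c v1 (L s) m * vary_prim c v2 (L s) m) =
    \sum_(l < 2 * n - 2) 'D_v1 (thr F i (4 * n.-1 - l)%N) m / (2 * n.-1 - l)%:R * 'D_v2 (thr F i l) m.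
  rewrite (vary_fixed _ (c0 v1)) lE !DLE.
  have n21 : (0 < 2 * n - 1)%N by lia.
  have := res_tail_prim (fun l => 'D_v2 (fun x => sign s l * thr F i l x) m) (fun=> 0) 0 n21 (Dth0 s).
  rewrite rmorph0 mul0r subr0 => ->.
  rewrite [X in _ + X]big1 ?addr0 => [|l _]; last by rewrite mulr0.
  have -> : (2 * n - 1).-1 = (2 * n - 2)%N by lia.
  apply: eq_bigr => l _; have ll := ltn_ord l.
  have -> : (2 * (2 * n - 1) - l - 2)%N = (4 * n.-1 - l)%N by lia.
  have -> : (2 * n - 1 - l - 1)%N = (2 * n.-1 - l)%N by lia.
  have D v k : 'D_v (fun x => sign s k * thr F i k x) m = sign s k * 'D_v (thr F i k) m.
    have := deriveM (derivable_cst (sign s k) m v) (holomorphic_derivable (v := v) (thr_hol k) Um).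
    by rewrite derive_cst scaler0 addr0.
  (* The two indices have the same parity, so the branch signs cancel and both branches give the
     same sum. *)
  rewrite !D; have s1 : sign s (4 * n.-1 - l)%N * sign s l = 1.
    rewrite /sign -exprD -mulnDr subnK; last by lia.
    by rewrite -signr_odd oddM oddM andbF.
  have G (a b d e f : C) : a * b = 1 -> a * d / e * (b * f) = d / e * f.
    by move=> ab; rewrite -[RHS]mul1r -ab; ring.
  exact: G.
exact: quarter_twice (E true) (E false).
Qed.

End Vertical.
End Ramified.

(** * Apparent singularities *)

(** The factor [D] of the solution is read as exp(- Lambda) with Lambda' = L. For [D] = diag(1, z)
    this brings the apparent singularities into the common scheme. *)
Lemma connection_eq_mulr (K : fieldType) (Y D L Om : 'M[laurent K]_2) : D \in unitmx ->
  map_mx (@derivL K) D = - (L *m D) ->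
  map_mx (@derivL K) (Y *m D) + Om *m (Y *m D) = 0 -> connection_eq Y L Om.
Proof.
move=> uD DD; rewrite derivmxM DD mulmxN !mulmxA -mulmxBl -mulmxDl => E.
by rewrite /connection_eq -[LHS](mulmxK uD) E mul0mx.
Qed.

Lemma dlog_diag (K : fieldType) (Y DY D l : 'M[laurent K]_2) : Y \in unitmx -> D \in unitmx ->
  (DY *m D - Y *m (l *m D)) *m invmx (Y *m D) = dlog Y DY l.
Proof.
move=> uY uD; have -> : invmx (Y *m D) = invmx D *m invmx Y.
  by apply: invmx_eq; rewrite -mulmxA (mulmxA D) mulmxV // mul1mx mulmxV.
by rewrite mulmxA -mulmxBl (mulmx_cancel _ _ uD).
Qed.

(** Left multiplication by the unipotent factor fixes the strictly lower triangular matrix with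
    entry [dp], so this factor can be cancelled throughout. *)
Lemma unipotent_frame (K : comUnitRingType) (p dp : K) (X y DX : 'M[K]_2) :
  mx2 1 0 p 1 *m X *m y = mx2 0 0 dp 0 *m X + mx2 1 0 p 1 *m DX ->
  X *m y = mx2 0 0 dp 0 *m X + DX.
Proof.
set A := mx2 1 0 p 1 => E.
have A1 : mx2 1 0 (- p) 1 *m A = 1%:M.
  by apply: mx2P; rewrite mulmx2E !mx2E mxE /=; ring.
have [_ uA] := mulmx1_unit A1.
apply: (can_inj (mulKmx uA)); rewrite mulmxDr !mulmxA E; congr (_ *m X + _).
by apply: mx2P; rewrite mulmx2E !mx2E; ring.
Qed.

(* The two entries of the second column of [psi' + Om psi = 0], with          *)
(* [psi = (1 0; p 1) Xi diag(1, z)], read in degree 1. *)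
Lemma apparent_solution_coef (K : numFieldType) (p g0 t0 : K) (g r t X01 X11 : laurent K)
    (z := varL K) (u := X01 * z) (v := (cstL p * X01 + X11) * z) :
  has_value X01 0 -> has_value X11 1 -> has_value g g0 -> is_power_series r ->
  has_value t t0 ->
  derivL u + g * v = 0 ->
  derivL v + ((cstL p * z^-1 + r) * u + (- z^-1 + t) * v) = 0 ->
  X11 1 = p * g0 - t0.
Proof.
move=> [X01p X010] [X11p X110] [gp g00] rp [tp t00] E1 E2.
have z0 := varL_neq0 K.
have zp : is_power_series z by apply: zero_below_mono.
have zM f : is_power_series f -> is_power_series (f * z).
  by move=> fp; apply: (zero_belowM (a := 0) (b := 0)).
have wp : is_power_series (cstL p * X01 + X11).
  apply: zero_belowD => //.
  exact: (zero_belowM (a := 0) (b := 0) _ (zero_below_cst _ _) X01p).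
have up : is_power_series u by apply: zM.
have vp : is_power_series v by apply: zM.
have uE k : u k = X01 (k - 1) by rewrite /u mulrC coef_varLM.
have vE k : v k = p * X01 (k - 1) + X11 (k - 1).
  by rewrite /v mulrC coef_varLM coefLD coef_cstLM.
have u0 : u 0 = 0 by rewrite uE X01p.
have u1 : u 1 = 0 by rewrite uE subrr X010.
have v0 : v 0 = 0 by rewrite vE X01p // X11p // mulr0 addr0.
have v1 : v 1 = 1 by rewrite vE subrr X010 X110 mulr0 add0r.
have u2 : u 2 = X01 1 by rewrite uE.
have v2 : v 2 = p * X01 1 + X11 1 by rewrite vE.
have d2 (f : laurent K) : derivL f 1 = 2%:R * f 2.
  by rewrite derivLE -[_ *~ _]/(f 2 *+ 2) mulr_natl.
have C1 : 2%:R * X01 1 + g0 = 0.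
  have := congr1 (fun f : laurent K => f 1) E1; rewrite coefLD coefL0 d2 u2.
  by rewrite (coefLM1 gp vp) v0 v1 mulr0 addr0 mulr1 g00.
have C2 : 2%:R * (p * X01 1 + X11 1) + (p * X01 1 - (p * X01 1 + X11 1) + t0) = 0.
  have E : (cstL p * z^-1 + r) * u + (- z^-1 + t) * v =
      cstL p * X01 + r * u - (z^-1 * v) + t * v.
    by rewrite /u; field.
  have := congr1 (fun f : laurent K => f 1) E2; rewrite E coefLD d2 v2 coefL0.
  rewrite !coefLD coefLN coef_cstLM varLV coef_monoLM mul1r v2.
  by rewrite (coefLM1 rp up) (coefLM1 tp vp) u0 u1 v0 v1 !mulr0 !addr0 mulr1 t00.
(* [C1] then eliminates [X01 1]. *)
have C3 : X11 1 = - t0 - p * (2%:R * X01 1).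
  by apply/eqP; rewrite -subr_eq0; apply/eqP; rewrite -[RHS]C2; ring.
have -> : X11 1 = - t0 - p * (2%:R * X01 1 + g0) + p * g0 by rewrite C3; ring.
by rewrite C1 mulr0 subr0 addrC.
Qed.

Section Apparent.
Local Open Scope classical_set_scope.
Variables (R : realType) (S : setting R) (N : phase S -> normal_form S) (F : formal_solutions S).
Hypothesis solF : are_formal_solutions N F.
Local Notation C := (CC R).
Local Notation U := (@phase_set R S).
Local Notation z := (varL C).
Local Notation cst := (@cstL C).
Local Notation family := (holomorphic_family U).
Local Notation family_mx := (@family_mx R S U).
Local Notation "A ^z" := (map_mx (@derivL C) A) (at level 2, format "A ^z").
Let oU : open U := @open_phase_set R S.
Variable j : 'I_(n_app S).

Let sol m (Um : U m) : apparent_solution N F j m := fs_app solF j Um.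

Let A m : 'M[laurent C]_2 := mx2 1 0 (cst (p_of m j)) 1.
Let Xi := Xiq F j.
Let Y m := A m *m Xi m.
Let D : 'M[laurent C]_2 := diag2 1 z.
Let L1 : phase S -> laurent C := fun=> 0.
Let L2 : phase S -> laurent C := fun=> monoL (-1) (-1).
Let Om := Omega_q N j.
Local Notation c := (fun x : phase S => q_of x j).

Let Xip m : U m -> is_power_series_mx (Xi m). Proof. by move=> Um; apply: app_Xi (sol Um). Qed.
Let Xi0 m : U m -> Defs.coefM (Xi m) 0 = 1%:M. Proof. by move=> Um; apply: app_Xi0 (sol Um). Qed.

Let Xi0E m a b : U m -> Xi m a b 0 = (a == b)%:R.
Proof. by move=> /Xi0/matrixP/(_ a b); rewrite !mxE. Qed.

Let hc : holomorphic_on U c := holomorphic_q U j.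
Let hp : holomorphic_on U (fun m => p_of m j) := holomorphic_p U j.

Let hA : family_mx A.
Proof.
exact: (family_mx2 oU (family_const U 1) (family_const U 0) (family_cst oU hp) (family_const U 1)).
Qed.

Let hXi : family_mx Xi.
Proof.
move=> a b; split; first by exists 0 => m Um; apply: Xip.
by move=> k; exact: (fs_Xiq solF j a b k).
Qed.

Let Ap m : is_power_series_mx (A m).
Proof.
by apply: zero_below_mx2; [exact: zero_below1|exact: zero_below0|exact: zero_below_cst|exact: zero_below1].
Qed.

Let Yp m : U m -> is_power_series_mx (Y m).
Proof. by move=> Um; apply: (zero_below_mxM (a := 0) (b := 0) _ (Ap m) (Xip Um)). Qed.

Let Y0 m : U m -> Defs.coefM (Y m) 0 \in unitmx.
Proof.
move=> Um; rewrite (coefMM (Ap m) (Xip Um)) (Xi0 Um) mulmx1 unitmxE unitfE det_mx2.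
rewrite /Defs.coefM !map_mxE !mx2E.
by rewrite coefL1 coefL0 mul0r subr0 mulr1 oner_neq0.
Qed.

Let Yu m : U m -> Y m \in unitmx /\ is_power_series_mx (invmx (Y m)).
Proof. by move=> Um; apply: ps_invmx; [apply: Yp|apply: Y0]. Qed.

Let uY m : U m -> Y m \in unitmx. Proof. by case/Yu. Qed.
Let YVp m : U m -> is_power_series_mx (invmx (Y m)). Proof. by case/Yu. Qed.

Let hY : family_mx Y. Proof. exact: (family_mxM oU hA hXi). Qed.

Let hYV : family_mx (fun m => invmx (Y m)).
Proof. by apply: (family_invmx oU hY) => m Um; split; [apply: Yp|apply: Y0]. Qed.

Let uD : D \in unitmx.
Proof.
have E := mulmx_diag2 (oner_neq0 _) (varL_neq0 C).
exact: (mulmx1_unit E).1.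
Qed.

Let eqY m : U m -> connection_eq (Y m) (diag2 (L1 m) (L2 m)) (Om m).
Proof.
move=> Um; apply: (connection_eq_mulr uD); last exact: app_solves (sol Um).
apply: mx2P; rewrite [LHS]map_mxE oppmxE mulmx2E !diag2E ?derivL1 ?raddf0 ?derivL_var.
- by rewrite !(mul0r, mulr0, addr0) oppr0.
- by rewrite !(mul0r, mulr0, addr0) oppr0.
- by rewrite !(mul0r, mulr0, addr0) oppr0.
- rewrite mul0r add0r monoLM mulr1 -[RHS]mul1r; apply: laurentP => k.
  by rewrite mul1r coefLN coefL1 coef_monoL; case: eqP; rewrite ?opprK ?oppr0.
Qed.

Let hL1 : family L1. Proof. exact: family_const. Qed.
Let hL2 : family L2. Proof. exact: family_const. Qed.

Let hOm : family_mx Om.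
Proof.
have H : family_mx (fun m => (Y m *m diag2 (L1 m) (L2 m) - (Y m)^z) *m invmx (Y m)).
  apply: (family_mxM oU _ hYV); apply: (family_mxB oU); last exact: family_mx_deriv.
  by apply: (family_mxM oU hY); apply: family_diag2.
apply: (family_mx_eq oU _ H) => m Um; apply/esym.
have E : Om m *m Y m = Y m *m diag2 (L1 m) (L2 m) - (Y m)^z.
  have := eqY Um; rewrite /connection_eq addrC => /eqP; rewrite addr_eq0 opprB => /eqP.
  exact.
by rewrite -E (mulmxK (uY Um)).
Qed.

Let resL1 m v : U m -> resL (dcoef v L1 m) = 0.
Proof. by move=> _; rewrite /L1 dcoef_const. Qed.
Let resL2 m v : U m -> resL (dcoef v L2 m) = 0.
Proof. by move=> _; rewrite /L2 dcoef_const. Qed.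

Let form := residue_form c Y Om L1 L2.

Lemma apparent_linear m a v w u : U m -> form m (a *: v + w) u = a * form m v u + form m w u.
Proof. exact: (residue_form_linear oU hc hY hL1 hL2 hOm). Qed.

Lemma apparent_holomorphic v w : holomorphic_on U (fun m => form m v w).
Proof. exact: (holomorphic_residue_form oU hc hY hYV hL1 hL2 hOm). Qed.

Let varyL1 v m : vary c v L1 m = 0.
Proof. by rewrite /L1 vary_const raddf0 mulr0 oppr0. Qed.

Let varyL2 v m : vary c v L2 m = monoL (- 'D_v c m) (-2).
Proof.
rewrite /L2 vary_const derivL_mono mulrN1z opprK monoLM mulr1.
by apply: laurentP => k; rewrite coefLN !coef_monoL add0r; case: eqP; rewrite ?oppr0.
Qed.

Let primL1 v m : vary_prim c v L1 m = 0.
Proof.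
by rewrite vary_primE /L1 dcoef_const mulr0 subr0; apply: laurentP => k; rewrite primLE mul0r if_same.
Qed.

Let primL2 v m : vary_prim c v L2 m = monoL ('D_v c m) (-1).
Proof.
rewrite vary_primE /L2 dcoef_const monoLM mulrN1 add0r; apply: laurentP => k.
rewrite coefLB primLE mul0r if_same sub0r !coef_monoL.
by case: eqP; rewrite ?opprK ?oppr0.
Qed.

(** With x fixed, diag(1, z) varies by diag(0, - dq), that is, by minus diag(0, dq / z) times
    itself: the variation of its exponents. *)
Lemma dlog_qE v m : U m -> dlog_q F j v m = log_variation c Y L1 L2 v m.
Proof.
move=> Um.
have ED : vary_mx c v (fun=> D) m = - (diag2 0 (monoL ('D_v c m) (-1)) *m D).
  rewrite (vary_diag2 oU c v (fun=> 1) (fun=> z) Um) !vary_const derivL1 derivL_var.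
  rewrite mulr0 oppr0 mulr1; apply: mx2P; rewrite oppmxE mulmx2E !diag2E.
  - by rewrite !(mul0r, mulr0, addr0) oppr0.
  - by rewrite !(mul0r, mulr0, addr0) oppr0.
  - by rewrite !(mul0r, mulr0, addr0) oppr0.
  - by rewrite mul0r add0r monoLM mulr1.
have E : vary_mx c v (fun x => Y x *m D) m =
    vary_mx c v Y m *m D - Y m *m (diag2 0 (monoL ('D_v c m) (-1)) *m D).
  by rewrite (vary_mxM oU c v hY (family_mx_const U D) Um) ED mulmxN.
rewrite /log_variation primL1 primL2 -(dlog_diag _ _ (uY Um) uD) -E.
by [].
Qed.

Lemma form_q_wedge m v1 v2 : U m ->
  res_wedge (fun v => vary_mx c v (Omega_q N j) m) (fun v => dlog_q F j v m) v1 v2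
  = form m v1 v2.
Proof. by move=> Um; rewrite /form /residue_form /res_wedge !dlog_qE. Qed.

Definition apparent_coef m : C := Xiq F j m 1 1 1.

Let dXi v m : 'M[laurent C]_2 := \matrix_(a, b) dcoef v (fun x => Xi x a b) m.

Let frame_y v m : U m -> let y := invmx (Y m) *m vary_mx c v Y m in
  Xi m *m y = mx2 0 0 (cst ('D_v (fun x => p_of x j) m)) 0 *m Xi m
              + (dXi v m - cst ('D_v c m) *: (Xi m)^z).
Proof.
move=> Um y; apply: (unipotent_frame (p := cst (p_of m j))).
have -> : mx2 1 0 (cst (p_of m j)) 1 *m Xi m *m y = vary_mx c v Y m := mulKVmx (uY Um) _.
have EA : vary_mx c v A m = mx2 0 0 (cst ('D_v (fun x => p_of x j) m)) 0.
  apply: mx2P; rewrite vary_mxE mx2E.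
  - rewrite (vary_eq oU (g := fun=> 1) c v Um) => [|x _]; last by rewrite mx2E.
    by rewrite vary_const derivL1 mulr0 oppr0.
  - rewrite (vary_eq oU (g := fun=> 0) c v Um) => [|x _]; last by rewrite mx2E.
    by rewrite vary_const raddf0 mulr0 oppr0.
  - rewrite (vary_eq oU (g := fun x => cst (p_of x j)) c v Um) => [|x _]; last by rewrite mx2E.
    exact: (vary_cst oU c v hp Um).
  - rewrite (vary_eq oU (g := fun=> 1) c v Um) => [|x _]; last by rewrite mx2E.
    by rewrite vary_const derivL1 mulr0 oppr0.
have EX : vary_mx c v Xi m = dXi v m - cst ('D_v c m) *: (Xi m)^z.
  by apply/matrixP => a b; rewrite vary_mxE addmxE oppmxE scalemxE map_mxE [dXi _ _ _ _]mxE.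
by rewrite (vary_mxM oU c v hA hXi Um) EA EX.
Qed.

Lemma apparent_residue m v1 v2 : U m ->
  Defs.half C * form m v1 v2 = wedge apparent_coef c m v1 v2.
Proof.
move=> Um; rewrite /form (residue_formE oU c hY hL1 hL2 hOm uY eqY resL1 resL2 v1 v2 Um).
rewrite mulrA mulVf ?pnatr_eq0 // mul1r.
have V1 := variation_family oU c hY hL1 hL2 hOm eqY v1 Um.
rewrite varyL1 varyL2 in V1.
have yp v : is_power_series_mx (invmx (Y m) *m vary_mx c v Y m).
  exact: (zero_below_mxM (a := 0) (b := 0) _ (YVp Um) (ps_vary_mx oU c v Um Yp)).
have H := residue_apparent ('D_v2 c m) (uY Um) (eqY Um) V1 (yp v1) (yp v2).
rewrite /log_variation primL1 primL2 [LHS]H.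
have dXip v : is_power_series_mx (dXi v m).
  by move=> a b; rewrite mxE; apply: (zero_below_dcoef oU v Um) => x Ux; apply: Xip.
have dXi0 v : Defs.coefM (dXi v m) 0 = 0.
  apply/matrixP => a b; rewrite !mxE (dcoefE oU v 0 (hXi a b) Um).
  by apply: (derive_eq_cst oU (a := (a == b)%:R) _ Um) => x Ux; apply: Xi0E.
have dXi1 v : dXi v m 1 1 1 = 'D_v apparent_coef m.
  by rewrite mxE (dcoefE oU v 1 (hXi 1 1) Um).
have [a1 b1 e1] := apparent_frame_coefs (Xip Um) (Xi0 Um) (dXip v1) (dXi0 v1) (yp v1) (frame_y v1 Um).
have [a2 b2 e2] := apparent_frame_coefs (Xip Um) (Xi0 Um) (dXip v2) (dXi0 v2) (yp v2) (frame_y v2 Um).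
(* The terms in dp_j /\ dq_j coming from [y 1 1] cancel against those of the off-diagonal products,
   and all that is proportional to dq_j alone drops out by antisymmetry. *)
have G (a b e e' p1 p2 q1 q2 d1 d2 d1' d2' x1 x2 y1 y2 w1 w2 : C) :
    x1 = p1 - q1 * b -> x2 = p2 - q2 * b -> y1 = - q1 * a -> y2 = - q2 * a ->
    w1 = p1 * a + d1 - q1 * (2%:R * e') + q1 * (b * a + e ^+ 2) ->
    w2 = p2 * a + d2 - q2 * (2%:R * e') + q2 * (b * a + e ^+ 2) ->
    d1 = d1' -> d2 = d2' ->
    q2 * w1 - q1 * w2 + (x1 * y2 - x2 * y1) = d1' * q2 - d2' * q1.
  by move=> -> -> -> -> -> -> -> ->; ring.
exact: G a1 a2 b1 b2 e1 e2 (dXi1 v1) (dXi1 v2).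
Qed.

End Apparent.

Section ApparentCoefficient.
Local Open Scope classical_set_scope.
Variables (R : realType) (S : setting R) (N : phase S -> normal_form S) (F : formal_solutions S).
Hypothesis solF : are_formal_solutions N F.
Local Notation C := (CC R).
Local Notation U := (@phase_set R S).
Local Notation z := (varL C).
Local Notation cst := (@cstL C).

(** Near q_j one has c0 = p_j / z + r and d0 = - 1/z + t with [r] and [t] regular, so
    [apparent_solution_coef] gives p_j / P(q_j) - t(q_j). The poles of d0 at the other q_k are the
    part of t(q_j) absent from [eta_q]. *)
Lemma apparent_coefE j m : U m ->
  apparent_coef F j m = eta_q N j m + \sum_(k | k != j) (q_of m j - q_of m k)^-1.
Proof.
move=> Um; have [_ qinj qt] := Um; have sol := fs_app solF j Um.
set q := q_of m j; set p := p_of m j; pose X := cst q + z.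
have zv : has_value z 0 by split; [apply: zero_below_mono|].
have Xv : has_value X q by rewrite -[q]addr0; apply: has_valueD (has_value_cst _) zv.
have Xc a : has_value (X - cst a) (q - a).
  exact: has_valueD Xv (has_valueN (has_value_cst _)).
have qk k : k != j -> q - q_of m k != 0.
  by move=> kj; rewrite subr_eq0 (inj_eq qinj) eq_sym.
have fracv (f : {poly C}) i : has_value (evalL f X / (X - cst (t_of (proj m) i)) ^+ pole (Some i))
    (f.[q] / (q - t_of (proj m) i) ^+ pole (Some i)).
  apply: has_valueM (has_value_evalL f Xv) (has_valueV (has_valueX _ (Xc _)) _).
  by apply: expf_neq0; rewrite subr_eq0; apply: qt.
have Pq : (P_pol (proj m)).[q] != 0.
  rewrite /P_pol horner_prod; apply/prodf_neq0 => i _.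
  by rewrite horner_exp hornerXsubC; apply: expf_neq0; rewrite subr_eq0; apply: qt.
have gv := has_valueV (has_value_evalL (P_pol (proj m)) Xv) Pq.
pose t : laurent C := \sum_i evalL (D_fin (N m) i) X / (X - cst (t_of (proj m) i)) ^+ pole (Some i)
  - \sum_(k | k != j) 1 / (X - cst (q_of m k)) + evalL (D_inf (N m)) X.
pose t0 : C := \sum_i (D_fin (N m) i).[q] / (q - t_of (proj m) i) ^+ pole (Some i)
  - \sum_(k | k != j) (q - q_of m k)^-1 + (D_inf (N m)).[q].
have tv : has_value t t0.
  apply: has_valueD (has_value_evalL _ Xv); apply: has_valueD.
    by apply: has_value_sum => i _; apply: fracv.
  apply/has_valueN/has_value_sum => k kj; rewrite div1r.
  by apply: has_valueV (Xc _) (qk _ kj).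
pose r : laurent C := \sum_i evalL (C_fin (N m) i) X / (X - cst (t_of (proj m) i)) ^+ pole (Some i)
  + \sum_(k | k != j) cst (p_of m k) / (X - cst (q_of m k))
  + evalL (C_tld (N m)) X + X ^+ n_app S * evalL (C_inf (N m)) X.
have rp : is_power_series r.
  apply: zero_belowD; last first.
    by have [] := has_valueM (has_valueX (n_app S) Xv) (has_value_evalL (C_inf (N m)) Xv).
  apply: zero_belowD; last by have [] := has_value_evalL (C_tld (N m)) Xv.
  apply: zero_belowD; apply: zero_below_sum => k kj.
    by have [] := fracv (C_fin (N m) k) k.
  by have [] := has_valueM (has_value_cst (p_of m k)) (has_valueV (Xc _) (qk _ kj)).
have Xq : X - cst q = z by rewrite /X addrAC subrr add0r.
have c0E : c0 m (N m) X = cst p * z^-1 + r.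
  rewrite /c0 (bigD1 j) //= Xq /r -/p.
  have G (K : comPzRingType) (a b d e f : K) : a + (b + d) + e + f = b + (a + d + e + f).
    by ring.
  exact: G.
have d0E : d0 m (N m) X = - z^-1 + t.
  rewrite /d0 (bigD1 j) //= Xq /t div1r.
  have G (K : comPzRingType) (a b d e : K) : a - (b + d) + e = - b + (a - d + e) by ring.
  exact: G.
have XD : derivL X = 1 by rewrite raddfD /= derivL_cst derivL_var add0r.
have X0 := app_Xi0 sol; have Xp := app_Xi sol.
have X01 : has_value (Xiq F j m 0 1) 0.
  by split; [exact: Xp|have /matrixP/(_ 0 1) := X0; rewrite !mxE].
have X11 : has_value (Xiq F j m 1 1) 1.
  by split; [exact: Xp|have /matrixP/(_ 1 1) := X0; rewrite !mxE].
have psi01 : psi_q F j m 0 1 = Xiq F j m 0 1 * z.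
  by rewrite /psi_q !mulmx2E !diag2E !mx2E mulr0 add0r mul1r mul0r addr0.
have psi11 : psi_q F j m 1 1 = (cst p * Xiq F j m 0 1 + Xiq F j m 1 1) * z.
  by rewrite /psi_q !mulmx2E !diag2E !mx2E mulr0 add0r mul1r.
have E := app_solves sol.
have Om0 := Omega0_entries m (N m) X.
have E1 : derivL (Xiq F j m 0 1 * z) + (evalL (P_pol (proj m)) X)^-1 *
    ((cst p * Xiq F j m 0 1 + Xiq F j m 1 1) * z) = 0.
  have /matrixP/(_ 0 1) := E; rewrite addmxE map_mxE psi01 mulmx2E psi01 psi11 !Om0 XD.
  by rewrite mul1r mul0r add0r [RHS]mxE.
have E2 : derivL ((cst p * Xiq F j m 0 1 + Xiq F j m 1 1) * z) +
    ((cst p * z^-1 + r) * (Xiq F j m 0 1 * z) +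
     (- z^-1 + t) * ((cst p * Xiq F j m 0 1 + Xiq F j m 1 1) * z)) = 0.
  have /matrixP/(_ 1 1) := E; rewrite addmxE map_mxE psi11 mulmx2E psi01 psi11 !Om0 XD.
  by rewrite !mul1r c0E d0E [RHS]mxE.
have := apparent_solution_coef X01 X11 gv rp tv E1 E2.
rewrite /apparent_coef => ->; rewrite /eta_q /t0 -/q -/p.
have G (K : comPzRingType) (a b d e : K) : e - (a - b + d) = e - a - d + b by ring.
exact: G.
Qed.

End ApparentCoefficient.

(** * Comparison of the two forms *)

Section TwoForms.
Local Open Scope classical_set_scope.
Variables (R : realType) (S : setting R).
Local Notation C := (CC R).
Local Notation U := (@phase_set R S).
Let oU : open U := @open_phase_set R S.
Implicit Types (w : phase S -> phase S -> phase S -> C) (f g : phase S -> C).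

Lemma derive_bigsum (J : Type) (r : seq J) (P : pred J) (h : J -> phase S -> C) (m v : phase S) :
  U m -> (forall j, P j -> holomorphic_on U (h j)) ->
  'D_v (fun x => \sum_(j <- r | P j) h j x) m = \sum_(j <- r | P j) 'D_v (h j) m.
Proof.
move=> Um hh; elim: r => [|j r IH].
  by rewrite big_nil; apply: (derive_eq_cst oU (a := 0) _ Um) => x _; rewrite big_nil.
have hr := @holomorphic_sum R (phase S) U J r P h oU hh.
rewrite big_cons -IH; case: ifPn => Pj.
  have <- := deriveD (holomorphic_derivable (v := v) (hh j Pj) Um)
    (holomorphic_derivable (v := v) hr Um).
  by apply: (derive_eq oU v Um) => x _; rewrite big_cons Pj.
by apply: (derive_eq oU v Um) => x _; rewrite big_cons (negPf Pj).
Qed.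

Definition two_form w :=
  [/\ forall m, U m -> forall a x y u, w m (a *: x + y) u = a * w m x u + w m y u,
      forall m, U m -> forall x y, w m x y = - w m y x
    & forall x y, holomorphic_on U (fun m => w m x y)].

Lemma two_form_eq w w' : (forall m v1 v2, U m -> w m v1 v2 = w' m v1 v2) ->
  two_form w -> two_form w'.
Proof.
move=> ww [wl wa wh]; split.
- by move=> m Um a x y u; rewrite -!ww // wl.
- by move=> m Um x y; rewrite -!ww // wa.
- by move=> x y; apply: (holomorphic_eq oU _ (wh x y)) => m Um; apply: ww.
Qed.

Lemma two_formD w w' : two_form w -> two_form w' ->
  two_form (fun m v1 v2 => w m v1 v2 + w' m v1 v2).
Proof.
move=> [wl wa wh] [wl' wa' wh']; split.
- by move=> m Um a x y u; rewrite wl // wl' // mulrDr addrACA.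
- by move=> m Um x y; rewrite wa // wa' // opprD.
- by move=> x y; apply: (holomorphicD oU (wh x y) (wh' x y)).
Qed.

Lemma two_formZ c w : two_form w -> two_form (fun m v1 v2 => c * w m v1 v2).
Proof.
move=> [wl wa wh]; split.
- by move=> m Um a x y u; rewrite wl // mulrDr mulrCA.
- by move=> m Um x y; rewrite wa // mulrN.
- by move=> x y; apply: (holomorphicM oU (holomorphic_cst U c) (wh x y)).
Qed.

Lemma two_formB w w' : two_form w -> two_form w' ->
  two_form (fun m v1 v2 => w m v1 v2 - w' m v1 v2).
Proof.
move=> hw hw'; apply: two_form_eq (two_formD hw (two_formZ (-1) hw')) => m v1 v2 _.
by rewrite mulN1r.
Qed.

Lemma two_form_sum (J : finType) (P : pred J) (w : J -> phase S -> phase S -> phase S -> C) :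
  (forall j, P j -> two_form (w j)) -> two_form (fun m v1 v2 => \sum_(j | P j) w j m v1 v2).
Proof.
move=> hw; split.
- move=> m Um a x y u; rewrite mulr_sumr -big_split; apply: eq_bigr => j Pj.
  by have [wl _ _] := hw j Pj; apply: wl.
- move=> m Um x y; rewrite -sumrN; apply: eq_bigr => j Pj.
  by have [_ wa _] := hw j Pj; apply: wa.
- move=> x y.
  have := @holomorphic_sum R (phase S) U J (index_enum J) P (fun j m => w j m x y) oU.
  by apply=> j Pj; have [_ _ wh] := hw j Pj; apply: wh.
Qed.

Lemma two_form_wedge f g : holomorphic_on U f -> holomorphic_on U g -> two_form (wedge f g).
Proof.
move=> hf hg; split.
- move=> m Um a x y u; rewrite /wedge.
  rewrite (derive_linear a x y (holomorphic_differentiable hf Um)).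
  rewrite (derive_linear a x y (holomorphic_differentiable hg Um)).
  have G (K : comPzRingType) (b p q r s t' u' : K) : (b * p + q) * t' - u' * (b * r + s) =
      b * (p * t' - u' * r) + (q * t' - u' * s) by ring.
  exact: G.
- by move=> m Um x y; rewrite /wedge opprB.
- move=> x y; apply: (holomorphicB oU); apply: (holomorphicM oU);
    exact: holomorphic_derive.
Qed.

(** A vector differs from the lift (0, x) of its projection x by a vertical one, which linearity
    lets one discard; antisymmetry does the same for the second argument. *)
Lemma section_of_two_form w : two_form w ->
  (forall m v1 v2, U m -> proj v1 = 0 -> w m v1 v2 = 0) -> section_of_pullback w.
Proof.
move=> [wl wa wh] wv.
pose lift (x : base S) : phase S := (0, x).
have wlift m u v : U m -> w m u v = w m (lift (proj u)) v.
  move=> Um; have E : u = 1 *: (u - lift (proj u)) + lift (proj u).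
    by rewrite scale1r subrK.
  by rewrite {1}E wl // wv ?mulr0 ?add0r //; apply: subrr.
exists (fun m x y => w m (lift x) (lift y)); split.
- by move=> m Um v1 v2; rewrite wlift // wa // wlift // -wa.
- move=> m Um a x y u; have -> : lift (a *: x + y) = a *: lift x + lift y.
    by congr pair; rewrite /= scaler0 addr0.
  exact: wl.
- by move=> m Um x y; apply: wa.
- by move=> x y; apply: wh.
Qed.

End TwoForms.

Section Comparison.
Local Open Scope classical_set_scope.
Variables (R : realType) (S : setting R) (N : phase S -> normal_form S) (F : formal_solutions S).
Hypothesis solF : are_formal_solutions N F.
Local Notation C := (CC R).
Local Notation I := (option 'I_(nu S)).
Local Notation U := (@phase_set R S).
Let oU : open U := @open_phase_set R S.

Definition unr_form (i : I) :=
  residue_form (Defs.center i) (framed F i) (Omega_unr N i) (dlambda F i true) (dlambda F i false).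

Definition ram_residue_form (i : I) :=
  residue_form (fun=> 0) (framed_ram F i) (Omega_ram N i) (dlambda_ram F i true) (dlambda_ram F i false).

Definition apparent_form (j : 'I_(n_app S)) :=
  residue_form (fun x => q_of x j) (fun m => mx2 1 0 (cstL (p_of m j)) 1 *m Xiq F j m)
    (Omega_q N j) (fun=> 0) (fun=> monoL (-1) (-1)).

(** At the t_i this is unfolding only; at the q_j the solution must first be rewritten with
    exponents. *)
Lemma omega_hatE m v1 v2 : U m -> omega_hat N F m v1 v2 =
  \sum_(i | ~~ is_ram (typ i)) Defs.half C * unr_form i m v1 v2
  + \sum_(i | is_ram (typ i)) 4%:R^-1 * ram_residue_form i m v1 v2
  + \sum_j Defs.half C * apparent_form j m v1 v2.
Proof.
move=> Um.
have Eu i : res_wedge (fun v => vary_mx (Defs.center i) v (Omega_unr N i) m)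
    (fun v => dlog_unr F i v m) v1 v2 = unr_form i m v1 v2 by [].
have Er i : res_wedge (fun v => vary_mx (fun=> 0) v (Omega_ram N i) m)
    (fun v => dlog_ram F i v m) v1 v2 = ram_residue_form i m v1 v2 by [].
have Ea j : res_wedge (fun v => vary_mx (fun x => q_of x j) v (Omega_q N j) m)
    (fun v => dlog_q F j v m) v1 v2 = apparent_form j m v1 v2 := form_q_wedge solF j v1 v2 Um.
have -> : omega_hat N F m v1 v2 = Defs.half C * \sum_(i | ~~ is_ram (typ i)) unr_form i m v1 v2
    + 4%:R^-1 * \sum_(i | is_ram (typ i)) ram_residue_form i m v1 v2
    + Defs.half C * \sum_j apparent_form j m v1 v2.
  by rewrite -(eq_bigr _ (fun j _ => Ea j)).
by rewrite !mulr_sumr.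
Qed.

Lemma holomorphic_inv_q j k : k != j -> holomorphic_on U (fun m => (q_of m j - q_of m k)^-1).
Proof.
move=> kj; apply: (holomorphicV oU _ (holomorphicB oU (holomorphic_q U j) (holomorphic_q U k))) => m [_ qi _].
by rewrite subr_eq0 (inj_eq qi) eq_sym.
Qed.

Lemma holomorphic_apparent_coef j : holomorphic_on U (apparent_coef F j).
Proof. exact: (fs_Xiq solF j 1 1 1). Qed.

Lemma holomorphic_sum_inv_q j : holomorphic_on U (fun m => \sum_(k | k != j) (q_of m j - q_of m k)^-1).
Proof.
have := @holomorphic_sum R (phase S) U _ (index_enum 'I_(n_app S)) (fun k => k != j)
  (fun k m => (q_of m j - q_of m k)^-1) oU.
by apply=> k kj; apply: holomorphic_inv_q.
Qed.

Lemma eta_qE j m : U m ->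
  apparent_coef F j m - \sum_(k | k != j) (q_of m j - q_of m k)^-1 = eta_q N j m.
Proof. by move=> Um; rewrite (apparent_coefE solF j Um) addrK. Qed.

(** Read off not from the explicit formula but from its equality with a coefficient of the solution
    minus the (q_j - q_k)^-1. *)
Lemma holomorphic_eta_q j : holomorphic_on U (eta_q N j).
Proof. by apply: (holomorphic_eq oU (eta_qE j)); apply: (holomorphicB oU (holomorphic_apparent_coef j) (holomorphic_sum_inv_q j)). Qed.

Lemma holomorphic_divn (f : phase S -> C) k : holomorphic_on U f -> holomorphic_on U (fun m => f m / k%:R).
Proof. by move=> hf; apply: (holomorphicM oU hf); apply: holomorphic_cst. Qed.

Lemma holomorphic_th_unr_proj i s l : holomorphic_on U (fun m => th_unr (proj m) i s l).
Proof. exact: (@holomorphic_proj R S U _ _ (@base_of_phase R S) (holomorphic_th_unr _ i s l)). Qed.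

Lemma holomorphic_th_ram_proj i l : holomorphic_on U (fun m => th_ram (proj m) i l).
Proof. exact: (@holomorphic_proj R S U _ _ (@base_of_phase R S) (holomorphic_th_ram _ i l)). Qed.

Lemma holomorphic_t_proj i : holomorphic_on U (fun m => t_of (proj m) i).
Proof. exact: (@holomorphic_proj R S U _ _ (@base_of_phase R S) (holomorphic_t _ i)). Qed.

Lemma holomorphic_H_t i : ~~ is_ram (typ (Some i)) -> holomorphic_on U (H_t F i).
Proof.
move=> ni; have H s : holomorphic_on U (fun m => \sum_(l < pole (Some i))
    th F (Some i) s l m * th F (Some i) s (2 * pole (Some i) - l - 1) m).
  have := @holomorphic_sum R (phase S) U _ (index_enum 'I_(pole (Some i))) predT
    (fun l m => th F (Some i) s l m * th F (Some i) s (2 * pole (Some i) - l - 1) m) oU.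
  by apply=> l _; apply: (holomorphicM oU); apply: (fs_th solF _ _ ni).
exact: (holomorphicD oU (H true) (H false)).
Qed.

Lemma two_form_omega_hat : two_form (omega_hat N F).
Proof.
apply: (two_form_eq (w := fun m v1 v2 =>
  \sum_(i | ~~ is_ram (typ i)) Defs.half C * unr_form i m v1 v2
  + \sum_(i | is_ram (typ i)) 4%:R^-1 * ram_residue_form i m v1 v2
  + \sum_j Defs.half C * apparent_form j m v1 v2)).
  by move=> m v1 v2 Um; rewrite omega_hatE.
apply: two_formD; first apply: two_formD.
- apply: (two_form_sum (w := fun i m v1 v2 => Defs.half C * unr_form i m v1 v2)) => i ni.
  apply: two_formZ; split.
  + by move=> m Um a x y u; apply: (unr_linear solF ni).
  + by move=> m _ x y; apply: residue_form_antisym.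
  + by move=> x y; apply: (unr_holomorphic solF ni).
- apply: (two_form_sum (w := fun i m v1 v2 => 4%:R^-1 * ram_residue_form i m v1 v2)) => i ri.
  apply: two_formZ; split.
  + by move=> m Um a x y u; apply: (ram_linear solF ri).
  + by move=> m _ x y; apply: residue_form_antisym.
  + by move=> x y; apply: (ram_holomorphic solF ri).
- apply: (two_form_sum (w := fun j m v1 v2 => Defs.half C * apparent_form j m v1 v2)) => j _.
  apply: two_formZ; split.
  + by move=> m Um a x y u; apply: (apparent_linear solF).
  + by move=> m _ x y; apply: residue_form_antisym.
  + by move=> x y; apply: (apparent_holomorphic solF).
Qed.

Lemma two_form_omega_hat' : two_form (omega_hat' N F).
Proof.
apply: two_formD; first apply: two_formD; first apply: two_formD.
- apply: (two_form_sum (w := fun j => wedge (eta_q N j) (fun x => q_of x j))) => j _.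
  exact: two_form_wedge (holomorphic_eta_q j) (holomorphic_q U j).
- apply: (two_form_sum (w := fun i m v1 v2 => \sum_(l < (pole i).-1)
      (wedge (H_th F i true l) (fun m' => th_unr (proj m') i true l) m v1 v2
       + wedge (H_th F i false l) (fun m' => th_unr (proj m') i false l) m v1 v2))) => i ui.
  have ni : ~~ is_ram (typ i) by case: (typ i) ui.
  have hH s l : holomorphic_on U (H_th F i s l) by apply/holomorphic_divn/(fs_th solF _ _ ni).
  apply: (two_form_sum (w := fun (l : 'I__) m v1 v2 =>
      (wedge (H_th F i true l) (fun m' => th_unr (proj m') i true l) m v1 v2
       + wedge (H_th F i false l) (fun m' => th_unr (proj m') i false l) m v1 v2))) => l _.
  by apply: two_formD; apply: two_form_wedge => //; apply: holomorphic_th_unr_proj.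
- apply: (two_form_sum (w := fun i m v1 v2 => \sum_(l < 2 * pole i - 2)
      wedge (H_thr F i l) (fun m' => th_ram (proj m') i l) m v1 v2)) => i ri.
  apply: (two_form_sum (w := fun (l : 'I__) => wedge (H_thr F i l) (fun m' => th_ram (proj m') i l))) => l _.
  by apply: two_form_wedge; [apply/holomorphic_divn/(fs_thr solF _ ri) | apply: holomorphic_th_ram_proj].
- apply: (two_form_sum (w := fun i => wedge (H_t F i) (fun m' => t_of (proj m') i))) => i /andP[_ ni].
  by apply: two_form_wedge; [apply: holomorphic_H_t | apply: holomorphic_t_proj].
Qed.

End Comparison.

Section Derivatives.
Local Open Scope classical_set_scope.
Variables (R : realType) (S : setting R).
Local Notation C := (CC R).
Local Notation U := (@phase_set R S).

Lemma derive_inv (f : phase S -> C) (m v : phase S) : U m -> holomorphic_on U f -> f m != 0 ->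
  'D_v (fun x => (f x)^-1) m = - 'D_v f m / f m ^+ 2.
Proof.
move=> Um hf f0.
have E := @deriveV C (phase S) f m v f0 (holomorphic_derivable (v := v) hf Um).
rewrite [LHS]E.
have G (K : fieldType) (a b : K) : - b^-1 *: (a : K^o) = - a / b by rewrite scaleNr mulNr; congr (- _); apply: mulrC.
exact: G.
Qed.

Lemma derive_sub (f g : phase S -> C) (m v : phase S) : U m -> holomorphic_on U f -> holomorphic_on U g ->
  'D_v (fun x => f x - g x) m = 'D_v f m - 'D_v g m.
Proof.
move=> Um hf hg; exact: (deriveB (holomorphic_derivable (v := v) hf Um) (holomorphic_derivable (v := v) hg Um)).
Qed.
End Derivatives.

Section ApparentComparison.
Local Open Scope classical_set_scope.
Variables (R : realType) (S : setting R) (N : phase S -> normal_form S) (F : formal_solutions S).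
Hypothesis solF : are_formal_solutions N F.
Local Notation C := (CC R).
Local Notation U := (@phase_set R S).
Let oU : open U := @open_phase_set R S.

Lemma wedge_vertical f (g : base S -> C) m v1 v2 : proj v1 = 0 ->
  wedge f (fun x => g (proj x)) m v1 v2 = 'D_v1 f m * 'D_v2 (fun x => g (proj x)) m.
Proof.
move=> v0; have D0 : 'D_v1 (fun x => g (proj x)) m = 0 := derive_vertical g m v0.
have G (K : comPzRingType) (a b d e : K) : e = 0 -> a * b - d * e = a * b.
  by move=> ->; rewrite mulr0 subr0.
exact: G D0.
Qed.

Lemma sum_antisym0 (K : numFieldType) n (w : 'I_n -> 'I_n -> K) :
  (forall j k, w j k = - w k j) -> \sum_j \sum_(k | k != j) w j k = 0.
Proof.
move=> wa; set s := \sum_j _.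
have E : s = - s.
  rewrite {1}/s (exchange_big_dep predT) //= -sumrN; apply: eq_bigr => k _.
  rewrite -sumrN; apply: eq_big => [j|j _]; last exact: wa.
  by rewrite eq_sym.
have : s *+ 2 == 0 by rewrite mulr2n {1}E addNr.
by rewrite mulrn_eq0 /= => /eqP.
Qed.

(* [apparent_coef] and [eta_q] differ by the terms [(q_j - q_k)^-1], and        *)
(* [d (q_j - q_k)^-1 /\ dq_j] is antisymmetric in [j] and [k].                  *)
Lemma sum_apparent m v1 v2 : U m ->
  \sum_j Defs.half C * apparent_form N F j m v1 v2 =
  \sum_j wedge (eta_q N j) (fun x => q_of x j) m v1 v2.
Proof.
move=> Um; pose dq v k := 'D_v (fun x => q_of x k) m.
pose w j k := (dq v2 k * dq v1 j - dq v1 k * dq v2 j) / (q_of m j - q_of m k) ^+ 2.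
have DV v j k : k != j -> 'D_v (fun x => (q_of x j - q_of x k)^-1) m =
    - (dq v j - dq v k) / (q_of m j - q_of m k) ^+ 2.
  move=> kj; have hd := holomorphicB oU (holomorphic_q U j) (holomorphic_q U k).
  have d0 : q_of m j - q_of m k != 0.
    by have [_ qi _] := Um; rewrite subr_eq0 (inj_eq qi) eq_sym.
  by rewrite (derive_inv v Um hd d0) (derive_sub v Um (holomorphic_q U j) (holomorphic_q U k)).
have De v j : 'D_v (eta_q N j) m = 'D_v (apparent_coef F j) m
    + \sum_(k | k != j) (dq v j - dq v k) / (q_of m j - q_of m k) ^+ 2.
  rewrite -(derive_eq oU v Um (eta_qE solF j)).
  rewrite (derive_sub v Um (holomorphic_apparent_coef solF j) (holomorphic_sum_inv_q j)); congr (_ + _).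
  have := derive_bigsum (index_enum 'I_(n_app S)) v Um (fun k => holomorphic_inv_q (j := j) (k := k)).
  move=> ->; rewrite -sumrN; apply: eq_bigr => k kj.
  by rewrite (DV v j k kj) mulNr opprK.
have wedgeE j : wedge (eta_q N j) (fun x => q_of x j) m v1 v2 =
    Defs.half C * apparent_form N F j m v1 v2 + \sum_(k | k != j) w j k.
  have -> : Defs.half C * apparent_form N F j m v1 v2 =
      wedge (apparent_coef F j) (fun x => q_of x j) m v1 v2 by exact: apparent_residue.
  have G (K : fieldType) (J : finType) (P : pred J) (a b d d' : K) (s s' t : J -> K) :
      (forall k, P k -> s k * b - s' k * a = t k) ->
      (d + \sum_(k | P k) s k) * b - (d' + \sum_(k | P k) s' k) * a =
      d * b - d' * a + \sum_(k | P k) t k.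
    move=> st; rewrite !mulrDl !mulr_suml opprD addrACA -sumrN -big_split /=.
    by congr (_ + _); apply: eq_bigr.
  rewrite /wedge (De v1 j) (De v2 j); apply: G => k _.
  have G' (K : fieldType) (a b c d e : K) : (a - b) / e * c - (c - d) / e * a = (d * a - b * c) / e.
    by ring.
  exact: G'.
have w0 : \sum_j \sum_(k | k != j) w j k = 0.
  apply: sum_antisym0 => j k.
  have G (K : fieldType) (a b c d p q : K) :
      (a * b - c * d) / (p - q) ^+ 2 = - ((d * c - b * a) / (q - p) ^+ 2).
    by rewrite -[q - p]opprB sqrrN; ring.
  exact: G.
rewrite -[LHS]addr0 -[X in _ + X]w0 -big_split.
by apply: eq_bigr => j _; rewrite wedgeE.
Qed.

End ApparentComparison.

Lemma sum_restrict (K : nmodType) (J : finType) (P Q : pred J) (h : J -> K) :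
  (forall i, P i -> ~~ Q i -> h i = 0) -> \sum_(i | P i) h i = \sum_(i | P i && Q i) h i.
Proof.
move=> h0; rewrite [LHS](bigID Q) /= [X in _ + X]big1 ?addr0 //.
by move=> i /andP[Pi Qi]; apply: h0.
Qed.

Lemma sum_split_restrict (K : nmodType) (J : finType) (P Q : pred J) (a b : J -> K) :
  (forall i, Q i -> P i) -> (forall i, P i -> ~~ Q i -> a i = 0) ->
  \sum_(i | P i) (a i + b i) = \sum_(i | Q i) a i + \sum_(i | P i) b i.
Proof.
move=> QP a0; rewrite big_split (sum_restrict a0); congr (_ + _).
by apply: eq_bigl => i; rewrite andb_idl //; apply: QP.
Qed.

Lemma sum_bool_split (K : nmodType) n (f g : bool -> K) (a b : 'I_n -> K) :
  f true = \sum_l a l -> f false = \sum_l b l ->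
  \sum_s (f s + g s) = \sum_l (a l + b l) + \sum_s g s.
Proof. by move=> ft ff; rewrite !big_split big_bool ft ff. Qed.

(** * Equality of the two forms when one argument is vertical *)

Section Vertical.
Local Open Scope classical_set_scope.
Variables (R : realType) (S : setting R) (N : phase S -> normal_form S) (F : formal_solutions S).
Hypothesis solF : are_formal_solutions N F.
Local Notation C := (CC R).
Local Notation I := (option 'I_(nu S)).
Local Notation U := (@phase_set R S).
Let oU : open U := @open_phase_set R S.

Lemma derive_divr (f : phase S -> C) (c : C) (m v : phase S) : U m -> holomorphic_on U f ->
  'D_v (fun x => f x / c) m = 'D_v f m / c.
Proof.
move=> Um hf.
have E := deriveZ c^-1 (holomorphic_derivable (v := v) hf Um).
have -> : 'D_v (fun x => f x / c) m = 'D_v (c^-1 \*: f) m.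
  by apply: (derive_eq oU v Um) => x _; rewrite [RHS]mulrC.
by rewrite [LHS]E [LHS]mulrC.
Qed.

Lemma derive_mul (f g : phase S -> C) (m v : phase S) : U m ->
  holomorphic_on U f -> holomorphic_on U g ->
  'D_v (fun x => f x * g x) m = f m * 'D_v g m + g m * 'D_v f m.
Proof.
move=> Um hf hg.
exact: (deriveM (holomorphic_derivable (v := v) hf Um) (holomorphic_derivable (v := v) hg Um)).
Qed.

Variables (m v1 v2 : phase S).
Hypotheses (Um : U m) (v0 : proj v1 = 0).

Lemma ram_contribution i : is_ram (typ i) -> 4%:R^-1 * ram_residue_form N F i m v1 v2 =
  \sum_(l < 2 * pole i - 2) wedge (H_thr F i l) (fun m' => th_ram (proj m') i l) m v1 v2.
Proof.
move=> ri; have -> := ram_vertical solF ri v2 Um v0; apply: eq_bigr => l _.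
rewrite [RHS](wedge_vertical _ (fun b => th_ram b i l) _ v2 v0).
have -> : 'D_v1 (H_thr F i l) m = 'D_v1 (thr F i (4 * (pole i).-1 - l)%N) m / (2 * (pole i).-1 - l)%:R.
  exact: (derive_divr _ v1 Um (fs_thr solF _ ri)).
have l1 : (l < 2 * pole i - 1)%N by have := ltn_ord l; lia.
have E : 'D_v2 (thr F i l) m = 'D_v2 (fun x => th_ram (proj x) i l) m.
  exact: (derive_eq oU v2 Um (fun x Ux => ram_th (fs_ram solF Ux ri) l1)).
exact: (congr1 ( *%R _) E).
Qed.

Section Unramified.
Variable i : I.
Hypothesis unr_i : ~~ is_ram (typ i).

Lemma derive_th s l v : (l < pole i)%N ->
  'D_v (th F i s l) m = 'D_v (fun x => th_unr (proj x) i s l) m.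
Proof.
move=> ln; exact: (derive_eq oU v Um (fun x Ux => unr_th (fs_unr solF Ux unr_i) s ln)).
Qed.

Lemma unr_th_contribution s :
  \sum_(l < (pole i).-1) 'D_v1 (th F i s (2 * pole i - l - 2)%N) m / (pole i - l - 1)%:R
    * 'D_v2 (th F i s l) m =
  \sum_(l < (pole i).-1) wedge (H_th F i s l) (fun m' => th_unr (proj m') i s l) m v1 v2.
Proof.
apply: eq_bigr => l _; rewrite [RHS](wedge_vertical _ (fun b => th_unr b i s l) _ v2 v0).
have -> : 'D_v1 (H_th F i s l) m =
    'D_v1 (th F i s (2 * pole i - l - 2)%N) m / (pole i - l - 1)%:R.
  exact: (derive_divr _ v1 Um (fs_th solF _ _ unr_i)).
have ln : (l < pole i)%N by have := ltn_ord l; lia.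
exact: (congr1 ( *%R _) (derive_th s v2 ln)).
Qed.

End Unramified.

Lemma H_t_contribution (k : 'I_(nu S)) : ~~ is_ram (typ (Some k)) ->
  \sum_s \sum_(l < pole (Some k)) th F (Some k) s l m
    * 'D_v1 (th F (Some k) s (2 * pole (Some k) - l - 1)%N) m * 'D_v2 (Defs.center (Some k)) m =
  wedge (H_t F k) (fun m' => t_of (proj m') k) m v1 v2.
Proof.
move=> nk; rewrite [RHS](wedge_vertical _ (fun b => t_of b k) _ v2 v0).
pose n := pole (Some k).
pose g s (l : 'I_n) x := th F (Some k) s l x * th F (Some k) s (2 * n - l - 1)%N x.
have hth s l : holomorphic_on U (th F (Some k) s l) := fs_th solF s l nk.
have hg s l : holomorphic_on U (g s l) := holomorphicM oU (hth s l) (hth s _).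
have hs s : holomorphic_on U (fun x => \sum_(l < n) g s l x).
  have := @holomorphic_sum R (phase S) U _ (index_enum 'I_n) predT (g s) oU.
  by apply=> l _; apply: hg.
have Ds s : 'D_v1 (fun x => \sum_(l < n) g s l x) m =
    \sum_(l < n) th F (Some k) s l m * 'D_v1 (th F (Some k) s (2 * n - l - 1)%N) m.
  have -> := derive_bigsum (index_enum 'I_n) v1 Um (fun l (_ : predT l) => hg s l).
  apply: eq_bigr => l _.
  have -> := derive_mul v1 Um (hth s l) (hth s (2 * n - l - 1)%N).
  (* For l < n the exponents are functions on the base, so only the other factor of each product is
     differentiated. *)
  have -> : 'D_v1 (th F (Some k) s l) m = 0.
    by rewrite (derive_th nk s v1 (ltn_ord l)); apply: (derive_vertical (fun b => th_unr b (Some k) s l)).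
  by rewrite mulr0 addr0.
have -> : 'D_v1 (H_t F k) m = \sum_s 'D_v1 (fun x => \sum_(l < n) g s l x) m.
  rewrite big_bool.
  exact: (deriveD (holomorphic_derivable (v := v1) (hs true) Um)
    (holomorphic_derivable (v := v1) (hs false) Um)).
rewrite mulr_suml; apply: eq_bigr => s _.
by rewrite Ds mulr_suml.
Qed.

Lemma center_contribution :
  \sum_(i | ~~ is_ram (typ i)) \sum_s \sum_(l < pole i) th F i s l m
    * 'D_v1 (th F i s (2 * pole i - l - 1)%N) m * 'D_v2 (Defs.center i) m =
  \sum_(i < nu S | (1 < i)%N && ~~ is_ram (typ (Some i)))
     wedge (H_t F i) (fun m' => t_of (proj m') i) m v1 v2.
Proof.
(* At t_1 = 0, t_2 = 1 and infinity the centre is constant, so these indices contribute nothing. *)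
pose Q (i : I) := if i is Some k then (1 < k)%N else false.
have -> := sum_restrict (Q := Q); last first.
  move=> i _ Qi; apply: big1 => s _; apply: big1 => l _.
  have D0 : 'D_v2 (Defs.center i) m = 0.
    case: i Qi {l} => [k|] k1; last exact: (derive_eq_cst oU (a := 0) _ Um).
    apply: (derive_eq_cst oU (a := if k == 0%N :> nat then 0 else 1) _ Um) => x _.
    rewrite /Defs.center /t_of; case: eqP => // k0; rewrite ifT //.
    by move: k1; rewrite /Q; lia.
  have G (K : comPzRingType) (a b e : K) : e = 0 -> a * b * e = 0 by move=> ->; rewrite mulr0.
  exact: G D0.
rewrite [LHS](reindex_omap Some id) /=; last by case=> [k|] //= /andP[].
apply: eq_big => [k|k /andP[/andP[nk _] _]]; first by rewrite eqxx andbT andbC.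
exact: H_t_contribution.
Qed.

(** The contributions of the unramified points split into exponents and centres, over different
    index sets: the irregular points for the former, the movable points for the latter. *)
Lemma omega_hat_vertical : omega_hat N F m v1 v2 = omega_hat' N F m v1 v2.
Proof.
rewrite (omega_hatE solF v1 v2 Um) [LHS]addrC (sum_apparent solF v1 v2 Um).
rewrite /omega_hat' -!addrA; congr (_ + _).
rewrite [X in _ = _ + X]addrC !addrA.
congr (_ + _); last by apply: eq_bigr => i ri; apply: ram_contribution.
rewrite -center_contribution.
transitivity (\sum_(i | ~~ is_ram (typ i)) (\sum_(l < (pole i).-1)
  (wedge (H_th F i true l) (fun m' => th_unr (proj m') i true l) m v1 v2
    + wedge (H_th F i false l) (fun m' => th_unr (proj m') i false l) m v1 v2)
  + \sum_s \sum_(l < pole i) th F i s l m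
    * 'D_v1 (th F i s (2 * pole i - l - 1)%N) m * 'D_v2 (Defs.center i) m)).
  apply: eq_bigr => i ni.
  have -> := unr_vertical solF ni v2 Um v0.
  exact: sum_bool_split (unr_th_contribution ni true) (unr_th_contribution ni false).
apply: sum_split_restrict => i; first by case: (typ i).
(* A regular point has pole order 1, so its sum over l < n_i - 1 is empty. *)
move=> ni nu; have := poleP i; have -> : is_reg (typ i) by case: (typ i) ni nu.
by move=> ->; rewrite big_ord0.
Qed.

End Vertical.

Theorem theorem4p12 (R : realType) (S : setting R)
    (N : phase S -> normal_form S) (F : formal_solutions S) :
  normal_form_family N ->
  are_formal_solutions N F ->
  section_of_pullback
    (fun m v1 v2 => omega_hat N F m v1 v2 - omega_hat' N F m v1 v2).
Proof.
move=> _ solF; apply: section_of_two_form.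
  exact: two_formB (two_form_omega_hat solF) (two_form_omega_hat' solF).
by move=> m v1 v2 Um v0; rewrite (omega_hat_vertical solF v2 Um v0) subrr.
Qed.
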